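(* Let $f\in\mathcal G^+[1]$ with $f'(1)=\beta$ and let $\lambda\in\Omega_+=\{w\in\mathbb C:\ |w-\beta|\le\beta,\ w\ne0\}$. Assume that $h$ is the holomorphic solution on $\Delta$ of the equation $$\lambda h(z)=h'(z)f(z)$$ normalized by the conditions $h(0)=1$ and $h(1)=0$. Then for each $\mu\in\Omega_+$ and each $\tau\in\Delta$, the holomorphic function $h_\tau$ on $\Delta$ defined by $$h_\tau(z)=[h(z)]^{\frac{\mu}{\lambda}}\,\frac{(z-\tau)(1-z\bar\tau)^{\mu/\bar\mu}}{-(1-z)^{1+\mu/\bar\mu}}$$ is univalent on $\Delta$ and belongs to the class $\mathrm{Sp}[\tau]$, with $h_\tau(\tau)=0$ and $h_\tau(0)=\tau$. If, in particular, $\mu=\lambda$, then $h_\tau$ converges to $h$ (uniformly on compact subsets of $\Delta$) whenever $\tau$ tends to $1$. Thus $h$ is a univalent function on $\Delta$ which is spirallike (starlike, if $\lambda$ is real) with respect to a boundary point, with $h(1)=0$.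
   Context: $\Delta=\{z\in\mathbb C:|z|<1\}$; $\angle\lim$ denotes the angular (non-tangential) limit, and $h(1):=\angle\lim_{z\to1}h(z)$. A one-parameter continuous semigroup is a family $\{F_t\}_{t\ge0}$ of holomorphic self-mappings of $\Delta$ with $F_{t+s}=F_t\circ F_s$ for $t,s\ge0$, $F_0=\mathrm{id}$, and $\lim_{t\to s}F_t(z)=F_s(z)$ for all $z\in\Delta$, $s\ge0$. Its generator is $f(z)=\lim_{t\to0^+}\frac{z-F_t(z)}{t}$; $\mathcal G$ is the set of all such generators. $\mathcal G^+[1]$ is the set of $f\in\mathcal G$ with $\angle\lim_{z\to1}f(z)=0$ and $f'(1):=\angle\lim_{z\to1}\frac{f(z)}{z-1}=\beta>0$; such $f$ has no zeros in $\Delta$. A univalent holomorphic function $h$ on $\Delta$ is starlike if $\{th(z):t\in(0,1]\}\subset h(\Delta)$ for each $z\in\Delta$, and spirallike if there is $\mu\in\mathbb C$ with $\operatorname{Re}\mu>0$ such that $\{e^{-t\mu}h(z):t\ge0\}\subset h(\Delta)$ for every $z\in\Delta$. It is starlike (spirallike) with respect to an interior point if $0\in h(\Delta)$, and with respect to a boundary point if $0\in\partial h(\Delta)$. For $\tau\in\Delta$, $\mathrm{Sp}[\tau]$ is the set of spirallike functions $h$ with $h(\tau)=0$. The nonvanishing functions $h$, $1-z$, $1-z\bar\tau$ equal $1$ at $z=0$, and their powers are the holomorphic branches equal to $1$ at $z=0$. *)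

(* Defs.v *)
From Stdlib Require Import Reals List ClassicalEpsilon.
From Coquelicot Require Import Coquelicot.

Local Open Scope C_scope.

Definition unit_disc (z : C) : Prop := (Cmod z < 1)%R.

Definition image_disc (h : C -> C) (w : C) : Prop :=
  exists z, unit_disc z /\ h z = w.

Definition holomorphic (g : C -> C) : Prop :=
  forall z, unit_disc z -> ex_derive (K := C_AbsRing) (V := C_NormedModule) g z.

Definition univalent (h : C -> C) : Prop :=
  holomorphic h /\
  forall z w, unit_disc z -> unit_disc w -> h z = h w -> z = w.

(* The approach region is nonempty only for k > 1, and lies inside the disc. *)
Definition stolz (k : R) (z : C) : Prop :=
  (Cmod (1 - z) < k * (1 - Cmod z))%R.

Definition angular_lim (g : C -> C) (l : C) : Prop :=
  forall k : R, (1 < k)%R ->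
    filterlim g (within (stolz k) (locally (RtoC 1))) (locally l).

Record semigroup (F : R -> C -> C) : Prop := {
  sg_disc : forall t z, (0 <= t)%R -> unit_disc z -> unit_disc (F t z);
  sg_holo : forall t, (0 <= t)%R -> holomorphic (F t);
  sg_add : forall t s z, (0 <= t)%R -> (0 <= s)%R -> unit_disc z ->
    F (t + s)%R z = F t (F s z);
  sg_id : forall z, unit_disc z -> F 0%R z = z;
  sg_cont : forall s z, (0 <= s)%R -> unit_disc z ->
    filterlim (fun t => F t z)
      (within (fun t => (0 <= t)%R) (locally s)) (locally (F s z)) }.

Definition generator (f : C -> C) : Prop :=
  exists F, semigroup F /\
    forall z, unit_disc z ->
      filterlim (fun t : R => (z - F t z) / RtoC t) (at_right 0)
        (locally (f z)).

(* f lies in G^+[1] and f'(1) = beta. *)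
Definition generator_plus1 (f : C -> C) (beta : R) : Prop :=
  generator f /\
  angular_lim f 0 /\
  angular_lim (fun z => f z / (z - 1)) (RtoC beta) /\
  (0 < beta)%R.

Definition Omega_plus (beta : R) (w : C) : Prop :=
  (Cmod (w - RtoC beta) <= beta)%R /\ w <> 0.

Definition starlike (h : C -> C) : Prop :=
  univalent h /\
  forall z (t : R), unit_disc z -> (0 < t <= 1)%R ->
    image_disc h (RtoC t * h z).

Definition Cexp (z : C) : C :=
  RtoC (exp (Re z)) * (cos (Im z), sin (Im z)).

Definition spirallike (h : C -> C) : Prop :=
  univalent h /\
  exists mu : C, (0 < Re mu)%R /\
    forall z (t : R), unit_disc z -> (0 <= t)%R ->
      image_disc h (Cexp (- (RtoC t * mu)) * h z).

Definition boundary (A : C -> Prop) (w : C) : Prop :=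
  forall P, locally w P ->
    (exists u, P u /\ A u) /\ (exists u, P u /\ ~ A u).

Definition starlike_boundary (h : C -> C) : Prop :=
  starlike h /\ boundary (image_disc h) 0.

Definition spirallike_boundary (h : C -> C) : Prop :=
  spirallike h /\ boundary (image_disc h) 0.

Definition Sp (tau : C) (h : C -> C) : Prop :=
  spirallike h /\ h tau = 0.

(* On the disc, a holomorphic nonvanishing g with g 0 = 1 has exactly one
   holomorphic logarithm vanishing at 0; [log_branch g] is that function, and
   its values outside the disc are arbitrary. *)
Definition is_log_branch (g L : C -> C) : Prop :=
  holomorphic L /\ L 0 = 0 /\ forall z, unit_disc z -> Cexp (L z) = g z.

Definition log_branch (g : C -> C) : C -> C :=
  epsilon (inhabits (fun _ : C => RtoC 0)) (is_log_branch g).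

Definition branch_pow (g : C -> C) (a : C) (z : C) : C :=
  Cexp (a * log_branch g z).

Definition h_tau (h : C -> C) (lambda mu tau : C) (z : C) : C :=
  branch_pow h (mu / lambda) z *
  (((z - tau) * branch_pow (fun w => 1 - w * Cconj tau) (mu / Cconj mu) z) /
   (- branch_pow (fun w => 1 - w) (1 + mu / Cconj mu) z)).

Definition compact_set (K : C -> Prop) : Prop :=
  forall cover : (C -> Prop) -> Prop,
    (forall U, cover U -> open U) ->
    (forall z, K z -> exists U, cover U /\ U z) ->
    exists l : list (C -> Prop),
      List.Forall cover l /\ forall z, K z -> exists U, In U l /\ U z.

Definition cvg_on_compacts {T : Type} (u : T -> C -> C)
    (F : (T -> Prop) -> Prop) (g : C -> C) : Prop :=
  forall K : C -> Prop, compact_set K -> (forall z, K z -> unit_disc z) ->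
    forall eps : posreal,
      F (fun t => forall z, K z -> (Cmod (u t z - g z) < eps)%R).

(* Main.v *)
Require Import Defs.
From Stdlib Require Import Reals List Lra Lia Psatz ClassicalEpsilon.
From Coquelicot Require Import Coquelicot.

Local Open Scope C_scope.

(** Why the theorem holds.  In the half-plane coordinate [w = (1 + z) / (1 - z)]
    the flow of [f] becomes [dw/dt = P] with [P = - 2 f / (1 - z)^2].
    Differentiating the Schwarz-Pick inequality for two points of the semigroup
    at time 0, and sending one of the points to [1], where the angular derivative
    of [f] is [beta], gives [beta Re w <= Re P] ([generator_plus1_bound]).  The
    Schwarz-Pick lemma is derived from Goursat's theorem on rectangles: in
    logarithmic coordinates an annulus is a rectangle, which gives the mean value
    property and a maximum principle at the centre of a disc.  The bound on [P]
    keeps [f] away from [0] locally.  Hence [h' / h = lambda / f] is locally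
    bounded, [h] has no zero (Gronwall) and has a holomorphic logarithm.

    For [h_tau], use the coordinate [zeta = log ((z - tau) / (1 - z conj tau))],
    which ranges over a half-plane.  There [log h_tau = zeta + Psi], where [Psi]
    has period [2 pi i], and the derivative of [log h_tau] divided by [mu] is an
    explicit expression in [w], [1 / P] and [1 / mu].  The two inequalities
    [beta Re w <= Re P] and [1 / beta <= 2 Re (1 / mu)], the second being the
    hypothesis on [mu], make its real part positive, with a Harnack-type
    lower bound ([spiral_quotient_Re_ge]).  A positive real part on a convex set
    makes [log h_tau] injective, and the period then makes [h_tau] injective
    ([spiral_univalent]); the lower bound makes [log h_tau / mu] strongly
    monotone, and a projected contraction solves the equation that places
    [exp (- t mu) h_tau] in the image ([spiral_invariant]).

    For [mu = lambda] the quotient [h_tau / h] is explicit and tends to [1] as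
    [tau] tends to [1], locally uniformly.  By Hurwitz's theorem [h] inherits
    univalence, since [h'] does not vanish.  Finally [log h] decreases at rate
    [lambda] along trajectories, so [h (F_t z) = exp (- t lambda) h z]: the image
    of [h] is spirallike (starlike for real [lambda]), and [0] is a boundary
    point of it. *)

Definition is_cderive (g : C -> C) (z l : C) : Prop :=
  @is_derive C_AbsRing C_NormedModule g z l.

(** * Complex differentiation in terms of the modulus *)

Lemma Cmod_sqr (z : C) : (Cmod z ^ 2 = Re z ^ 2 + Im z ^ 2)%R.
Proof. apply Cmod2_alt. Qed.

Lemma pow2_le_inv (x y : R) : (0 <= y -> x ^ 2 <= y ^ 2 -> x <= y)%R.
Proof.
  intros Hy H. apply Rsqr_incr_0_var; [|exact Hy]. unfold Rsqr; lra.
Qed.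

Lemma pow2_lt_inv (x y : R) : (0 <= y -> x ^ 2 < y ^ 2 -> x < y)%R.
Proof. intros Hy H. nra. Qed.

Lemma C_eq_Re_Im (z w : C) : Re z = Re w -> Im z = Im w -> z = w.
Proof. destruct z, w; simpl; intros; subst; reflexivity. Qed.

Lemma re_minus (a b : C) : Re (a - b) = (Re a - Re b)%R.
Proof. reflexivity. Qed.

Lemma im_minus (a b : C) : Im (a - b) = (Im a - Im b)%R.
Proof. reflexivity. Qed.

Lemma Cmod_minus_sym (z w : C) : Cmod (z - w) = Cmod (w - z).
Proof. rewrite <- Cmod_opp. f_equal. ring. Qed.

Lemma Cmod_triangle_minus (z w : C) : (Cmod (z - w) <= Cmod z + Cmod w)%R.
Proof.
  unfold Cminus. rewrite <- (Cmod_opp w). apply Cmod_triangle.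
Qed.

Lemma Cmod_triangle_rev (z w : C) : (Cmod z - Cmod w <= Cmod (z - w))%R.
Proof.
  generalize (Cmod_triangle (z - w) w). replace (z - w + w) with z by ring. lra.
Qed.

Lemma Re_le_Cmod (z : C) : (Re z <= Cmod z)%R.
Proof. generalize (re_le_Cmod z) (Rle_abs (Re z)); lra. Qed.

Lemma Im_le_Cmod (z : C) : (Rabs (Im z) <= Cmod z)%R.
Proof.
  generalize (Rmax_Cmod z) (Rmax_r (Rabs (fst z)) (Rabs (snd z))).
  unfold Im. lra.
Qed.

Lemma Cmod_le_abs (z : C) : (Cmod z <= Rabs (Re z) + Rabs (Im z))%R.
Proof.
  apply pow2_le_inv.
  - generalize (Rabs_pos (Re z)) (Rabs_pos (Im z)); lra.
  - rewrite Cmod_sqr, <- (pow2_abs (Re z)), <- (pow2_abs (Im z)).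
    generalize (Rabs_pos (Re z)) (Rabs_pos (Im z)); nra.
Qed.

Lemma Re_mult_conj (z : C) : Re (Cconj z * z) = (Cmod z ^ 2)%R.
Proof. rewrite Cmod_sqr, re_mult, re_conj, im_conj. ring. Qed.

Lemma Cconj_0 : Cconj 0 = 0.
Proof. apply C_eq_Re_Im; simpl; ring. Qed.

Lemma Cconj_1 : Cconj 1 = 1.
Proof. apply C_eq_Re_Im; simpl; ring. Qed.

Lemma Cconj_neq_0 (z : C) : z <> 0 -> Cconj z <> 0.
Proof.
  intros H H0. apply H. rewrite <- (Cconj_conj z), H0. apply Cconj_0.
Qed.

Lemma Cmod_pos_neq_0 (z : C) : (0 < Cmod z)%R -> z <> 0.
Proof. intros H ->. rewrite Cmod_0 in H; lra. Qed.

(** The uniform structure of [C] is that of a product; the estimates below are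
    made in the modulus. *)
Lemma locally_Cmod (z : C) (P : C -> Prop) :
  @locally C_UniformSpace z P <->
  exists d : R, (0 < d)%R /\ forall y, (Cmod (y - z) < d)%R -> P y.
Proof.
  split.
  - intros [d Hd]. exists d. split; [apply cond_pos|].
    intros y Hy. apply Hd. apply C_NormedModule_mixin_compat1. exact Hy.
  - intros [d [Hd H]].
    assert (H2 : (0 < sqrt 2)%R) by (apply sqrt_lt_R0; lra).
    exists (mkposreal (d / sqrt 2) (Rdiv_lt_0_compat _ _ Hd H2)).
    intros y Hy. apply H.
    replace d with (sqrt 2 * (d / sqrt 2))%R by (field; lra).
    apply (C_NormedModule_mixin_compat2 z y _ Hy).
Qed.

Lemma is_cderive_eps (g : C -> C) (z l : C) :
  is_cderive g z l <->
  forall eps : R, (0 < eps)%R -> exists d : R, (0 < d)%R /\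
    forall y, (Cmod (y - z) < d)%R ->
      (Cmod (g y - g z - l * (y - z)) <= eps * Cmod (y - z))%R.
Proof.
  split.
  - intros [_ H] eps Heps.
    specialize (H z (fun P HP => HP) (mkposreal eps Heps)).
    apply locally_C, locally_Cmod in H. destruct H as [d [Hd H]].
    exists d. split; [exact Hd|]. intros y Hy. specialize (H y Hy).
    rewrite (Cmult_comm l). exact H.
  - intros H. split; [apply is_linear_scal_l|].
    intros x Hx. apply (@is_filter_lim_locally_unique C_AbsRing (AbsRing_NormedModule C_AbsRing)) in Hx. subst x.
    intros eps. apply locally_C, locally_Cmod.
    destruct (H eps (cond_pos eps)) as [d [Hd H']].
    exists d. split; [exact Hd|]. intros y Hy. specialize (H' y Hy).
    rewrite (Cmult_comm l) in H'. exact H'.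
Qed.

(** The two normed-module structures that the ring [C] carries over itself
    have the same derivatives. *)
Lemma is_cderive_abs (g : C -> C) (z l : C) :
  @is_derive C_AbsRing (AbsRing_NormedModule C_AbsRing) g z l <->
  is_cderive g z l.
Proof.
  split; intros [_ H]; (split; [apply is_linear_scal_l|exact H]).
Qed.

Lemma is_cderive_ext_near (g k : C -> C) (z l : C) (d : R) :
  (0 < d)%R -> (forall y, (Cmod (y - z) < d)%R -> g y = k y) ->
  is_cderive g z l -> is_cderive k z l.
Proof.
  intros Hd H. apply is_derive_ext_loc with (f := g). apply locally_C, locally_Cmod.
  exists d. auto.
Qed.

Definition cont_at (g : C -> C) (z : C) : Prop :=
  forall eps : R, (0 < eps)%R -> exists d : R, (0 < d)%R /\
    forall y, (Cmod (y - z) < d)%R -> (Cmod (g y - g z) < eps)%R.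

Lemma is_cderive_cont_at (g : C -> C) (z l : C) :
  is_cderive g z l -> cont_at g z.
Proof.
  intros H0 eps Heps. assert (H := proj1 (is_cderive_eps _ _ _) H0).
  destruct (H 1%R Rlt_0_1) as [d [Hd H1]].
  assert (HM : (0 < 1 + Cmod l)%R) by (generalize (Cmod_ge_0 l); lra).
  exists (Rmin d (eps / (1 + Cmod l))). split.
  { apply Rmin_pos; [exact Hd|]. apply Rdiv_lt_0_compat; lra. }
  intros y Hy.
  destruct (Rmin_Rgt_l _ _ _ Hy) as [Hy1 Hy2].
  specialize (H1 y Hy1).
  replace (g y - g z) with ((g y - g z - l * (y - z)) + l * (y - z)) by ring.
  apply Rle_lt_trans with (1 := Cmod_triangle _ _).
  rewrite Cmod_mult.
  apply Rle_lt_trans with ((1 + Cmod l) * Cmod (y - z))%R; [lra|].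
  apply Rlt_le_trans with ((1 + Cmod l) * (eps / (1 + Cmod l)))%R.
  - apply Rmult_lt_compat_l; assumption.
  - right. field. lra.
Qed.

Lemma is_cderive_const (a z : C) : is_cderive (fun _ => a) z 0.
Proof. exact (is_derive_const (V := C_NormedModule) a z). Qed.

Lemma is_cderive_id (z : C) : is_cderive (fun y => y) z 1.
Proof. apply is_cderive_abs, @is_derive_id. Qed.

Lemma is_cderive_eq (g : C -> C) (z l l' : C) :
  l = l' -> is_cderive g z l -> is_cderive g z l'.
Proof. intros ->. auto. Qed.

Lemma is_cderive_plus (g k : C -> C) (z l m : C) :
  is_cderive g z l -> is_cderive k z m ->
  is_cderive (fun y => g y + k y) z (l + m).
Proof. exact (is_derive_plus (V := C_NormedModule) g k z l m). Qed.

Lemma is_cderive_opp (g : C -> C) (z l : C) :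
  is_cderive g z l -> is_cderive (fun y => - g y) z (- l).
Proof. exact (is_derive_opp (V := C_NormedModule) g z l). Qed.

Lemma is_cderive_minus (g k : C -> C) (z l m : C) :
  is_cderive g z l -> is_cderive k z m ->
  is_cderive (fun y => g y - k y) z (l - m).
Proof. exact (is_derive_minus (V := C_NormedModule) g k z l m). Qed.

Lemma is_cderive_mult (g k : C -> C) (z l m : C) :
  is_cderive g z l -> is_cderive k z m ->
  is_cderive (fun y => g y * k y) z (l * k z + g z * m).
Proof.
  intros Hg Hk. apply is_cderive_abs.
  apply is_cderive_abs in Hg. apply is_cderive_abs in Hk.
  exact (is_derive_mult (K := C_AbsRing) g k z l m Hg Hk Cmult_comm).
Qed.

Lemma is_cderive_scal (a : C) (g : C -> C) (z l : C) :
  is_cderive g z l -> is_cderive (fun y => a * g y) z (a * l).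
Proof.
  intros H.
  apply (is_cderive_eq _ _ (0 * g z + a * l)); [ring|].
  exact (is_cderive_mult _ _ _ _ _ (is_cderive_const a z) H).
Qed.

Lemma is_cderive_comp (g k : C -> C) (z l m : C) :
  is_cderive g (k z) l -> is_cderive k z m ->
  is_cderive (fun y => g (k y)) z (m * l).
Proof.
  intros Hg Hk. apply is_cderive_abs in Hk.
  exact (is_derive_comp (K := C_AbsRing) (V := C_NormedModule) g k z l m Hg Hk).
Qed.

Lemma is_cderive_Cinv (z : C) : z <> 0 -> is_cderive Cinv z (- / (z * z)).
Proof.
  intros Hz. apply (proj2 (is_cderive_eps _ _ _)). intros eps Heps.
  assert (Hm : (0 < Cmod z)%R) by (apply Cmod_gt_0; exact Hz).
  set (m := Cmod z) in *.
  exists (Rmin (m / 2) (eps * m ^ 3 / 2)). split.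
  { apply Rmin_pos; [lra|].
    apply Rdiv_lt_0_compat; [|lra]. apply Rmult_lt_0_compat; [lra|].
    apply pow_lt; lra. }
  intros y Hy.
  destruct (Rmin_Rgt_l _ _ _ Hy) as [Hy1 Hy2].
  assert (Hym : (m / 2 < Cmod y)%R).
  { generalize (Cmod_triangle_rev z (z - y)).
    replace (z - (z - y)) with y by ring.
    rewrite (Cmod_minus_sym z y). unfold m in *. lra. }
  assert (Hy0 : y <> 0) by (apply Cmod_pos_neq_0; lra).
  replace (/ y - / z - (- / (z * z)) * (y - z))
    with ((y - z) * (y - z) * (/ (z * z) * / y)) by (field; auto).
  rewrite !Cmod_mult, (Cmod_inv y Hy0), (Cmod_inv _ (Cmult_neq_0 _ _ Hz Hz)),
    Cmod_mult.
  fold m. set (e := Cmod (y - z)) in *.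
  assert (He : (0 <= e)%R) by apply Cmod_ge_0.
  replace (e * e * (/ (m * m) * / Cmod y))%R
    with (e * / (m * m) * / Cmod y * e)%R by ring.
  apply Rmult_le_compat_r; [exact He|].
  apply Rmult_le_reg_r with (m * m * Cmod y)%R.
  { repeat apply Rmult_lt_0_compat; lra. }
  replace (e * / (m * m) * / Cmod y * (m * m * Cmod y))%R with e
    by (field; split; lra).
  apply Rle_trans with (eps * m ^ 3 / 2)%R; [lra|].
  replace (eps * m ^ 3 / 2)%R with (eps * (m * m * (m / 2)))%R by field.
  apply Rmult_le_compat_l; [lra|]. apply Rmult_le_compat_l; [nra|lra].
Qed.

Lemma is_cderive_inv (g : C -> C) (z l : C) :
  is_cderive g z l -> g z <> 0 ->
  is_cderive (fun y => / g y) z (- l / (g z * g z)).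
Proof.
  intros H H0.
  apply (is_cderive_eq _ _ (l * - / (g z * g z))); [field; exact H0|].
  exact (is_cderive_comp Cinv g z _ l (is_cderive_Cinv _ H0) H).
Qed.

Lemma is_cderive_div (g k : C -> C) (z l m : C) :
  is_cderive g z l -> is_cderive k z m -> k z <> 0 ->
  is_cderive (fun y => g y / k y) z ((l * k z - g z * m) / (k z * k z)).
Proof.
  intros Hg Hk H0.
  apply (is_cderive_eq _ _ (l * / k z + g z * (- m / (k z * k z))));
    [field; exact H0|].
  exact (is_cderive_mult _ _ _ _ _ Hg (is_cderive_inv _ _ _ Hk H0)).
Qed.

Lemma is_cderive_ext (g k : C -> C) (z l : C) :
  (forall y, g y = k y) -> is_cderive g z l -> is_cderive k z l.
Proof. exact (is_derive_ext (V := C_NormedModule) g k z l). Qed.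

Lemma C_derive_is (g : C -> C) (z : C) :
  ex_derive (K := C_AbsRing) (V := C_NormedModule) g z ->
  is_cderive g z (C_derive g z).
Proof. apply C_derive_correct. exact z. Qed.

Lemma is_cderive_ex (g : C -> C) (z l : C) :
  is_cderive g z l -> ex_derive (K := C_AbsRing) (V := C_NormedModule) g z.
Proof. intros H. exists l. exact H. Qed.

(** Leaves the derivatives of non-arithmetic subexpressions and the nonvanishing
    of denominators. *)
Ltac cderive :=
  lazymatch goal with
  | |- is_cderive (fun y => y) _ _ => apply is_cderive_id
  | |- is_cderive (fun _ => ?a) _ _ => apply (is_cderive_const a)
  | |- is_cderive (fun y => @?g y + @?k y) _ _ =>
      apply (is_cderive_plus g k); cderive
  | |- is_cderive (fun y => @?g y - @?k y) _ _ =>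
      apply (is_cderive_minus g k); cderive
  | |- is_cderive (fun y => - @?g y) _ _ => apply (is_cderive_opp g); cderive
  | |- is_cderive (fun y => @?g y * @?k y) _ _ =>
      apply (is_cderive_mult g k); cderive
  | |- is_cderive (fun y => @?g y / @?k y) _ _ =>
      apply (is_cderive_div g k); [cderive|cderive|]
  | |- _ => try eassumption
  end.

(* The rules above match on the function being differentiated, which the
   definition by filters would hide once unfolded. *)
Global Opaque is_cderive.

(** * Mean value estimates along segments *)

Lemma is_derive_segment (g : C -> C) (c z v l : C) (s : R) :
  is_cderive g (z + RtoC s * v) l ->
  is_derive (fun t : R => Re (c * g (z + RtoC t * v))) s (Re (c * (l * v))).
Proof.
  intros H0. assert (H := proj1 (is_cderive_eps _ _ _) H0).
  split; [apply is_linear_scal_l|].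
  intros x Hx. apply (@is_filter_lim_locally_unique R_AbsRing (AbsRing_NormedModule R_AbsRing)) in Hx.
  subst x.
  intros eps.
  set (K := (1 + Cmod c * Cmod v)%R).
  assert (HK : (0 < K)%R).
  { unfold K. generalize (Cmod_ge_0 c) (Cmod_ge_0 v). nra. }
  destruct (H (eps / K)%R) as [d [Hd H']].
  { apply Rdiv_lt_0_compat; [apply cond_pos|exact HK]. }
  assert (Hv1 : (0 < 1 + Cmod v)%R) by (generalize (Cmod_ge_0 v); lra).
  exists (mkposreal _ (Rdiv_lt_0_compat _ _ Hd Hv1)).
  intros t Ht. change (Rabs (t - s) < d / (1 + Cmod v))%R in Ht.
  change (Rabs ((Re (c * g (z + RtoC t * v))%C - Re (c * g (z + RtoC s * v))%C)
    - (t - s) * Re (c * (l * v))%C) <= eps * Rabs (t - s))%R.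
  assert (E : z + RtoC t * v - (z + RtoC s * v) = RtoC (t - s) * v).
  { rewrite RtoC_minus. ring. }
  specialize (H' (z + RtoC t * v)). rewrite E in H'.
  rewrite Cmod_mult, Cmod_R in H'.
  assert (Hlt : (Rabs (t - s) * Cmod v < d)%R).
  { apply Rle_lt_trans with (Rabs (t - s) * (1 + Cmod v))%R.
    - apply Rmult_le_compat_l; [apply Rabs_pos|lra].
    - apply Rlt_le_trans with (d / (1 + Cmod v) * (1 + Cmod v))%R.
      + apply Rmult_lt_compat_r; assumption.
      + right; field; lra. }
  specialize (H' Hlt).
  rewrite <- re_scal_l, <- !re_minus.
  replace (c * g (z + RtoC t * v) - c * g (z + RtoC s * v)
    - RtoC (t - s) * (c * (l * v)))
    with (c * (g (z + RtoC t * v) - g (z + RtoC s * v)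
      - l * (RtoC (t - s) * v))) by ring.
  apply Rle_trans with (1 := re_le_Cmod _).
  rewrite Cmod_mult.
  apply Rle_trans with (Cmod c * (eps / K * (Rabs (t - s) * Cmod v)))%R.
  { apply Rmult_le_compat_l; [apply Cmod_ge_0|exact H']. }
  replace (Cmod c * (eps / K * (Rabs (t - s) * Cmod v)))%R
    with (eps * Rabs (t - s) * ((Cmod c * Cmod v) / K))%R by (field; lra).
  rewrite <- (Rmult_1_r (eps * Rabs (t - s))) at 2.
  apply Rmult_le_compat_l.
  { apply Rmult_le_pos; [left; apply cond_pos|apply Rabs_pos]. }
  apply Rmult_le_reg_r with K; [exact HK|]. unfold Rdiv.
  rewrite Rmult_assoc, Rinv_l by lra. unfold K; lra.
Qed.

Lemma is_derive_continuity_pt (f : R -> R) (x l : R) :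
  is_derive f x l -> continuity_pt f x.
Proof.
  intros H. apply derivable_continuous_pt. exists l.
  apply is_derive_Reals. exact H.
Qed.

Lemma segment_mean_value (g g' : C -> C) (c z w : C) :
  (forall s : R, (0 <= s <= 1)%R ->
     is_cderive g (z + RtoC s * (w - z)) (g' (z + RtoC s * (w - z)))) ->
  exists s : R, (0 <= s <= 1)%R /\
    Re (c * (g w - g z)) = Re (c * (g' (z + RtoC s * (w - z)) * (w - z))).
Proof.
  intros H.
  destruct (MVT_gen (fun t : R => Re (c * g (z + RtoC t * (w - z)))) 0 1
    (fun t : R => Re (c * (g' (z + RtoC t * (w - z)) * (w - z)))))
    as [s [Hs E]].
  - rewrite Rmin_left, Rmax_right by lra. intros x Hx.
    apply is_derive_segment, H. lra.
  - rewrite Rmin_left, Rmax_right by lra. intros x Hx.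
    eapply is_derive_continuity_pt, is_derive_segment, H, Hx.
  - rewrite Rmin_left, Rmax_right in Hs by lra.
    exists s. split; [exact Hs|].
    replace (z + RtoC 1 * (w - z)) with w in E by ring.
    replace (z + RtoC 0 * (w - z)) with z in E by ring.
    replace (c * (g w - g z)) with (c * g w - c * g z) by ring.
    rewrite re_minus, E. ring.
Qed.

Lemma segment_mean_value_le (g g' : C -> C) (M : R) (z w : C) :
  (forall s : R, (0 <= s <= 1)%R ->
     is_cderive g (z + RtoC s * (w - z)) (g' (z + RtoC s * (w - z))) /\
     (Cmod (g' (z + RtoC s * (w - z))%C) <= M)%R) ->
  (Cmod (g w - g z) <= M * Cmod (w - z))%R.
Proof.
  intros H.
  destruct (segment_mean_value g g' (Cconj (g w - g z)) z w) as [s [Hs E]].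
  { intros s Hs. apply H, Hs. }
  rewrite Re_mult_conj in E.
  destruct (H s Hs) as [_ HM].
  set (D := Cmod (g w - g z)) in *.
  assert (HD : (0 <= D)%R) by apply Cmod_ge_0.
  assert (H1 : (D ^ 2 <= D * (M * Cmod (w - z)))%R).
  { rewrite E. apply Rle_trans with (1 := Re_le_Cmod _).
    rewrite !Cmod_mult, Cmod_conj. fold D.
    apply Rmult_le_compat_l; [exact HD|].
    apply Rmult_le_compat_r; [apply Cmod_ge_0|exact HM]. }
  destruct (Req_dec D 0) as [H0|H0].
  - rewrite H0. apply Rmult_le_pos; [|apply Cmod_ge_0].
    apply Rle_trans with (2 := HM), Cmod_ge_0.
  - nra.
Qed.

(** Gronwall's inequality: along the segment the derivative of [|g|^2] is at
    most [2 M |w - z| |g|^2] in modulus, so [|g|^2] becomes monotone once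
    multiplied by an exponential of that rate, increasing or decreasing. *)
Lemma segment_gronwall (g g' : C -> C) (M : R) (z w : C) :
  (forall s : R, (0 <= s <= 1)%R ->
     is_cderive g (z + RtoC s * (w - z)) (g' (z + RtoC s * (w - z))) /\
     (Cmod (g' (z + RtoC s * (w - z))%C)
        <= M * Cmod (g (z + RtoC s * (w - z))%C))%R) ->
  (Cmod (g z) ^ 2 <= exp (2 * (M * Cmod (w - z))) * Cmod (g w) ^ 2)%R /\
  (Cmod (g w) ^ 2 <= exp (2 * (M * Cmod (w - z))) * Cmod (g z) ^ 2)%R.
Proof.
  intros H.
  set (k := (2 * (M * Cmod (w - z)))%R).
  set (gam := fun t : R => z + RtoC t * (w - z)).
  set (N := fun t : R => (Cmod (g (gam t)) ^ 2)%R).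
  set (N' := fun t : R => (2 * Re (Cconj (g (gam t)) * (g' (gam t) * (w - z)))%C)%R).
  assert (HN : forall t, (0 <= t <= 1)%R -> is_derive N t (N' t)).
  { intros t Ht. destruct (H t Ht) as [Hd _].
    apply is_derive_ext with
      (fun t => (Re (1 * g (gam t)) ^ 2 + Re (- Ci * g (gam t)) ^ 2)%R).
    { intros x. unfold N. rewrite Cmod_sqr, !re_mult. simpl. ring. }
    assert (H1 := is_derive_segment g 1 _ _ _ _ Hd).
    assert (H2 := is_derive_segment g (- Ci) _ _ _ _ Hd).
    evar_last.
    { apply @is_derive_plus; apply is_derive_pow; [exact H1|exact H2]. }
    unfold N', gam. simpl. unfold plus; simpl. ring. }
  assert (HB : forall t, (0 <= t <= 1)%R -> (Rabs (N' t) <= k * N t)%R).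
  { intros t Ht. destruct (H t Ht) as [_ Hb]. fold (gam t) in Hb.
    unfold N', N, k. rewrite Rabs_mult, (Rabs_right 2) by lra.
    replace (2 * (M * Cmod (w - z)) * Cmod (g (gam t)) ^ 2)%R
      with (2 * (Cmod (g (gam t)) * (M * Cmod (g (gam t)) * Cmod (w - z))))%R
      by ring.
    apply Rmult_le_compat_l; [lra|].
    apply Rle_trans with (1 := re_le_Cmod _).
    rewrite !Cmod_mult, Cmod_conj.
    apply Rmult_le_compat_l; [apply Cmod_ge_0|].
    apply Rmult_le_compat_r; [apply Cmod_ge_0|exact Hb]. }
  assert (HE : forall a t, (0 <= t <= 1)%R ->
    is_derive (fun t => N t * exp (a * t))%R t
      ((N' t + a * N t) * exp (a * t))%R).
  { intros a t Ht. evar_last.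
    { apply @is_derive_mult; [apply HN, Ht| |exact Rmult_comm].
      apply (is_derive_comp exp (fun t => a * t)%R).
      - apply is_derive_exp.
      - apply is_derive_scal, @is_derive_id. }
    simpl. unfold plus, mult, scal, one; simpl. unfold mult; simpl. ring. }
  assert (HV : forall a, exists t, (0 <= t <= 1)%R /\
    (N 1 * exp a - N 0 = (N' t + a * N t) * exp (a * t))%R).
  { intros a.
    destruct (MVT_gen (fun t => N t * exp (a * t))%R 0 1
      (fun t => (N' t + a * N t) * exp (a * t))%R) as [t [Ht E]].
    - rewrite Rmin_left, Rmax_right by lra. intros t Ht. apply HE; lra.
    - rewrite Rmin_left, Rmax_right by lra. intros t Ht.
      eapply is_derive_continuity_pt, HE, Ht.
    - rewrite Rmin_left, Rmax_right in Ht by lra. exists t. split; [exact Ht|].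
      rewrite Rmult_1_r, Rmult_0_r, exp_0, Rmult_1_r, Rminus_0_r, Rmult_1_r in E.
      exact E. }
  assert (N0 : N 0%R = (Cmod (g z) ^ 2)%R).
  { unfold N, gam. do 3 f_equal. ring. }
  assert (N1 : N 1%R = (Cmod (g w) ^ 2)%R).
  { unfold N, gam. do 3 f_equal. ring. }
  rewrite <- N0, <- N1. split.
  - destruct (HV k) as [t [Ht E]].
    assert (Hb := HB t Ht). apply Rabs_le_between in Hb.
    generalize (exp_pos (k * t)). nra.
  - destruct (HV (- k)%R) as [t [Ht E]].
    assert (Hb := HB t Ht). apply Rabs_le_between in Hb.
    generalize (exp_pos (- k * t)). intros Hp.
    assert (E1 : (exp k * exp (- k) = 1)%R).
    { rewrite <- exp_plus, Rplus_opp_r. apply exp_0. }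
    assert (H1 : (N 1 * exp (- k) <= N 0)%R) by nra.
    replace (N 1%R) with (exp k * (N 1 * exp (- k)))%R.
    + apply Rmult_le_compat_l; [left; apply exp_pos|exact H1].
    + replace (exp k * (N 1 * exp (- k)))%R with (N 1 * (exp k * exp (- k)))%R
        by ring. rewrite E1. ring.
Qed.

(** * The complex exponential and its local inverse *)

Lemma Re_Cexp (z : C) : Re (Cexp z) = (exp (Re z) * cos (Im z))%R.
Proof. simpl. ring. Qed.

Lemma Im_Cexp (z : C) : Im (Cexp z) = (exp (Re z) * sin (Im z))%R.
Proof. simpl. ring. Qed.

Lemma Cexp_plus (z w : C) : Cexp (z + w) = Cexp z * Cexp w.
Proof.
  apply C_eq_Re_Im.
  - rewrite re_mult, !Re_Cexp, !Im_Cexp, re_plus, im_plus, exp_plus, cos_plus.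
    ring.
  - rewrite im_mult, !Re_Cexp, !Im_Cexp, re_plus, im_plus, exp_plus, sin_plus.
    ring.
Qed.

Lemma Cexp_0 : Cexp 0 = 1.
Proof.
  apply C_eq_Re_Im; rewrite ?Re_Cexp, ?Im_Cexp; simpl;
    rewrite exp_0, ?cos_0, ?sin_0; ring.
Qed.

Lemma Cmod_Cexp (z : C) : Cmod (Cexp z) = exp (Re z).
Proof.
  unfold Cexp. rewrite Cmod_mult, Cmod_R, Rabs_right.
  2: { left. apply exp_pos. }
  replace (Cmod (cos (Im z), sin (Im z))) with 1%R; [ring|].
  unfold Cmod; simpl. rewrite !Rmult_1_r.
  generalize (sin2_cos2 (Im z)). unfold Rsqr. intros H.
  rewrite Rplus_comm, H. symmetry. apply sqrt_1.
Qed.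

Lemma Cexp_neq_0 (z : C) : Cexp z <> 0.
Proof. apply Cmod_pos_neq_0. rewrite Cmod_Cexp. apply exp_pos. Qed.

Lemma Cexp_opp (z : C) : Cexp (- z) = / Cexp z.
Proof.
  assert (H : Cexp (- z) * Cexp z = 1).
  { rewrite <- Cexp_plus, <- Cexp_0. f_equal. ring. }
  rewrite <- (Cmult_1_l (/ Cexp z)), <- H. field. apply Cexp_neq_0.
Qed.

Lemma Cexp_minus (z w : C) : Cexp (z - w) = Cexp z / Cexp w.
Proof. unfold Cminus. rewrite Cexp_plus, Cexp_opp. reflexivity. Qed.

Lemma is_derive_R_eps (f : R -> R) (x l : R) :
  is_derive f x l ->
  forall eps : R, (0 < eps)%R -> exists d : R, (0 < d)%R /\
    forall y, (Rabs (y - x) < d)%R ->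
      (Rabs (f y - f x - l * (y - x)) <= eps * Rabs (y - x))%R.
Proof.
  intros [_ H] eps Heps.
  destruct (H x (fun P HP => HP) (mkposreal eps Heps)) as [d Hd].
  exists d. split; [apply cond_pos|]. intros y Hy. specialize (Hd y Hy).
  rewrite (Rmult_comm l). exact Hd.
Qed.

Lemma is_cderive_Cexp_0 : is_cderive Cexp 0 1.
Proof.
  apply is_cderive_eps. intros eps Heps.
  set (e := (Rmin eps 1 / 20)%R).
  assert (He : (0 < e /\ 20 * e <= eps /\ 20 * e <= 1)%R).
  { unfold e. generalize (Rmin_l eps 1) (Rmin_r eps 1)
      (Rmin_pos eps 1 Heps Rlt_0_1). lra. }
  clearbody e. destruct He as [He [He1 He2]].
  assert (De : is_derive exp 0 1).
  { evar_last; [apply is_derive_exp|]. apply exp_0. }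
  assert (Dc : is_derive cos 0 0).
  { evar_last; [apply is_derive_cos|]. rewrite sin_0. ring. }
  assert (Ds : is_derive sin 0 1).
  { evar_last; [apply is_derive_sin|]. apply cos_0. }
  destruct (is_derive_R_eps _ _ _ De e He) as [d1 [Hd1 H1]].
  destruct (is_derive_R_eps _ _ _ Dc e He) as [d2 [Hd2 H2]].
  destruct (is_derive_R_eps _ _ _ Ds e He) as [d3 [Hd3 H3]].
  exists (Rmin e (Rmin d1 (Rmin d2 d3))). split.
  { repeat apply Rmin_pos; assumption. }
  intros z Hz. rewrite Cexp_0.
  replace (z - 0) with z in * by ring.
  destruct (Rmin_Rgt_l _ _ _ Hz) as [Hz0 Hz'].
  destruct (Rmin_Rgt_l _ _ _ Hz') as [Hz1 Hz''].
  destruct (Rmin_Rgt_l _ _ _ Hz'') as [Hz2 Hz3].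
  clear Hz Hz' Hz''.
  assert (Hx := re_le_Cmod z). assert (Hy := Im_le_Cmod z).
  set (m := Cmod z) in *.
  specialize (H1 (Re z)). specialize (H2 (Im z)). specialize (H3 (Im z)).
  rewrite Rminus_0_r in H1, H2, H3.
  rewrite exp_0 in H1. rewrite cos_0 in H2. rewrite sin_0 in H3.
  specialize (H1 ltac:(lra)). specialize (H2 ltac:(lra)).
  specialize (H3 ltac:(lra)).
  apply Rle_trans with (1 := Cmod_le_abs _).
  rewrite !re_minus, !im_minus, Cmult_1_l, Re_Cexp, Im_Cexp.
  change (Re 1) with 1%R. change (Im 1) with 0%R.
  revert Hx Hy H1 H2 H3.
  set (x := Re z). set (y := Im z). intros Hx Hy H1 H2 H3.
  set (E := exp x) in *. set (c := cos y) in *. set (s := sin y) in *.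
  assert (HE : (Rabs (E - 1) <= 2 * m)%R).
  { replace (E - 1)%R with ((E - 1 - 1 * x) + x)%R by ring.
    apply Rle_trans with (1 := Rabs_triang _ _).
    generalize (Rabs_pos x). nra. }
  assert (HE2 : (Rabs E <= 2)%R).
  { replace E with ((E - 1) + 1)%R by ring.
    apply Rle_trans with (1 := Rabs_triang _ _). rewrite Rabs_R1. lra. }
  assert (Hm0 : (0 <= m)%R) by apply Cmod_ge_0.
  assert (A : (Rabs (E * c - 1 - x) <= 3 * e * m)%R).
  { replace (E * c - 1 - x)%R with ((E - 1 - 1 * x) + E * (c - 1 - 0 * y))%R
      by ring.
    apply Rle_trans with (1 := Rabs_triang _ _). rewrite Rabs_mult.
    assert (Rabs E * Rabs (c - 1 - 0 * y) <= 2 * (e * m))%R.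
    { apply Rmult_le_compat; try apply Rabs_pos; [exact HE2|].
      apply Rle_trans with (1 := H2). apply Rmult_le_compat_l; lra. }
    assert (e * Rabs x <= e * m)%R by (apply Rmult_le_compat_l; lra). lra. }
  assert (B : (Rabs (E * s - 0 - y) <= 4 * e * m)%R).
  { replace (E * s - 0 - y)%R with (E * (s - 0 - 1 * y) + (E - 1) * y)%R
      by ring.
    apply Rle_trans with (1 := Rabs_triang _ _). rewrite !Rabs_mult.
    assert (Rabs E * Rabs (s - 0 - 1 * y) <= 2 * (e * m))%R.
    { apply Rmult_le_compat; try apply Rabs_pos; [exact HE2|].
      apply Rle_trans with (1 := H3). apply Rmult_le_compat_l; lra. }
    assert (Rabs (E - 1) * Rabs y <= (2 * m) * e)%R.
    { apply Rmult_le_compat; try apply Rabs_pos; lra. } lra. }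
  nra.
Qed.

Lemma is_cderive_Cexp (z : C) : is_cderive Cexp z (Cexp z).
Proof.
  apply (is_cderive_ext (fun y : C => Cexp z * Cexp (y - z))).
  { intros y. rewrite <- Cexp_plus. f_equal. ring. }
  apply (is_cderive_eq _ _ (Cexp z * ((1 - 0) * 1))); [ring|].
  apply is_cderive_scal, (is_cderive_comp Cexp (fun y => y - z)).
  - replace (z - z) with (RtoC 0) by ring. apply is_cderive_Cexp_0.
  - exact (is_cderive_minus _ _ _ _ _ (is_cderive_id z) (is_cderive_const z z)).
Qed.

Lemma is_cderive_Cexp_comp (g : C -> C) (z l : C) :
  is_cderive g z l -> is_cderive (fun y => Cexp (g y)) z (l * Cexp (g z)).
Proof. apply is_cderive_comp, is_cderive_Cexp. Qed.

Lemma Cexp_eq_1 (z : C) :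
  Cexp z = 1 -> exists k : Z, z = RtoC (2 * IZR k * PI) * Ci.
Proof.
  intros H.
  assert (Hre : Re z = 0%R).
  { apply exp_inv. rewrite exp_0, <- Cmod_Cexp, H. apply Cmod_1. }
  assert (Hcos : cos (Im z) = 1%R).
  { generalize (Re_Cexp z). rewrite H, Hre, exp_0. simpl. lra. }
  assert (Hsin : sin (Im z / 2) = 0%R).
  { replace (Im z) with (2 * (Im z / 2))%R in Hcos by field.
    rewrite cos_2a_sin in Hcos. nra. }
  destruct (sin_eq_0_0 _ Hsin) as [k Hk].
  exists k. apply C_eq_Re_Im; simpl; [rewrite Hre; ring|]. lra.
Qed.

Lemma Cexp_period (k : Z) : Cexp (RtoC (2 * IZR k * PI) * Ci) = 1.
Proof.
  set (z := RtoC (2 * IZR k * PI) * Ci).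
  assert (Hre : Re z = 0%R) by (unfold z; simpl; ring).
  assert (Him : Im z = (2 * (IZR k * PI))%R) by (unfold z; simpl; ring).
  assert (Hs : sin (IZR k * PI) = 0%R).
  { apply sin_eq_0_1. exists k. reflexivity. }
  apply C_eq_Re_Im; rewrite ?Re_Cexp, ?Im_Cexp, Hre, Him, exp_0.
  - rewrite cos_2a_sin, Hs. simpl. ring.
  - rewrite sin_2a, Hs. simpl. ring.
Qed.

Lemma Cexp_surj (w : C) : w <> 0 -> exists z, Cexp z = w.
Proof.
  intros Hw. assert (Hm : (0 < Cmod w)%R) by (apply Cmod_gt_0; exact Hw).
  set (m := Cmod w) in *.
  set (c := (Re w / m)%R). set (s := (Im w / m)%R).
  assert (Hcs : (c ^ 2 + s ^ 2 = 1)%R).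
  { unfold c, s. generalize (Cmod_sqr w). fold m. intros E.
    replace ((Re w / m) ^ 2 + (Im w / m) ^ 2)%R
      with ((Re w ^ 2 + Im w ^ 2) / m ^ 2)%R by (field; lra).
    rewrite <- E. field; lra. }
  assert (Hc : (-1 <= c <= 1)%R) by nra.
  assert (Ht : exists t, cos t = c /\ sin t = s).
  { destruct (Rle_lt_dec 0 s) as [H|H].
    - exists (acos c). split; [apply cos_acos, Hc|].
      rewrite sin_acos by exact Hc.
      replace (1 - Rsqr c)%R with (Rsqr s) by (unfold Rsqr; lra).
      apply sqrt_Rsqr, H.
    - exists (- acos c)%R. rewrite cos_neg, sin_neg.
      split; [apply cos_acos, Hc|].
      rewrite sin_acos by exact Hc.
      replace (1 - Rsqr c)%R with (Rsqr (- s)) by (unfold Rsqr; lra).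
      rewrite sqrt_Rsqr by lra. ring. }
  destruct Ht as [t [Htc Hts]].
  exists (ln m, t). apply C_eq_Re_Im; rewrite ?Re_Cexp, ?Im_Cexp; simpl;
    rewrite exp_ln, ?Htc, ?Hts by exact Hm; unfold c, s; field; lra.
Qed.

(** The principal logarithm, meaningful on the right half-plane. *)
Definition Clog (z : C) : C := (ln (Cmod z), atan (Im z / Re z)).

Lemma Cexp_Clog (z : C) : (0 < Re z)%R -> Cexp (Clog z) = z.
Proof.
  intros Hz.
  assert (Hm : (0 < Cmod z)%R) by (generalize (Re_le_Cmod z); lra).
  set (q := (Im z / Re z)%R).
  assert (Hs : sqrt (1 + Rsqr q) = (Cmod z / Re z)%R).
  { rewrite <- (sqrt_Rsqr (Cmod z / Re z)).
    - f_equal. unfold q, Rsqr.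
      replace (Cmod z / Re z * (Cmod z / Re z))%R
        with (Cmod z ^ 2 / Re z ^ 2)%R by (field; lra).
      rewrite Cmod_sqr. field. lra.
    - left. apply Rdiv_lt_0_compat; lra. }
  apply C_eq_Re_Im; rewrite ?Re_Cexp, ?Im_Cexp; simpl; fold q.
  - rewrite exp_ln by exact Hm. rewrite cos_atan, Hs. field. lra.
  - rewrite exp_ln by exact Hm. rewrite sin_atan, Hs. unfold q. field. lra.
Qed.

Lemma Clog_1 : Clog 1 = 0.
Proof.
  unfold Clog. rewrite Cmod_1, ln_1. simpl.
  replace (0 / 1)%R with 0%R by field. rewrite atan_0. reflexivity.
Qed.

Lemma Clog_cont_at (z : C) : (0 < Re z)%R -> cont_at Clog z.
Proof.
  intros Hz eps Heps.
  assert (Hm : (0 < Cmod z)%R) by (generalize (Re_le_Cmod z); lra).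
  assert (CM : continuous (fun w : C_UniformSpace => Cmod w) z).
  { apply filterlim_locally. intros e. apply locally_Cmod.
    exists e. split; [apply cond_pos|]. intros w Hw.
    change (Rabs (Cmod w - Cmod z) < e)%R.
    apply Rle_lt_trans with (2 := Hw), Rabs_le.
    generalize (Cmod_triangle_rev w z) (Cmod_triangle_rev z w).
    rewrite (Cmod_minus_sym z w). lra. }
  assert (C1 : continuous (fun w : C_UniformSpace => ln (Cmod w)) z).
  { apply (continuous_comp (fun w : C_UniformSpace => Cmod w) ln); [exact CM|].
    apply continuity_pt_filterlim, derivable_continuous_pt.
    exists (/ Cmod z)%R. apply derivable_pt_lim_ln, Hm. }
  assert (C2 : continuous (fun w : C_UniformSpace => atan (Im w / Re w)) z).
  { apply (continuous_comp (fun w : C_UniformSpace => (Im w / Re w)%R) atan).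
    - destruct z as [x y].
      apply (continuous_mult (fun w : C_UniformSpace => Im w)
        (fun w : C_UniformSpace => (/ Re w)%R)).
      + exact (continuous_snd x y).
      + apply (continuous_comp (fun w : C_UniformSpace => Re w) Rinv);
          [exact (continuous_fst x y)|].
        apply continuous_Rinv. simpl in *. lra.
    - apply continuity_pt_filterlim, derivable_continuous_pt, derivable_pt_atan. }
  assert (He : (0 < eps / 2)%R) by lra.
  assert (N1 := proj1 (filterlim_locally _ _) C1 (mkposreal _ He)).
  assert (N2 := proj1 (filterlim_locally _ _) C2 (mkposreal _ He)).
  apply locally_Cmod in N1. apply locally_Cmod in N2.
  destruct N1 as [d1 [Hd1 H1]], N2 as [d2 [Hd2 H2]].
  exists (Rmin d1 d2). split; [apply Rmin_pos; assumption|]. intros w Hw.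
  destruct (Rmin_Rgt_l _ _ _ Hw) as [Hw1 Hw2].
  apply Rle_lt_trans with (1 := Cmod_le_abs _).
  assert (A := H1 w Hw1). assert (B := H2 w Hw2).
  change (Rabs (Re (Clog w - Clog z)) < eps / 2)%R in A.
  change (Rabs (Im (Clog w - Clog z)) < eps / 2)%R in B. lra.
Qed.

(** A continuous logarithm of a differentiable function is differentiable:
    its difference quotient is that of [g] divided by that of the
    exponential, whose derivative does not vanish. *)
Lemma is_cderive_log (L g : C -> C) (z l : C) (r : R) :
  (0 < r)%R -> (forall y, (Cmod (y - z) < r)%R -> Cexp (L y) = g y) ->
  cont_at L z -> is_cderive g z l -> is_cderive L z (l / g z).
Proof.
  intros Hr HL Hc Hg.
  assert (Hgz : Cexp (L z) = g z).
  { apply HL. replace (z - z) with (RtoC 0) by ring. rewrite Cmod_0. exact Hr. }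
  assert (HE := proj1 (is_cderive_eps _ _ _) (is_cderive_Cexp (L z))).
  rewrite Hgz in HE.
  assert (Hg0 : g z <> 0) by (rewrite <- Hgz; apply Cexp_neq_0).
  set (G := g z) in *.
  assert (HG : (0 < Cmod G)%R) by (apply Cmod_gt_0; exact Hg0).
  assert (Hg' := proj1 (is_cderive_eps _ _ _) Hg).
  fold G in Hg'.
  apply is_cderive_eps. intros eps Heps.
  set (Q := (Cmod l / Cmod G)%R).
  assert (HQ : (0 <= Q)%R).
  { apply Rmult_le_pos; [apply Cmod_ge_0|]. left. apply Rinv_0_lt_compat, HG. }
  (* with |exp-remainder| <= e1 |L y - L z| and |g-remainder| <= e2 |y - z|,
     |G| |D| <= e1 |D + (l/G)(y-z)| + e2 |y-z| for D the remainder of L *)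
  set (e1 := Rmin (Cmod G / 2) (eps * Cmod G / (4 * (Q + 1)))%R).
  assert (He1 : (0 < e1)%R).
  { apply Rmin_pos; [lra|]. apply Rdiv_lt_0_compat; [|lra].
    apply Rmult_lt_0_compat; assumption. }
  destruct (HE e1 He1) as [d1 [Hd1 H1]].
  destruct (Hc d1 Hd1) as [d2 [Hd2 H2]].
  destruct (Hg' (eps * Cmod G / 4)%R) as [d3 [Hd3 H3]].
  { apply Rdiv_lt_0_compat; [|lra]. apply Rmult_lt_0_compat; assumption. }
  exists (Rmin r (Rmin d2 d3)). split; [repeat apply Rmin_pos; assumption|].
  intros y Hy.
  destruct (Rmin_Rgt_l _ _ _ Hy) as [Hy1 Hy'].
  destruct (Rmin_Rgt_l _ _ _ Hy') as [Hy2 Hy3]. clear Hy Hy'.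
  specialize (H1 (L y) (H2 y Hy2)). specialize (H3 y Hy3).
  rewrite (HL y Hy1) in H1.
  set (D := L y - L z - l / G * (y - z)).
  set (e := Cmod (y - z)) in *.
  assert (He : (0 <= e)%R) by apply Cmod_ge_0.
  assert (HD : (Cmod (L y - L z) <= Cmod D + Q * e)%R).
  { replace (L y - L z) with (D + l / G * (y - z)) by (unfold D; ring).
    apply Rle_trans with (1 := Cmod_triangle _ _).
    rewrite Cmod_mult, Cmod_div by exact Hg0. fold e Q. lra. }
  assert (HGD : (Cmod G * Cmod D <= e1 * Cmod (L y - L z)
    + eps * Cmod G / 4 * e)%R).
  { rewrite <- Cmod_mult.
    replace (G * D) with ((g y - G - l * (y - z)) - (g y - G - G * (L y - L z)))
      by (unfold D; field; exact Hg0).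
    apply Rle_trans with (1 := Cmod_triangle_minus _ _). lra. }
  assert (Ha : (e1 <= Cmod G / 2)%R) by apply Rmin_l.
  assert (Hb : (e1 * Q <= eps * Cmod G / 4)%R).
  { apply Rle_trans with (e1 * (Q + 1))%R; [nra|].
    apply Rle_trans with (eps * Cmod G / (4 * (Q + 1)) * (Q + 1))%R.
    - apply Rmult_le_compat_r; [lra|]. apply Rmin_r.
    - right. field. lra. }
  fold G D. assert (HD0 : (0 <= Cmod D)%R) by apply Cmod_ge_0.
  assert (X1 : (e1 * Cmod (L y - L z) <= e1 * (Cmod D + Q * e))%R)
    by (apply Rmult_le_compat_l; lra).
  assert (X2 : (e1 * Cmod D <= Cmod G / 2 * Cmod D)%R)
    by (apply Rmult_le_compat_r; lra).
  assert (X3 : (e1 * Q * e <= eps * Cmod G / 4 * e)%R)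
    by (apply Rmult_le_compat_r; lra).
  apply Rmult_le_reg_l with (Cmod G / 2)%R; [lra|]. lra.
Qed.

(** * Holomorphic logarithms on the disc *)

Lemma segment_in_ball (r : R) (z w : C) (s : R) :
  (0 <= s <= 1)%R -> (Cmod z <= r)%R -> (Cmod w <= r)%R ->
  (Cmod (z + RtoC s * (w - z)) <= r)%R.
Proof.
  intros Hs Hz Hw.
  replace (z + RtoC s * (w - z)) with (RtoC (1 - s) * z + RtoC s * w)
    by (rewrite RtoC_minus; ring).
  apply Rle_trans with (1 := Cmod_triangle _ _).
  rewrite !Cmod_mult, !Cmod_R, !Rabs_right by lra. nra.
Qed.

Lemma ball_open (r : R) (z : C) : (Cmod z < r)%R ->
  exists d, (0 < d)%R /\ forall y, (Cmod (y - z) < d)%R -> (Cmod y < r)%R.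
Proof.
  intros H. exists (r - Cmod z)%R. split; [lra|].
  intros y Hy. generalize (Cmod_triangle_rev y z). lra.
Qed.

Definition bounded_log_derivative (g g' : C -> C) : Prop :=
  forall r : R, (r < 1)%R -> exists M : R, forall z, (Cmod z <= r)%R ->
    (Cmod (g' z) <= M * Cmod (g z))%R.

(** A zero of [g] would make [g 0] vanish too, by Gronwall's inequality. *)
Lemma bounded_log_derivative_neq_0 (g g' : C -> C) :
  (forall z, unit_disc z -> is_cderive g z (g' z)) ->
  bounded_log_derivative g g' -> g 0 <> 0 ->
  forall z, unit_disc z -> g z <> 0.
Proof.
  intros Hg HB H0 z Hz E. unfold unit_disc in Hz.
  destruct (HB _ Hz) as [M HM].
  destruct (segment_gronwall g g' M 0 z) as [H _].
  { intros s Hs.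
    assert (Hp : (Cmod (0 + RtoC s * (z - 0)) <= Cmod z)%R).
    { apply segment_in_ball; [exact Hs|rewrite Cmod_0; apply Cmod_ge_0|lra]. }
    split; [apply Hg; unfold unit_disc; lra|apply HM, Hp]. }
  rewrite E, Cmod_0 in H. apply Cmod_gt_0 in H0. nra.
Qed.

(** Over a step of length at most [1 / (4 M)] the modulus of [g] at most
    doubles, so [g] moves by at most half of its initial modulus. *)
Lemma ratio_near_1 (g g' : C -> C) (r M : R) (a b : C) :
  (forall z, (Cmod z <= r)%R -> is_cderive g z (g' z)) ->
  (forall z, (Cmod z <= r)%R -> (Cmod (g' z) <= M * Cmod (g z))%R) ->
  (0 <= M)%R -> (Cmod a <= r)%R -> (Cmod b <= r)%R ->
  (M * Cmod (b - a) <= / 4)%R -> g a <> 0 -> (0 < Re (g b / g a))%R.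
Proof.
  intros Hd HM HM0 Ha Hb Hab H0.
  assert (Hga : (0 < Cmod (g a))%R) by (apply Cmod_gt_0; exact H0).
  assert (Hexp : (exp (/ 2) <= 4)%R).
  { apply Rle_trans with (exp 1); [|generalize exp_le_3; lra].
    left. apply exp_increasing. lra. }
  assert (HP : forall s, (0 <= s <= 1)%R ->
    (Cmod (a + RtoC s * (b - a)) <= r)%R).
  { intros s Hs. apply segment_in_ball; assumption. }
  assert (HG : forall s, (0 <= s <= 1)%R ->
    (Cmod (g (a + RtoC s * (b - a))%C) <= 2 * Cmod (g a))%R).
  { intros s Hs.
    destruct (segment_gronwall g g' M a (a + RtoC s * (b - a))) as [_ H].
    { intros t Ht.
      assert (Hp : (Cmod (a + RtoC t * (a + RtoC s * (b - a) - a)) <= r)%R).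
      { apply segment_in_ball; auto. }
      split; [apply Hd, Hp|apply HM, Hp]. }
    replace (a + RtoC s * (b - a) - a) with (RtoC s * (b - a)) in H by ring.
    rewrite Cmod_mult, Cmod_R, Rabs_right in H by lra.
    apply pow2_le_inv; [lra|].
    apply Rle_trans with (1 := H). rewrite Rpow_mult_distr.
    apply Rmult_le_compat_r; [apply pow2_ge_0|].
    replace (2 ^ 2)%R with 4%R by ring.
    apply Rle_trans with (2 := Hexp).
    assert (Hle : (2 * (M * (s * Cmod (b - a))) <= / 2)%R).
    { replace (2 * (M * (s * Cmod (b - a))))%R
        with (s * (2 * (M * Cmod (b - a))))%R by ring.
      assert (0 <= M * Cmod (b - a))%R
        by (apply Rmult_le_pos; [exact HM0|apply Cmod_ge_0]). nra. }
    destruct Hle as [Hle|Hle]; [left; apply exp_increasing, Hle|].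
    rewrite Hle; lra. }
  assert (HD : (Cmod (g b - g a) <= M * (2 * Cmod (g a)) * Cmod (b - a))%R).
  { apply segment_mean_value_le with (g' := g'). intros s Hs.
    split; [apply Hd, HP, Hs|].
    apply Rle_trans with (1 := HM _ (HP s Hs)).
    apply Rmult_le_compat_l; [exact HM0|]. apply HG, Hs. }
  assert (HQ : (Cmod (g b / g a - 1) <= / 2)%R).
  { replace (g b / g a - 1) with ((g b - g a) / g a) by (field; exact H0).
    rewrite Cmod_div by exact H0.
    apply Rmult_le_reg_r with (Cmod (g a)); [exact Hga|].
    unfold Rdiv. rewrite Rmult_assoc, Rinv_l by lra. nra. }
  generalize (re_le_Cmod (g b / g a - 1)). rewrite re_minus. simpl (Re 1).
  intros H. assert (H' := Rle_trans _ _ _ H HQ). apply Rabs_le_between in H'.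
  lra.
Qed.

Definition local_log (g : C -> C) (r : R) (L : C -> C) : Prop :=
  L 0 = 0 /\ forall z, (Cmod z < r)%R ->
    (exists l, is_cderive L z l) /\ Cexp (L z) = g z.

Lemma local_log_derive (g : C -> C) (r : R) (L : C -> C) (z m : C) :
  local_log g r L -> (Cmod z < r)%R -> is_cderive g z m ->
  is_cderive L z (m / g z).
Proof.
  intros [_ HL] Hz Hg. destruct (ball_open r z Hz) as [d [Hd Hb]].
  apply is_cderive_log with (r := d); [exact Hd| | |exact Hg].
  - intros y Hy. apply HL, Hb, Hy.
  - destruct (HL z Hz) as [[l Hl] _]. eapply is_cderive_cont_at, Hl.
Qed.

(** Two logarithms vanishing at [0] have the same derivative [g' / g]. *)
Lemma local_log_unique (g g' : C -> C) (r1 r2 : R) (L1 L2 : C -> C) (z : C) :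
  local_log g r1 L1 -> local_log g r2 L2 ->
  (Cmod z < r1)%R -> (Cmod z < r2)%R ->
  (forall y, (Cmod y <= Cmod z)%R -> is_cderive g y (g' y)) ->
  L1 z = L2 z.
Proof.
  intros H1 H2 Hz1 Hz2 Hg.
  assert (H : (Cmod ((L1 z - L2 z) - (L1 0 - L2 0)) <= 0 * Cmod (z - 0))%R).
  { apply (segment_mean_value_le (fun y => L1 y - L2 y) (fun _ => 0)).
    intros s Hs.
    assert (Hp : (Cmod (0 + RtoC s * (z - 0)) <= Cmod z)%R).
    { apply segment_in_ball; [exact Hs|rewrite Cmod_0; apply Cmod_ge_0|lra]. }
    split; [|rewrite Cmod_0; lra].
    set (p := 0 + RtoC s * (z - 0)) in *.
    apply (is_cderive_eq _ _ (g' p / g p - g' p / g p)); [ring|].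
    apply is_cderive_minus.
    - eapply local_log_derive; [exact H1|lra|apply Hg, Hp].
    - eapply local_log_derive; [exact H2|lra|apply Hg, Hp]. }
  destruct H1 as [E1 _], H2 as [E2 _]. rewrite E1, E2, Rmult_0_l in H.
  assert (H' : Cmod (L1 z - L2 z - (0 - 0)) = 0%R)
    by (apply Rle_antisym; [exact H|apply Cmod_ge_0]).
  apply Cmod_eq_0 in H'.
  replace (L1 z) with (L1 z - L2 z - (0 - 0) + L2 z) by ring.
  rewrite H'. ring.
Qed.

(** The continuous argument along the radius of [z], cut into [n] steps. *)
Fixpoint radial_log (g : C -> C) (n : R) (k : nat) (z : C) : C :=
  match k with
  | O => 0
  | S k => radial_log g n k z
           + Clog (g (RtoC (INR (S k) / n) * z) / g (RtoC (INR k / n) * z))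
  end.

(** Once [n > 4 M] the quotients of consecutive values of [g] along a radius lie
    in the right half-plane, where the principal logarithm applies; the product
    of the quotients telescopes. *)
Lemma local_log_exists (g g' : C -> C) (r : R) :
  (forall z, unit_disc z -> is_cderive g z (g' z)) ->
  bounded_log_derivative g g' -> g 0 = 1 -> (0 < r < 1)%R ->
  exists L, local_log g r L.
Proof.
  intros Hg HB H0 Hr.
  destruct (HB r (proj2 Hr)) as [M0 HM0].
  set (M := Rmax M0 0).
  assert (HMp : (0 <= M)%R) by apply Rmax_r.
  assert (HM : forall z, (Cmod z <= r)%R ->
    (Cmod (g' z) <= M * Cmod (g z))%R).
  { intros z Hz. apply Rle_trans with (1 := HM0 z Hz).
    apply Rmult_le_compat_r; [apply Cmod_ge_0|apply Rmax_l]. }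
  assert (Hnz : forall z, unit_disc z -> g z <> 0).
  { apply bounded_log_derivative_neq_0 with g'; try assumption.
    rewrite H0. exact C1_nz. }
  destruct (nfloor_ex (4 * M + 1)) as [N HN]; [lra|].
  set (n := S N).
  assert (Hn : (4 * M + 1 < INR n)%R) by (unfold n; rewrite S_INR; apply HN).
  assert (Hn0 : (0 < INR n)%R) by lra.
  assert (Hscale : forall k z, (k <= n)%nat ->
    (Cmod (RtoC (INR k / INR n) * z) <= Cmod z)%R).
  { intros k z Hk. rewrite Cmod_mult, Cmod_R.
    assert (Hq : (0 <= INR k / INR n <= 1)%R).
    { split.
      - apply Rmult_le_pos; [apply pos_INR|left; apply Rinv_0_lt_compat, Hn0].
      - apply Rmult_le_reg_r with (INR n); [exact Hn0|].
        unfold Rdiv. rewrite Rmult_assoc, Rinv_l by lra.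
        apply le_INR in Hk. lra. }
    rewrite Rabs_right by lra. generalize (Cmod_ge_0 z). nra. }
  assert (Hdisc : forall k z, (k <= n)%nat -> (Cmod z <= r)%R ->
    unit_disc (RtoC (INR k / INR n) * z)).
  { intros k z Hk Hz. unfold unit_disc. generalize (Hscale k z Hk). lra. }
  assert (Hpos : forall k z, (S k <= n)%nat -> (Cmod z <= r)%R ->
    (0 < Re (g (RtoC (INR (S k) / INR n) * z)%C
             / g (RtoC (INR k / INR n) * z)%C))%R).
  { intros k z Hk Hz. apply ratio_near_1 with (g' := g') (r := r) (M := M).
    - intros y Hy. apply Hg. unfold unit_disc. lra.
    - exact HM.
    - exact HMp.
    - generalize (Hscale k z ltac:(lia)). lra.
    - generalize (Hscale (S k) z Hk). lra.
    - replace (RtoC (INR (S k) / INR n) * z - RtoC (INR k / INR n) * z)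
        with (RtoC (/ INR n) * z).
      + rewrite Cmod_mult, Cmod_R, Rabs_right
          by (left; apply Rinv_0_lt_compat, Hn0).
        apply Rle_trans with (M * (/ INR n * 1))%R.
        * apply Rmult_le_compat_l; [exact HMp|].
          apply Rmult_le_compat_l; [left; apply Rinv_0_lt_compat, Hn0|lra].
        * apply Rmult_le_reg_r with (INR n); [exact Hn0|].
          rewrite Rmult_1_r, Rmult_assoc, Rinv_l by lra. lra.
      + replace (INR (S k) / INR n)%R with (/ INR n + INR k / INR n)%R
          by (rewrite S_INR; field; lra).
        rewrite RtoC_plus. ring.
    - apply Hnz, Hdisc; [lia|exact Hz]. }
  exists (radial_log g (INR n) n). split.
  - clear Hpos Hdisc Hscale HN Hn. generalize n at 2. intros k.
    induction k as [|k IH]; [reflexivity|].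
    change (radial_log g (INR n) k 0
      + Clog (g (RtoC (INR (S k) / INR n) * 0)
              / g (RtoC (INR k / INR n) * 0)) = 0).
    rewrite IH, !Cmult_0_r, H0.
    replace (1 / 1) with (RtoC 1) by (field; apply C1_nz).
    rewrite Clog_1. ring.
  - assert (H : forall k, (k <= n)%nat -> forall z, (Cmod z < r)%R ->
      (exists l, is_cderive (radial_log g (INR n) k) z l) /\
      Cexp (radial_log g (INR n) k z) = g (RtoC (INR k / INR n) * z)).
    { induction k as [|k IH]; intros Hk z Hz.
      - change (radial_log g (INR n) 0) with (fun _ : C => RtoC 0).
        split; [exists 0; apply is_cderive_const|].
        rewrite Cexp_0. simpl INR. unfold Rdiv.
        rewrite Rmult_0_l, Cmult_0_l. symmetry. exact H0.
      - destruct (IH ltac:(lia) z Hz) as [[l Hl] E].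
        assert (Hd1 := Hdisc (S k) z Hk ltac:(lra)).
        assert (Hd0 := Hdisc k z ltac:(lia) ltac:(lra)).
        change (radial_log g (INR n) (S k)) with (fun z => radial_log g (INR n) k z
          + Clog (g (RtoC (INR (S k) / INR n) * z)
                  / g (RtoC (INR k / INR n) * z))).
        set (q := fun y => g (RtoC (INR (S k) / INR n) * y)
                  / g (RtoC (INR k / INR n) * y)).
        split.
        + assert (Dq : exists m, is_cderive q z m).
          { eexists. apply is_cderive_div.
            - apply (is_cderive_comp g). { apply Hg, Hd1. }
              apply is_cderive_scal, is_cderive_id.
            - apply (is_cderive_comp g). { apply Hg, Hd0. }
              apply is_cderive_scal, is_cderive_id.
            - apply Hnz, Hd0. }
          destruct Dq as [m Dq].
          destruct (ball_open r z Hz) as [d [Hd Hb]].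
          eexists. apply is_cderive_plus; [exact Hl|].
          apply is_cderive_log with (g := q) (r := d) (l := m);
            [exact Hd| | |exact Dq].
          * intros y Hy. apply Cexp_Clog, Hpos; [exact Hk|].
            left. apply Hb, Hy.
          * intros eps Heps.
            destruct (Clog_cont_at (q z)) with (2 := Heps) as [d1 [Hd1' H1]].
            { apply Hpos; [exact Hk|lra]. }
            destruct (is_cderive_cont_at _ _ _ Dq d1 Hd1') as [d2 [Hd2 H2]].
            exists d2. split; [exact Hd2|]. intros y Hy. apply H1, H2, Hy.
        + rewrite Cexp_plus, E, Cexp_Clog by (apply Hpos; [exact Hk|lra]).
          field. apply Hnz, Hd0. }
    intros z Hz. destruct (H n (le_n n) z Hz) as [Hd E].
    split; [exact Hd|]. rewrite E. f_equal.
    unfold Rdiv. rewrite Rinv_r by lra. ring.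
Qed.

(** Logarithms on concentric discs agree on the smaller one, so the value at [z]
    may be read off any disc containing [z]. *)
Lemma is_log_branch_exists (g g' : C -> C) :
  (forall z, unit_disc z -> is_cderive g z (g' z)) ->
  bounded_log_derivative g g' -> g 0 = 1 ->
  exists L, is_log_branch g L.
Proof.
  intros Hg HB H0.
  set (rad := fun z => ((1 + Cmod z) / 2)%R).
  assert (Hrad : forall z, unit_disc z -> (0 < rad z < 1)%R /\ (Cmod z < rad z)%R).
  { intros z Hz. unfold unit_disc in Hz. unfold rad.
    generalize (Cmod_ge_0 z). lra. }
  assert (HL : forall z, exists L, unit_disc z -> local_log g (rad z) L).
  { intros z. destruct (Rlt_le_dec (Cmod z) 1) as [Hz|Hz].
    - destruct (local_log_exists g g' (rad z) Hg HB H0) as [L H].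
      { apply Hrad, Hz. }
      exists L. auto.
    - exists (fun _ => 0). intros Hz'. unfold unit_disc in Hz'. lra. }
  set (L := fun z => proj1_sig (constructive_indefinite_description _ (HL z))).
  assert (HLs : forall z, unit_disc z -> local_log g (rad z) (L z)).
  { intros z. exact (proj2_sig (constructive_indefinite_description _ (HL z))). }
  exists (fun z => L z z). split; [|split].
  - intros z Hz. destruct (Hrad z Hz) as [Hr1 Hr2].
    destruct (HLs z Hz) as [_ HLz]. destruct (HLz z Hr2) as [[l Hl] _].
    destruct (ball_open _ _ Hr2) as [d [Hd Hb]].
    apply is_cderive_ex with l.
    apply (is_cderive_ext_near (L z)) with (d := d); [exact Hd| |exact Hl].
    intros y Hy.
    assert (Hyr := Hb y Hy).
    assert (Hyd : unit_disc y) by (unfold unit_disc; lra).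
    apply local_log_unique with (g := g) (g' := g') (r1 := rad z) (r2 := rad y);
      auto.
    + apply Hrad, Hyd.
    + intros x Hx. apply Hg. unfold unit_disc in *. lra.
  - apply HLs. unfold unit_disc. rewrite Cmod_0. lra.
  - intros z Hz. apply HLs; [exact Hz|]. apply Hrad, Hz.
Qed.

(** The local bound on the logarithmic derivative stands in for compactness in
    the construction of the logarithm; it is explicit in every use below. *)
Definition log_admissible (g g' : C -> C) : Prop :=
  (forall z, unit_disc z -> is_cderive g z (g' z)) /\
  bounded_log_derivative g g' /\ g 0 = 1.

Lemma log_branch_spec (g g' : C -> C) :
  log_admissible g g' -> is_log_branch g (log_branch g).
Proof.
  intros [Hd [HB H0]]. unfold log_branch. apply epsilon_spec.
  exact (is_log_branch_exists g g' Hd HB H0).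
Qed.

Lemma log_branch_0 (g g' : C -> C) :
  log_admissible g g' -> log_branch g 0 = 0.
Proof. intros H. apply (log_branch_spec g g' H). Qed.

Lemma Cexp_log_branch (g g' : C -> C) (z : C) :
  log_admissible g g' -> unit_disc z -> Cexp (log_branch g z) = g z.
Proof. intros H. apply (log_branch_spec g g' H). Qed.

Lemma log_branch_derive (g g' : C -> C) (z : C) :
  log_admissible g g' -> unit_disc z ->
  is_cderive (log_branch g) z (g' z / g z).
Proof.
  intros H Hz. destruct (log_branch_spec g g' H) as [Hh [H0 HE]].
  apply local_log_derive with (r := 1%R); [|exact Hz|apply H, Hz].
  split; [exact H0|]. intros y Hy. split; [|apply HE, Hy].
  exists (C_derive (log_branch g) y). apply C_derive_is, Hh, Hy.
Qed.

Ltac feed H := match type of H with ?A -> _ =>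
  let h := fresh in assert (h : A); [|specialize (H h); clear h] end.
(** * Goursat's theorem on rectangles and the maximum principle *)

(** The imaginary part of the integral of [k] around the rectangle
    [[a, b] x [c, d]]. *)
Definition rect_int (k : C -> C) (a b c d : R) : R :=
  (RInt (fun x => Im (k (x, c)) - Im (k (x, d))) a b
   + RInt (fun y => Re (k (b, y)) - Re (k (a, y))) c d)%R.

Lemma Cmod_pair_le (x y u v : R) :
  (Cmod ((u, v) - (x, y)) <= Rabs (u - x) + Rabs (v - y))%R.
Proof. exact (Cmod_le_abs ((u, v) - (x, y))). Qed.

Lemma cont_at_horizontal (k : C -> C) (x y : R) :
  cont_at k (x, y) -> continuous (fun u => Im (k (u, y))) x.
Proof.
  intros H. apply continuity_pt_filterlim, continuity_pt_locally. intros eps.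
  destruct (H eps (cond_pos eps)) as [d [Hd H']].
  exists (mkposreal d Hd). intros u Hu. change (Rabs (u - x) < d)%R in Hu.
  rewrite <- im_minus. apply Rle_lt_trans with (1 := Im_le_Cmod _), H'.
  apply Rle_lt_trans with (1 := Cmod_pair_le _ _ _ _).
  rewrite Rminus_diag, Rabs_R0. lra.
Qed.

Lemma cont_at_vertical (k : C -> C) (x y : R) :
  cont_at k (x, y) -> continuous (fun v => Re (k (x, v))) y.
Proof.
  intros H. apply continuity_pt_filterlim, continuity_pt_locally. intros eps.
  destruct (H eps (cond_pos eps)) as [d [Hd H']].
  exists (mkposreal d Hd). intros v Hv. change (Rabs (v - y) < d)%R in Hv.
  rewrite <- re_minus. apply Rle_lt_trans with (1 := re_le_Cmod _), H'.
  apply Rle_lt_trans with (1 := Cmod_pair_le _ _ _ _).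
  rewrite Rminus_diag, Rabs_R0. lra.
Qed.

Definition cont_on_rect (k : C -> C) (a b c d : R) : Prop :=
  forall x y, (a <= x <= b)%R -> (c <= y <= d)%R -> cont_at k (x, y).

Lemma ex_RInt_horizontal (k : C -> C) (a b c d a' b' y y' : R) :
  cont_on_rect k a b c d -> (a <= a')%R -> (a' <= b')%R -> (b' <= b)%R ->
  (c <= y <= d)%R -> (c <= y' <= d)%R ->
  ex_RInt (fun x => Im (k (x, y)) - Im (k (x, y')))%R a' b'.
Proof.
  intros H Ha Hab Hb Hy Hy'. apply (ex_RInt_continuous (V := R_CompleteNormedModule)).
  rewrite Rmin_left, Rmax_right by lra. intros x Hx.
  apply (continuous_minus (V := R_NormedModule)); apply cont_at_horizontal, H; lra.
Qed.

Lemma ex_RInt_vertical (k : C -> C) (a b c d c' d' x x' : R) :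
  cont_on_rect k a b c d -> (c <= c')%R -> (c' <= d')%R -> (d' <= d)%R ->
  (a <= x <= b)%R -> (a <= x' <= b)%R ->
  ex_RInt (fun y => Re (k (x, y)) - Re (k (x', y)))%R c' d'.
Proof.
  intros H Hc Hcd Hd Hx Hx'. apply (ex_RInt_continuous (V := R_CompleteNormedModule)).
  rewrite Rmin_left, Rmax_right by lra. intros y Hy.
  apply (continuous_minus (V := R_NormedModule)); apply cont_at_vertical, H; lra.
Qed.

Lemma rect_int_split_x (k : C -> C) (a m b c d : R) :
  cont_on_rect k a b c d -> (a <= m <= b)%R -> (c <= d)%R ->
  rect_int k a b c d = (rect_int k a m c d + rect_int k m b c d)%R.
Proof.
  intros H Hm Hcd. unfold rect_int.
  assert (E1 : RInt (fun x => Im (k (x, c)) - Im (k (x, d)))%R a b =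
    (RInt (fun x => Im (k (x, c)) - Im (k (x, d)))%R a m
     + RInt (fun x => Im (k (x, c)) - Im (k (x, d)))%R m b)%R).
  { symmetry. apply (RInt_Chasles (V := R_CompleteNormedModule));
      apply ex_RInt_horizontal with a b c d; auto; lra. }
  assert (E2 : RInt (fun y => Re (k (b, y)) - Re (k (a, y)))%R c d =
    (RInt (fun y => Re (k (m, y)) - Re (k (a, y)))%R c d
     + RInt (fun y => Re (k (b, y)) - Re (k (m, y)))%R c d)%R).
  { symmetry.
    etransitivity; [symmetry; apply (RInt_plus (V := R_CompleteNormedModule));
      apply ex_RInt_vertical with a b c d; auto; lra|].
    apply RInt_ext. intros y _. unfold plus; simpl. ring. }
  rewrite E1, E2. ring.
Qed.

Lemma rect_int_split_y (k : C -> C) (a b c m d : R) :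
  cont_on_rect k a b c d -> (c <= m <= d)%R -> (a <= b)%R ->
  rect_int k a b c d = (rect_int k a b c m + rect_int k a b m d)%R.
Proof.
  intros H Hm Hab. unfold rect_int.
  assert (E1 : RInt (fun y => Re (k (b, y)) - Re (k (a, y)))%R c d =
    (RInt (fun y => Re (k (b, y)) - Re (k (a, y)))%R c m
     + RInt (fun y => Re (k (b, y)) - Re (k (a, y)))%R m d)%R).
  { symmetry. apply (RInt_Chasles (V := R_CompleteNormedModule));
      apply ex_RInt_vertical with a b c d; auto; lra. }
  assert (E2 : RInt (fun x => Im (k (x, c)) - Im (k (x, d)))%R a b =
    (RInt (fun x => Im (k (x, c)) - Im (k (x, m)))%R a b
     + RInt (fun x => Im (k (x, m)) - Im (k (x, d)))%R a b)%R).
  { symmetry.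
    etransitivity; [symmetry; apply (RInt_plus (V := R_CompleteNormedModule));
      apply ex_RInt_horizontal with a b c d; auto; lra|].
    apply RInt_ext. intros x _. unfold plus; simpl. ring. }
  rewrite E1, E2. ring.
Qed.

Lemma RInt_near_const (f : R -> R) (a b v e : R) :
  (a <= b)%R -> ex_RInt f a b ->
  (forall x, (a <= x <= b)%R -> (Rabs (f x - v) <= e)%R) ->
  (Rabs (RInt f a b - v * (b - a)) <= e * (b - a))%R.
Proof.
  intros Hab Hf H.
  replace (RInt f a b - v * (b - a))%R with (RInt (fun x => f x - v)%R a b).
  - rewrite (Rmult_comm e). apply abs_RInt_le_const; [exact Hab| |exact H].
    apply (ex_RInt_minus (V := R_NormedModule)); [exact Hf|apply (ex_RInt_const (V := R_NormedModule))].
  - etransitivity.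
    + apply (RInt_minus (V := R_CompleteNormedModule));
        [exact Hf|apply (ex_RInt_const (V := R_NormedModule))].
    + rewrite RInt_const. unfold minus, plus, opp, scal; simpl.
      unfold mult; simpl. ring.
Qed.

(** Near a point of differentiability [k] is affine up to [eps |z - z0|], and
    the integral of an affine function around a rectangle vanishes. *)
Lemma rect_int_small (k : C -> C) (a b c d : R) (z0 l : C) (eps : R) :
  (a <= b)%R -> (c <= d)%R -> (a <= Re z0 <= b)%R -> (c <= Im z0 <= d)%R ->
  cont_on_rect k a b c d ->
  (forall x y, (a <= x <= b)%R -> (c <= y <= d)%R ->
     (Cmod (k (x, y) - k z0 - l * ((x, y) - z0))
        <= eps * Cmod ((x, y) - z0))%R) ->
  (0 <= eps)%R ->
  (Rabs (rect_int k a b c d) <= 2 * eps * ((b - a) + (d - c)) ^ 2)%R.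
Proof.
  intros Hab Hcd Hx0 Hy0 Hk H Heps.
  set (s := ((b - a) + (d - c))%R).
  set (E := fun x y => k (x, y) - k z0 - l * ((x, y) - z0)).
  assert (HE : forall x y, (a <= x <= b)%R -> (c <= y <= d)%R ->
    (Cmod (E x y) <= eps * s)%R).
  { intros x y Hx Hy. apply Rle_trans with (1 := H x y Hx Hy).
    apply Rmult_le_compat_l; [exact Heps|].
    apply Rle_trans with (1 := Cmod_le_abs _).
    rewrite re_minus, im_minus. simpl (Re (x, y)). simpl (Im (x, y)).
    assert (Rabs (x - Re z0) <= b - a)%R by (apply Rabs_le; lra).
    assert (Rabs (y - Im z0) <= d - c)%R by (apply Rabs_le; lra).
    unfold s. lra. }
  assert (H1 := RInt_near_const
    (fun x => Im (k (x, c)) - Im (k (x, d)))%R a b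
    (- Re l * (d - c)) (2 * (eps * s)) Hab).
  assert (H2 := RInt_near_const
    (fun y => Re (k (b, y)) - Re (k (a, y)))%R c d
    (Re l * (b - a)) (2 * (eps * s)) Hcd).
  feed H1. { apply ex_RInt_horizontal with a b c d; auto; lra. }
  feed H1.
  { intros x Hx.
    replace (Im (k (x, c)) - Im (k (x, d)) - - Re l * (d - c))%R
      with (Im (E x c - E x d)) by (unfold E, Re, Im; simpl; ring).
    apply Rle_trans with (1 := Im_le_Cmod _).
    apply Rle_trans with (1 := Cmod_triangle_minus _ _).
    assert (A := HE x c Hx ltac:(lra)). assert (B := HE x d Hx ltac:(lra)).
    lra. }
  feed H2. { apply ex_RInt_vertical with a b c d; auto; lra. }
  feed H2.
  { intros y Hy.
    replace (Re (k (b, y)) - Re (k (a, y)) - Re l * (b - a))%R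
      with (Re (E b y - E a y)) by (unfold E, Re, Im; simpl; ring).
    apply Rle_trans with (1 := re_le_Cmod _).
    apply Rle_trans with (1 := Cmod_triangle_minus _ _).
    assert (A := HE b y ltac:(lra) Hy). assert (B := HE a y ltac:(lra) Hy).
    lra. }
  unfold rect_int.
  set (I1 := RInt _ a b) in *. set (I2 := RInt _ c d) in *.
  replace (I1 + I2)%R with ((I1 - - Re l * (d - c) * (b - a))
    + (I2 - Re l * (b - a) * (d - c)))%R by ring.
  apply Rle_trans with (1 := Rabs_triang _ _).
  replace (2 * eps * s ^ 2)%R
    with (2 * (eps * s) * (b - a) + 2 * (eps * s) * (d - c))%R
    by (unfold s; ring).
  lra.
Qed.

(** A rectangle on which the integral is at least [K] in modulus has a half
    on which it is at least [K / 2]; halve both sides. *)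
Lemma rect_int_quarter (k : C -> C) (a b c d K : R) :
  (a <= b)%R -> (c <= d)%R -> cont_on_rect k a b c d ->
  (K <= Rabs (rect_int k a b c d))%R ->
  exists p : R * R,
    (fst p = a \/ fst p = a + (b - a) / 2)%R /\
    (snd p = c \/ snd p = c + (d - c) / 2)%R /\
    (K / 4 <= Rabs (rect_int k (fst p) (fst p + (b - a) / 2)
                             (snd p) (snd p + (d - c) / 2)))%R.
Proof.
  intros Hab Hcd Hk HK.
  assert (Hx : exists x, (x = a \/ x = a + (b - a) / 2)%R /\
    (K / 2 <= Rabs (rect_int k x (x + (b - a) / 2) c d))%R).
  { rewrite (rect_int_split_x k a (a + (b - a) / 2) b c d Hk) in HK by lra.
    destruct (Rle_lt_dec (K / 2)
      (Rabs (rect_int k a (a + (b - a) / 2) c d))) as [H|H].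
    - exists a. auto.
    - exists (a + (b - a) / 2)%R. split; [auto|].
      replace (a + (b - a) / 2 + (b - a) / 2)%R with b by field.
      generalize (Rabs_triang (rect_int k a (a + (b - a) / 2) c d)
        (rect_int k (a + (b - a) / 2) b c d)). lra. }
  destruct Hx as [x [Hx HKx]].
  assert (Hk' : cont_on_rect k x (x + (b - a) / 2) c d).
  { intros u v Hu Hv. apply Hk; lra. }
  rewrite (rect_int_split_y k _ _ c (c + (d - c) / 2) d Hk') in HKx by lra.
  destruct (Rle_lt_dec (K / 4)
    (Rabs (rect_int k x (x + (b - a) / 2) c (c + (d - c) / 2)))) as [H|H].
  - exists (x, c). auto.
  - exists (x, c + (d - c) / 2)%R. simpl. split; [exact Hx|]. split; [auto|].
    replace (c + (d - c) / 2 + (d - c) / 2)%R with d by field.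
    generalize (Rabs_triang
      (rect_int k x (x + (b - a) / 2) c (c + (d - c) / 2))
      (rect_int k x (x + (b - a) / 2) (c + (d - c) / 2) d)). lra.
Qed.

Lemma nested_sup (u : nat -> R) (s : R) :
  (0 <= s)%R ->
  (forall n, (u n <= u (S n))%R /\ (u (S n) + s / 2 ^ (S n) <= u n + s / 2 ^ n)%R) ->
  exists x, forall n, (u n <= x <= u n + s / 2 ^ n)%R.
Proof.
  intros Hs H.
  assert (Hp : forall n, (0 <= s / 2 ^ n)%R).
  { intros n. apply Rmult_le_pos; [exact Hs|].
    left. apply Rinv_0_lt_compat, pow_lt. lra. }
  assert (H1 : forall n m, (u n <= u (n + m)%nat)%R /\
    (u (n + m)%nat + s / 2 ^ (n + m) <= u n + s / 2 ^ n)%R).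
  { intros n m. induction m as [|m IH].
    - rewrite Nat.add_0_r. lra.
    - rewrite Nat.add_succ_r. generalize (H (n + m)%nat). lra. }
  assert (H2 : forall n m, (u m <= u n + s / 2 ^ n)%R).
  { intros n m. destruct (Nat.le_ge_cases n m) as [E|E].
    - destruct (H1 n (m - n)%nat) as [_ Hb].
      replace (n + (m - n))%nat with m in Hb by lia.
      generalize (Hp m). lra.
    - destruct (H1 m (n - m)%nat) as [Ha _].
      replace (m + (n - m))%nat with n in Ha by lia.
      generalize (Hp n). lra. }
  destruct (completeness (fun x => exists n, x = u n)) as [x [Hub Hlub]].
  - exists (u O + s / 2 ^ O)%R. intros y [n ->]. apply H2.
  - exists (u O). exists O. reflexivity.
  - exists x. intros n. split.
    + apply Hub. exists n. reflexivity.
    + apply Hlub. intros y [m ->]. apply H2.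
Qed.

(** Otherwise repeated quartering yields rectangles shrinking to a point, on the
    [n]-th of which the integral is at least [K / 4^n]; differentiability at that
    point makes it [o (4^-n)]. *)
Lemma goursat_rect (k : C -> C) (a b c d : R) :
  (a <= b)%R -> (c <= d)%R ->
  (forall x y, (a <= x <= b)%R -> (c <= y <= d)%R ->
     exists l, is_cderive k (x, y) l) ->
  rect_int k a b c d = 0%R.
Proof.
  intros Hab Hcd Hd.
  assert (Hk : cont_on_rect k a b c d).
  { intros x y Hx Hy. destruct (Hd x y Hx Hy) as [l Hl].
    eapply is_cderive_cont_at, Hl. }
  set (K := Rabs (rect_int k a b c d)).
  destruct (Req_dec K 0) as [HK0|HK0].
  { unfold K in HK0. destruct (Req_dec (rect_int k a b c d) 0) as [E|E];
      [exact E|]. exfalso. apply (Rabs_no_R0 _ E HK0). }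
  exfalso.
  assert (HK : (0 < K)%R) by (generalize (Rabs_pos (rect_int k a b c d));
    fold K; lra).
  set (P := fun (n : nat) (p : R * R) =>
    (a <= fst p)%R /\ (fst p + (b - a) / 2 ^ n <= b)%R /\
    (c <= snd p)%R /\ (snd p + (d - c) / 2 ^ n <= d)%R /\
    (K / 4 ^ n <= Rabs (rect_int k (fst p) (fst p + (b - a) / 2 ^ n)
                                (snd p) (snd p + (d - c) / 2 ^ n)))%R).
  assert (Hpow : forall n, (0 < / 2 ^ n)%R).
  { intros n. apply Rinv_0_lt_compat, pow_lt. lra. }
  assert (Hhalf : forall s n, (s / 2 ^ S n = s / 2 ^ n / 2)%R).
  { intros s n. simpl. field. apply pow_nonzero. lra. }
  assert (Hsub : forall s n, (0 <= s -> 0 <= s / 2 ^ n)%R).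
  { intros s n Hs. apply Rmult_le_pos; [exact Hs|]. left. apply Hpow. }
  assert (Hstep : forall n p, P n p -> exists q, P (S n) q /\
    (fst p <= fst q)%R /\
    (fst q + (b - a) / 2 ^ S n <= fst p + (b - a) / 2 ^ n)%R /\
    (snd p <= snd q)%R /\
    (snd q + (d - c) / 2 ^ S n <= snd p + (d - c) / 2 ^ n)%R).
  { intros n p (P1 & P2 & P3 & P4 & P5).
    assert (S1 := Hsub (b - a)%R n ltac:(lra)).
    assert (S2 := Hsub (d - c)%R n ltac:(lra)).
    destruct (rect_int_quarter k (fst p) (fst p + (b - a) / 2 ^ n)
      (snd p) (snd p + (d - c) / 2 ^ n) (K / 4 ^ n)) as [q (Q1 & Q2 & Q3)];
      [lra|lra| |exact P5|].
    { intros x y Hx Hy. apply Hk; lra. }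
    rewrite (Rplus_minus_l (fst p)) in Q1, Q3.
    rewrite (Rplus_minus_l (snd p)) in Q2, Q3.
    assert (E4 : (K / 4 ^ S n = K / 4 ^ n / 4)%R).
    { simpl. field. apply pow_nonzero. lra. }
    exists q. unfold P. rewrite !Hhalf, E4.
    set (sx := ((b - a) / 2 ^ n)%R) in *. set (sy := ((d - c) / 2 ^ n)%R) in *.
    repeat split; try lra. }
  assert (Hstart : P O (a, c)).
  { unfold P. simpl. rewrite !Rdiv_1_r.
    replace (a + (b - a))%R with b by ring.
    replace (c + (d - c))%R with d by ring.
    repeat split; try lra. apply Rle_refl. }
  set (next := fun n (s : {p | P n p}) =>
    exist (P (S n)) _ (proj1 (proj2_sig (constructive_indefinite_description _
      (Hstep n (proj1_sig s) (proj2_sig s)))))).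
  set (st := nat_rect (fun n => {p | P n p}) (exist _ _ Hstart) next).
  set (u := fun n => proj1_sig (st n)).
  assert (Hu : forall n, P n (u n)) by (intros n; exact (proj2_sig (st n))).
  assert (Hnext : forall n,
    (fst (u n) <= fst (u (S n)))%R /\
    (fst (u (S n)) + (b - a) / 2 ^ S n <= fst (u n) + (b - a) / 2 ^ n)%R /\
    (snd (u n) <= snd (u (S n)))%R /\
    (snd (u (S n)) + (d - c) / 2 ^ S n <= snd (u n) + (d - c) / 2 ^ n)%R).
  { intros n.
    exact (proj2 (proj2_sig (constructive_indefinite_description _
      (Hstep n (proj1_sig (st n)) (proj2_sig (st n)))))). }
  destruct (nested_sup (fun n => fst (u n)) (b - a)) as [x0 Hx0];
    [lra|intros n; generalize (Hnext n); tauto|].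
  destruct (nested_sup (fun n => snd (u n)) (d - c)) as [y0 Hy0];
    [lra|intros n; generalize (Hnext n); tauto|].
  assert (Hx0' : (a <= x0 <= b)%R).
  { destruct (Hu O) as (P1 & P2 & _). generalize (Hx0 O). simpl in *. lra. }
  assert (Hy0' : (c <= y0 <= d)%R).
  { destruct (Hu O) as (_ & _ & P3 & P4 & _). generalize (Hy0 O).
    simpl in *. lra. }
  destruct (Hd x0 y0 Hx0' Hy0') as [l Hl].
  assert (Hl' := proj1 (is_cderive_eps _ _ _) Hl). clear Hl.
  set (s := ((b - a) + (d - c))%R).
  assert (Hs : (0 <= s)%R) by (unfold s; lra).
  set (eps := (K / (4 * (s ^ 2 + 1)))%R).
  assert (Hs1 : (0 < s ^ 2 + 1)%R) by (generalize (pow2_ge_0 s); lra).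
  assert (Heps : (0 < eps)%R) by (apply Rdiv_lt_0_compat; lra).
  destruct (Hl' eps Heps) as [r [Hr Hball]].
  assert (Hn : exists n, (s / 2 ^ n < r)%R).
  { destruct (Pow_x_infinity 2 ltac:(rewrite Rabs_right; lra) ((s + 1) / r))
      as [n Hn].
    exists n. specialize (Hn n (le_n n)).
    rewrite Rabs_right in Hn by (left; apply pow_lt; lra).
    apply Rmult_lt_reg_r with (2 ^ n)%R; [apply pow_lt; lra|].
    unfold Rdiv at 1. rewrite Rmult_assoc, Rinv_l, Rmult_1_r
      by (apply pow_nonzero; lra).
    apply Rge_le in Hn. apply Rmult_le_compat_l with (r := r) in Hn; [|lra].
    replace (r * ((s + 1) / r))%R with (s + 1)%R in Hn by (field; lra). lra. }
  destruct Hn as [n Hn].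
  destruct (Hu n) as (P1 & P2 & P3 & P4 & P5).
  specialize (Hx0 n). specialize (Hy0 n). simpl in Hx0, Hy0.
  assert (S1 := Hsub (b - a)%R n ltac:(lra)).
  assert (S2 := Hsub (d - c)%R n ltac:(lra)).
  assert (Es : (s / 2 ^ n = (b - a) / 2 ^ n + (d - c) / 2 ^ n)%R).
  { unfold s, Rdiv. ring. }
  assert (Hsmall := rect_int_small k (fst (u n)) (fst (u n) + (b - a) / 2 ^ n)
    (snd (u n)) (snd (u n) + (d - c) / 2 ^ n) (x0, y0) l eps
    ltac:(lra) ltac:(lra) Hx0 Hy0).
  feed Hsmall. { intros x y Hx Hy. apply Hk; lra. }
  feed Hsmall.
  { intros x y Hx Hy. apply Hball.
    apply Rle_lt_trans with (2 := Hn).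
    apply Rle_trans with (1 := Cmod_pair_le _ _ _ _). rewrite Es.
    apply Rplus_le_compat; apply Rabs_le; lra. }
  specialize (Hsmall ltac:(lra)).
  rewrite (Rplus_minus_l (fst (u n))), (Rplus_minus_l (snd (u n))), <- Es
    in Hsmall.
  assert (H : (K / 4 ^ n <= 2 * eps * (s / 2 ^ n) ^ 2)%R) by lra.
  assert (H2n : (2 ^ n <> 0)%R) by (apply pow_nonzero; lra).
  replace (4 ^ n)%R with (2 ^ n * 2 ^ n)%R in H
    by (rewrite <- Rpow_mult_distr; f_equal; ring).
  apply Rmult_le_compat_r with (r := (2 ^ n * 2 ^ n)%R) in H;
    [|generalize (pow_lt 2 n ltac:(lra)); nra].
  replace (K / (2 ^ n * 2 ^ n) * (2 ^ n * 2 ^ n))%R with K in H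
    by (field; exact H2n).
  replace (2 * eps * (s / 2 ^ n) ^ 2 * (2 ^ n * 2 ^ n))%R
    with (2 * eps * s ^ 2)%R in H by (field; exact H2n).
  assert (E : (4 * eps * (s ^ 2 + 1) = K)%R) by (unfold eps; field; lra).
  generalize (pow2_ge_0 s). nra.
Qed.

Lemma exp_le (x y : R) : (x <= y -> exp x <= exp y)%R.
Proof.
  intros [H|H]; [left; apply exp_increasing, H|rewrite H; apply Rle_refl].
Qed.

(** The integral of [Re g] over the circle of radius [exp x]; in logarithmic
    coordinates an annulus is a rectangle whose horizontal sides cancel. *)
Definition circle_int (g : C -> C) (x : R) : R :=
  RInt (fun y => Re (g (Cexp (x, y)))) 0 (2 * PI).

Lemma Cmod_Cexp_pair (x y : R) : Cmod (Cexp (x, y)) = exp x.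
Proof. apply Cmod_Cexp. Qed.

Lemma cont_at_comp_Cexp (g : C -> C) (z : C) :
  cont_at g (Cexp z) -> cont_at (fun y => g (Cexp y)) z.
Proof.
  intros H eps Heps. destruct (H eps Heps) as [d [Hd H1]].
  destruct (is_cderive_cont_at _ _ _ (is_cderive_Cexp z) d Hd) as [e [He H2]].
  exists e. split; [exact He|]. intros y Hy. apply H1, H2, Hy.
Qed.

Lemma ex_circle_int (g : C -> C) (x : R) :
  (forall z, Cmod z = exp x -> cont_at g z) ->
  ex_RInt (fun y => Re (g (Cexp (x, y)))) 0 (2 * PI).
Proof.
  intros H. apply (ex_RInt_continuous (V := R_CompleteNormedModule)).
  intros y _. apply (cont_at_vertical (fun z => g (Cexp z))).
  apply cont_at_comp_Cexp, H, Cmod_Cexp_pair.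
Qed.

Lemma circle_int_const (g : C -> C) (x x' : R) :
  (x <= x')%R ->
  (forall z, (exp x <= Cmod z <= exp x')%R -> exists l, is_cderive g z l) ->
  circle_int g x = circle_int g x'.
Proof.
  intros Hx Hd.
  assert (Hc : forall t, (x <= t <= x')%R ->
    forall z, Cmod z = exp t -> cont_at g z).
  { intros t Ht z Hz. destruct (Hd z) as [l Hl].
    - rewrite Hz. split; apply exp_le; lra.
    - eapply is_cderive_cont_at, Hl. }
  assert (HP := PI_RGT_0).
  assert (H : rect_int (fun z => g (Cexp z)) x x' 0 (2 * PI) = 0%R).
  { apply goursat_rect; [exact Hx|lra|]. intros u v Hu _.
    destruct (Hd (Cexp (u, v))) as [l Hl].
    { rewrite Cmod_Cexp_pair. split; apply exp_le; lra. }
    eexists. apply (is_cderive_comp g Cexp); [exact Hl|apply is_cderive_Cexp]. }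
  unfold rect_int in H.
  assert (E : RInt (fun u => Im (g (Cexp (u, 0%R)))
    - Im (g (Cexp (u, (2 * PI)%R))))%R x x' = 0%R).
  { rewrite (RInt_ext (V := R_CompleteNormedModule) _ (fun _ => 0%R)).
    - rewrite RInt_const. unfold scal; simpl. unfold mult; simpl. ring.
    - intros u _. unfold Cexp; simpl. rewrite cos_0, sin_0, cos_2PI, sin_2PI.
      ring. }
  rewrite E, Rplus_0_l in H.
  unfold circle_int.
  assert (E2 : RInt (fun y => Re (g (Cexp (x', y))) - Re (g (Cexp (x, y))))%R
      0 (2 * PI) =
    (RInt (fun y => Re (g (Cexp (x', y)))) 0 (2 * PI)
     - RInt (fun y => Re (g (Cexp (x, y)))) 0 (2 * PI))%R).
  { apply (RInt_minus (V := R_CompleteNormedModule)).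
    - apply ex_circle_int, Hc; lra.
    - apply ex_circle_int, Hc; lra. }
  lra.
Qed.

Lemma circle_int_near (g : C -> C) (x v e : R) :
  (forall z, Cmod z = exp x -> cont_at g z) ->
  (forall z, Cmod z = exp x -> (Rabs (Re (g z) - v) <= e)%R) ->
  (Rabs (circle_int g x - v * (2 * PI)) <= e * (2 * PI))%R.
Proof.
  intros Hc H. assert (HP := PI_RGT_0).
  replace (2 * PI)%R with (2 * PI - 0)%R at 1 2 by ring.
  apply RInt_near_const; [lra|apply ex_circle_int, Hc|].
  intros y _. apply H, Cmod_Cexp_pair.
Qed.

Lemma circle_int_continuous (g : C -> C) (x e : R) :
  (forall z, Cmod z = exp x -> cont_at g z) -> (0 < e)%R ->
  exists d, (0 < d)%R /\ forall t, (Rabs (t - x) < d)%R ->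
    (forall z, Cmod z = exp t -> cont_at g z) ->
    (Rabs (circle_int g t - circle_int g x) <= e)%R.
Proof.
  intros Hc He. assert (HP := PI_RGT_0).
  assert (He' : (0 < e / (2 * PI))%R) by (apply Rdiv_lt_0_compat; lra).
  destruct (uniform_continuity_2d_1d' (fun u v => Re (g (Cexp (u, v))))
    0 (2 * PI) x) with (eps := mkposreal _ He') as [d Hd].
  { intros y _ eps.
    destruct (cont_at_comp_Cexp g (x, y) (Hc _ (Cmod_Cexp_pair x y)) eps
      (cond_pos eps)) as [d [Hd H]].
    assert (Hd2 : (0 < d / 2)%R) by lra.
    exists (mkposreal _ Hd2). intros u v Hu Hv. simpl in Hu, Hv.
    rewrite <- re_minus. apply Rle_lt_trans with (1 := re_le_Cmod _), H.
    apply Rle_lt_trans with (1 := Cmod_pair_le _ _ _ _). lra. }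
  exists d. split; [apply cond_pos|]. intros t Ht Hct.
  unfold circle_int.
  assert (E : RInt (fun y => Re (g (Cexp (t, y))) - Re (g (Cexp (x, y))))%R
      0 (2 * PI) =
    (RInt (fun y => Re (g (Cexp (t, y)))) 0 (2 * PI)
     - RInt (fun y => Re (g (Cexp (x, y)))) 0 (2 * PI))%R).
  { apply (RInt_minus (V := R_CompleteNormedModule)); apply ex_circle_int;
      assumption. }
  rewrite <- E.
  replace e with ((2 * PI - 0) * (e / (2 * PI)))%R by (field; lra).
  apply abs_RInt_le_const; [lra| |].
  - apply (ex_RInt_minus (V := R_NormedModule)); apply ex_circle_int;
      assumption.
  - intros y Hy. left. simpl in Hd. apply Rabs_lt_between in Ht.
    assert (Hdp := cond_pos d).
    apply Hd; try lra. rewrite Rminus_diag, Rabs_R0. exact Hdp.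
Qed.

(** The mean value property survives a circle [|z| = s] on which [g] is only
    known to be continuous: the average over [|z| = r] is constant on both
    sides of [s], is continuous in [r], and tends to [g 0]. *)
Lemma mean_value (g : C -> C) (r s : R) :
  (0 < r)%R -> (0 < s)%R ->
  (forall z, (Cmod z <= r)%R -> cont_at g z) ->
  (forall z, (0 < Cmod z <= r)%R -> Cmod z <> s -> exists l, is_cderive g z l) ->
  circle_int g (ln r) = (Re (g 0) * (2 * PI))%R.
Proof.
  intros Hr Hs Hc Hd. assert (HP := PI_RGT_0).
  assert (Hct : forall x, (x <= ln r)%R ->
    forall z, Cmod z = exp x -> cont_at g z).
  { intros x Hx z Hz. apply Hc. rewrite Hz, <- (exp_ln r Hr). apply exp_le, Hx. }
  assert (Hdiff : forall x x', (x' <= ln r)%R -> (x' < ln s \/ ln s < x)%R ->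
    forall z, (exp x <= Cmod z <= exp x')%R -> exists l, is_cderive g z l).
  { intros x x' Hx' Hor z Hz. apply Hd.
    - split; [generalize (exp_pos x); lra|].
      rewrite <- (exp_ln r Hr). generalize (exp_le _ _ Hx'). lra.
    - intros E. rewrite E, <- (exp_ln s Hs) in Hz. destruct Hor as [H|H];
        apply exp_increasing in H; lra. }
  (* for radii below [s], compare with circles shrinking to the centre *)
  assert (Hlow : forall x, (x <= ln r)%R -> (x < ln s)%R ->
    circle_int g x = (Re (g 0) * (2 * PI))%R).
  { intros x Hx Hxs. apply cond_eq. intros eps Heps.
    destruct (Hc 0 ltac:(rewrite Cmod_0; lra) (eps / (4 * PI))%R) as [d [Hd0 H]].
    { apply Rdiv_lt_0_compat; lra. }
    set (t := Rmin x (ln (d / 2))).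
    assert (Htx : (t <= x)%R) by apply Rmin_l.
    assert (Htd : (exp t < d)%R).
    { apply Rle_lt_trans with (d / 2)%R; [|lra].
      rewrite <- (exp_ln (d / 2)) by lra. apply exp_le, Rmin_r. }
    rewrite <- (circle_int_const g t x Htx) by (apply Hdiff; auto).
    apply Rle_lt_trans with (eps / (4 * PI) * (2 * PI))%R.
    - apply circle_int_near; [apply Hct; lra|].
      intros z Hz. rewrite <- re_minus. left.
      apply Rle_lt_trans with (1 := re_le_Cmod _), H.
      replace (z - 0) with z by ring. lra.
    - replace (eps / (4 * PI) * (2 * PI))%R with (eps / 2)%R by (field; lra).
      lra. }
  destruct (Rlt_le_dec (ln r) (ln s)) as [Hrs|Hrs]; [apply Hlow; lra|].
  apply cond_eq. intros eps Heps.
  destruct (circle_int_continuous g (ln s) (eps / 4)) as [d [Hd0 H]];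
    [apply Hct, Hrs|lra|].
  set (lo := (ln s - d / 2)%R).
  assert (H1 := H lo). feed H1.
  { unfold lo. apply Rabs_lt_between. lra. }
  feed H1. { apply Hct. unfold lo. lra. }
  rewrite (Hlow lo) in H1 by (unfold lo; lra).
  set (hi := Rmin (ln r) (ln s + d / 2)).
  assert (H2 := H hi). feed H2.
  { unfold hi. apply Rabs_lt_between.
    generalize (Rmin_r (ln r) (ln s + d / 2)).
    assert (ln s <= Rmin (ln r) (ln s + d / 2))%R by (apply Rmin_glb; lra).
    lra. }
  feed H2. { apply Hct. apply Rmin_l. }
  assert (E : circle_int g (ln r) = circle_int g hi).
  { unfold hi. destruct (Rle_lt_dec (ln r) (ln s + d / 2)) as [H3|H3].
    - rewrite Rmin_left by exact H3. reflexivity.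
    - rewrite Rmin_right by lra. symmetry.
      apply circle_int_const; [lra|]. apply Hdiff; lra. }
  rewrite E.
  replace (circle_int g hi - Re (g 0) * (2 * PI))%R
    with ((circle_int g hi - circle_int g (ln s))
      - (Re (g 0) * (2 * PI) - circle_int g (ln s)))%R by ring.
  apply Rabs_le_between in H1. apply Rabs_le_between in H2.
  apply Rabs_lt_between. lra.
Qed.

(** A bound at the centre is enough: other points are moved there by disc
    automorphisms or translations. *)
Lemma max_modulus_centre (g : C -> C) (r s m : R) :
  (0 < r)%R -> (0 < s)%R ->
  (forall z, (Cmod z <= r)%R -> cont_at g z) ->
  (forall z, (0 < Cmod z <= r)%R -> Cmod z <> s -> exists l, is_cderive g z l) ->
  (forall z, Cmod z = r -> (Cmod (g z) <= m)%R) ->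
  (Cmod (g 0) <= m)%R.
Proof.
  intros Hr Hs Hc Hd Hm. assert (HP := PI_RGT_0).
  destruct (Req_dec (Cmod (g 0)) 0) as [E|E].
  { rewrite E. apply Rle_trans with (2 := Hm (RtoC r)
      ltac:(rewrite Cmod_R, Rabs_right; lra)). apply Cmod_ge_0. }
  set (a := Cmod (g 0)) in *.
  assert (Ha : (0 < a)%R) by (generalize (Cmod_ge_0 (g 0)); fold a; lra).
  set (k := fun z => Cconj (g 0) * g z).
  assert (Hck : forall z, (Cmod z <= r)%R -> cont_at k z).
  { intros z Hz eps Heps. destruct (Hc z Hz (eps / a)%R) as [d [Hd0 H]].
    { apply Rdiv_lt_0_compat; assumption. }
    exists d. split; [exact Hd0|]. intros y Hy. unfold k.
    replace (Cconj (g 0) * g y - Cconj (g 0) * g z)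
      with (Cconj (g 0) * (g y - g z)) by ring.
    rewrite Cmod_mult, Cmod_conj. fold a.
    replace eps with (a * (eps / a))%R by (field; lra).
    apply Rmult_lt_compat_l; [exact Ha|]. apply H, Hy. }
  assert (Hmv := mean_value k r s Hr Hs Hck). feed Hmv.
  { intros z Hz Hzs. destruct (Hd z Hz Hzs) as [l Hl].
    eexists. apply is_cderive_scal, Hl. }
  unfold k at 2 in Hmv. rewrite Re_mult_conj in Hmv. fold a in Hmv.
  assert (Hex : ex_RInt (fun y => Re (k (Cexp (ln r, y)))) 0 (2 * PI)).
  { apply ex_circle_int. intros z Hz. apply Hck. rewrite Hz, exp_ln; lra. }
  assert (Hb : (circle_int k (ln r) <= a * m * (2 * PI))%R).
  { unfold circle_int.
    replace (a * m * (2 * PI))%R with (RInt (fun _ : R => (a * m)%R) 0 (2 * PI)).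
    - apply RInt_le; [lra|exact Hex|apply (ex_RInt_const (V := R_NormedModule))|].
      intros y _. apply Rle_trans with (1 := Re_le_Cmod _). unfold k.
      rewrite Cmod_mult, Cmod_conj. fold a. apply Rmult_le_compat_l; [lra|].
      apply Hm. rewrite Cmod_Cexp_pair, exp_ln; lra.
    - rewrite RInt_const. unfold scal; simpl. unfold mult; simpl. ring. }
  rewrite Hmv in Hb.
  apply Rmult_le_reg_r in Hb; [|lra]. nra.
Qed.

(** * Disc automorphisms and the Schwarz-Pick lemma *)

Definition mob (a z : C) : C := (z - a) / (1 - z * Cconj a).

Lemma mob_denom_neq_0 (a z : C) :
  (Cmod a < 1)%R -> (Cmod z <= 1)%R -> 1 - z * Cconj a <> 0.
Proof.
  intros Ha Hz. apply Cmod_pos_neq_0.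
  generalize (Cmod_triangle_rev 1 (z * Cconj a)).
  rewrite Cmod_1, Cmod_mult, Cmod_conj.
  generalize (Cmod_ge_0 a) (Cmod_ge_0 z). nra.
Qed.

Lemma Cmod_mob_denom_ge (a z : C) :
  (Cmod z <= 1)%R -> (1 - Cmod a <= Cmod (1 - z * Cconj a))%R.
Proof.
  intros Hz. generalize (Cmod_triangle_rev 1 (z * Cconj a)).
  rewrite Cmod_1, Cmod_mult, Cmod_conj.
  generalize (Cmod_ge_0 a) (Cmod_ge_0 z). nra.
Qed.

Lemma mob_sqr (a z : C) :
  (Cmod (1 - z * Cconj a) ^ 2 - Cmod (z - a) ^ 2
   = (1 - Cmod a ^ 2) * (1 - Cmod z ^ 2))%R.
Proof. rewrite !Cmod_sqr. unfold Re, Im. simpl. ring. Qed.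

Lemma mob_defect (a z : C) :
  unit_disc a -> (Cmod z <= 1)%R ->
  (1 - Cmod (mob a z) ^ 2
   = (1 - Cmod a ^ 2) * (1 - Cmod z ^ 2) / Cmod (1 - z * Cconj a) ^ 2)%R.
Proof.
  intros Ha Hz. assert (H := mob_denom_neq_0 a z Ha Hz).
  unfold mob. rewrite Cmod_div by exact H.
  apply Cmod_gt_0 in H. rewrite <- mob_sqr. field. lra.
Qed.

Lemma Cmod_sqr_lt_1 (z : C) : unit_disc z -> (0 < 1 - Cmod z ^ 2)%R.
Proof. unfold unit_disc. generalize (Cmod_ge_0 z). nra. Qed.

Lemma mob_disc (a z : C) : unit_disc a -> unit_disc z -> unit_disc (mob a z).
Proof.
  intros Ha Hz.
  assert (H := mob_defect a z Ha (Rlt_le _ _ Hz)).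
  assert (Hd := mob_denom_neq_0 a z Ha (Rlt_le _ _ Hz)).
  apply Cmod_gt_0 in Hd.
  assert (Hp : (0 < (1 - Cmod a ^ 2) * (1 - Cmod z ^ 2)
    / Cmod (1 - z * Cconj a) ^ 2)%R).
  { apply Rdiv_lt_0_compat.
    - apply Rmult_lt_0_compat; apply Cmod_sqr_lt_1; assumption.
    - apply pow_lt, Hd. }
  apply pow2_lt_inv; lra.
Qed.

Lemma unit_disc_opp (a : C) : unit_disc a -> unit_disc (- a).
Proof. unfold unit_disc. rewrite Cmod_opp. auto. Qed.

Lemma mob_opp_mob (a z : C) :
  unit_disc a -> unit_disc z -> mob (- a) (mob a z) = z.
Proof.
  intros Ha Hz.
  assert (H1 := mob_denom_neq_0 a z Ha (Rlt_le _ _ Hz)).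
  assert (H2 := mob_denom_neq_0 a a Ha (Rlt_le _ _ Ha)).
  unfold mob. rewrite Copp_conj.
  field. split; [exact H1|].
  replace (1 - z * Cconj a - (z - a) * (- Cconj a)) with (1 - a * Cconj a)
    by ring.
  exact H2.
Qed.

Lemma mob_mob_opp (a z : C) :
  unit_disc a -> unit_disc z -> mob a (mob (- a) z) = z.
Proof.
  intros Ha Hz. replace a with (- - a) at 1 by ring.
  apply mob_opp_mob; [apply unit_disc_opp|]; assumption.
Qed.

Lemma mob_derive (a z : C) :
  unit_disc a -> (Cmod z <= 1)%R ->
  is_cderive (mob a) z
    ((1 - a * Cconj a) / ((1 - z * Cconj a) * (1 - z * Cconj a))).
Proof.
  intros Ha Hz. assert (H := mob_denom_neq_0 a z Ha Hz).
  eapply is_cderive_eq; [|unfold mob; cderive; exact H].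
  field. exact H.
Qed.

Definition slope (k : C -> C) (z0 l z : C) : C :=
  if excluded_middle_informative (z = z0) then l else (k z - k z0) / (z - z0).

Lemma slope_neq (k : C -> C) (z0 l z : C) :
  z <> z0 -> slope k z0 l z = (k z - k z0) / (z - z0).
Proof.
  intros H. unfold slope. destruct excluded_middle_informative; tauto.
Qed.

Lemma C_minus_neq_0 (z w : C) : z <> w -> z - w <> 0.
Proof. intros H E. apply H. replace z with (z - w + w) by ring. rewrite E. ring. Qed.

Lemma slope_cont_at (k : C -> C) (z0 l : C) :
  is_cderive k z0 l -> cont_at (slope k z0 l) z0.
Proof.
  intros H eps Heps.
  destruct (proj1 (is_cderive_eps _ _ _) H (eps / 2)%R) as [d [Hd Hk]]; [lra|].
  exists d. split; [exact Hd|]. intros y Hy.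
  unfold slope at 2. destruct excluded_middle_informative as [_|F]; [|tauto].
  unfold slope. destruct excluded_middle_informative as [E|E].
  - replace (l - l) with (RtoC 0) by ring. rewrite Cmod_0. exact Heps.
  - assert (Hne := C_minus_neq_0 _ _ E).
    replace ((k y - k z0) / (y - z0) - l)
      with ((k y - k z0 - l * (y - z0)) / (y - z0)) by (field; exact Hne).
    rewrite Cmod_div by exact Hne.
    assert (Hp : (0 < Cmod (y - z0))%R) by (apply Cmod_gt_0, Hne).
    apply Rle_lt_trans with (eps / 2)%R; [|lra].
    apply Rmult_le_reg_r with (Cmod (y - z0)); [exact Hp|].
    unfold Rdiv at 1. rewrite Rmult_assoc, Rinv_l, Rmult_1_r by lra.
    apply Hk, Hy.
Qed.

Lemma slope_derive (k : C -> C) (z0 l z m : C) :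
  z <> z0 -> is_cderive k z m -> exists m', is_cderive (slope k z0 l) z m'.
Proof.
  intros Hz Hk.
  assert (Hp : (0 < Cmod (z - z0))%R) by (apply Cmod_gt_0, C_minus_neq_0, Hz).
  eexists.
  apply (is_cderive_ext_near (fun y => (k y - k z0) / (y - z0)))
    with (d := Cmod (z - z0)); [exact Hp| |].
  - intros y Hy. symmetry. apply slope_neq. intros ->.
    rewrite Cmod_minus_sym in Hy. lra.
  - cderive. apply C_minus_neq_0, Hz.
Qed.

Lemma cont_at_comp (g k : C -> C) (z : C) :
  cont_at g (k z) -> cont_at k z -> cont_at (fun y => g (k y)) z.
Proof.
  intros Hg Hk eps Heps. destruct (Hg eps Heps) as [d [Hd H1]].
  destruct (Hk d Hd) as [e [He H2]].
  exists e. split; [exact He|]. intros y Hy. apply H1, H2, Hy.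
Qed.

(** The defect [1 - |.|^2] of a point is multiplied by a bounded factor under
    an automorphism. *)
Lemma mob_defect_le (a z : C) :
  unit_disc a -> (Cmod z <= 1)%R ->
  (1 - Cmod (mob a z) ^ 2 <= (1 - Cmod z ^ 2) / (1 - Cmod a) ^ 2)%R.
Proof.
  intros Ha Hz. rewrite mob_defect by assumption. unfold unit_disc in Ha.
  assert (Hd := Cmod_mob_denom_ge a z Hz).
  assert (Hzz : (0 <= 1 - Cmod z ^ 2)%R) by (generalize (Cmod_ge_0 z); nra).
  apply Rle_trans with ((1 - Cmod z ^ 2) / Cmod (1 - z * Cconj a) ^ 2)%R.
  - unfold Rdiv. apply Rmult_le_compat_r.
    + left. apply Rinv_0_lt_compat, pow_lt. lra.
    + generalize (pow2_ge_0 (Cmod a)). nra.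
  - unfold Rdiv. apply Rmult_le_compat_l; [exact Hzz|].
    apply Rinv_le_contravar; [apply pow_lt; lra|]. apply pow_incr. lra.
Qed.

(** The quotient [mob (F z2) (F u) / mob z2 u], moved by an automorphism so
    that [z1] is the centre, has modulus at most [1 + o(1)] on circles tending
    to the unit circle.  Its removable singularity [z2] is filled in by a
    derivative and lies on the one circle where [max_modulus_centre] asks only
    for continuity. *)
Lemma schwarz_pick (F : C -> C) (z1 z2 : C) :
  (forall z, unit_disc z -> unit_disc (F z)) -> holomorphic F ->
  unit_disc z1 -> unit_disc z2 ->
  (Cmod (mob (F z2) (F z1)) <= Cmod (mob z2 z1))%R.
Proof.
  intros HF Hhol Hz1 Hz2.
  assert (HF' : forall z, unit_disc z -> is_cderive F z (C_derive F z)).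
  { intros z Hz. apply C_derive_is, Hhol, Hz. }
  destruct (excluded_middle_informative (z1 = z2)) as [->|Hne].
  { unfold mob at 1. replace (F z2 - F z2) with (RtoC 0) by ring.
    unfold Cdiv. rewrite Cmult_0_l, Cmod_0. apply Cmod_ge_0. }
  set (N := fun u => mob (F z2) (F u) * (1 - u * Cconj z2)).
  assert (HN : forall u, unit_disc u -> exists l, is_cderive N u l).
  { intros u Hu. eexists. apply is_cderive_mult.
    - apply (is_cderive_comp (mob (F z2))).
      + apply mob_derive; [apply HF, Hz2|]. left. apply HF, Hu.
      + apply HF', Hu.
    - cderive. }
  assert (HN2 : N z2 = 0).
  { unfold N, mob. replace (F z2 - F z2) with (RtoC 0) by ring.
    unfold Cdiv. ring. }
  destruct (HN z2 Hz2) as [l Hl].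
  set (Q := slope N z2 l).
  assert (HQ : forall u, unit_disc u -> u <> z2 ->
    Q u = mob (F z2) (F u) / mob z2 u).
  { intros u Hu Hu2. unfold Q. rewrite slope_neq by exact Hu2.
    rewrite HN2. unfold N. unfold mob at 3. field.
    split; [|apply C_minus_neq_0, Hu2].
    apply mob_denom_neq_0; [exact Hz2|left; exact Hu]. }
  assert (HQd : forall u, unit_disc u -> u <> z2 -> exists m, is_cderive Q u m).
  { intros u Hu Hu2. destruct (HN u Hu) as [m Hm].
    apply slope_derive with m; assumption. }
  assert (HQc : forall u, unit_disc u -> cont_at Q u).
  { intros u Hu. destruct (excluded_middle_informative (u = z2)) as [->|Hu2].
    - apply slope_cont_at, Hl.
    - destruct (HQd u Hu Hu2) as [m Hm]. eapply is_cderive_cont_at, Hm. }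
  assert (Hz1' := unit_disc_opp _ Hz1).
  set (p := mob z1 z2).
  assert (Hp : unit_disc p) by (apply mob_disc; assumption).
  assert (Hp0 : (0 < Cmod p)%R).
  { apply Cmod_gt_0. unfold p, mob. intros E.
    apply (C_minus_neq_0 z2 z1); [auto|].
    assert (Hd := mob_denom_neq_0 z1 z2 Hz1 (Rlt_le _ _ Hz2)).
    replace (z2 - z1) with ((z2 - z1) / (1 - z2 * Cconj z1)
      * (1 - z2 * Cconj z1)) by (field; exact Hd).
    rewrite E. ring. }
  set (G := fun z => Q (mob (- z1) z)).
  assert (HG0 : G 0 = mob (F z2) (F z1) / mob z2 z1).
  { unfold G. replace (mob (- z1) 0) with z1.
    - apply HQ; assumption.
    - unfold mob. field. }
  assert (Hphi : forall z, unit_disc z -> unit_disc (mob (- z1) z)).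
  { intros z Hz. apply mob_disc; assumption. }
  assert (Hphi2 : forall z, unit_disc z -> Cmod z <> Cmod p ->
    mob (- z1) z <> z2).
  { intros z Hz Hzp E. apply Hzp. unfold p. rewrite <- E.
    rewrite mob_mob_opp by assumption. reflexivity. }
  assert (Hphid : forall z, unit_disc z -> exists m, is_cderive (mob (- z1)) z m).
  { intros z Hz. eexists. apply mob_derive; [exact Hz1'|left; exact Hz]. }
  assert (HG1 : (Cmod (G 0) <= 1)%R).
  { destruct (Rle_lt_dec (Cmod (G 0)) 1) as [H|H]; [exact H|]. exfalso.
    set (q := (/ Cmod (G 0) ^ 2)%R).
    assert (HG2 : (1 < Cmod (G 0) ^ 2)%R) by nra.
    assert (Hq : (0 < q < 1)%R).
    { unfold q. split; [apply Rinv_0_lt_compat; lra|].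
      rewrite <- Rinv_1. apply Rinv_lt_contravar; lra. }
    unfold unit_disc in Hz1, Hz2, Hp.
    set (K := ((1 - Cmod z1) ^ 2 * (1 - Cmod z2) ^ 2)%R).
    assert (HK : (0 < K)%R).
    { unfold K. apply Rmult_lt_0_compat; apply pow_lt; lra. }
    set (eta := Rmin ((1 - Cmod p) / 2) (K * (1 - q) / 4)).
    assert (Heta : (0 < eta)%R).
    { apply Rmin_pos; [lra|]. apply Rdiv_lt_0_compat; [nra|lra]. }
    assert (He1 : (eta <= (1 - Cmod p) / 2)%R) by apply Rmin_l.
    assert (He2 : (eta <= K * (1 - q) / 4)%R) by apply Rmin_r.
    set (r := (1 - eta)%R).
    assert (Hr : (Cmod p < r < 1)%R) by (unfold r; lra).
    assert (Hm0 : (0 <= 2 / (1 + q))%R).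
    { left. apply Rdiv_lt_0_compat; lra. }
    assert (Hmax := max_modulus_centre G r (Cmod p) (sqrt (2 / (1 + q)))
      ltac:(lra) Hp0).
    feed Hmax.
    { intros z Hz. apply (cont_at_comp Q (mob (- z1))).
      - apply HQc, Hphi. unfold unit_disc. lra.
      - destruct (Hphid z) as [m Hm]; [unfold unit_disc; lra|].
        eapply is_cderive_cont_at, Hm. }
    feed Hmax.
    { intros z [Hz0 Hz] Hzp.
      assert (Hzd : unit_disc z) by (unfold unit_disc; lra).
      destruct (HQd (mob (- z1) z)) as [m Hm]; [apply Hphi, Hzd|auto|].
      destruct (Hphid z Hzd) as [m' Hm'].
      eexists. apply (is_cderive_comp Q); [exact Hm|exact Hm']. }
    feed Hmax.
    { intros z Hz.
      assert (Hzd : unit_disc z) by (unfold unit_disc; lra).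
      assert (Hud := Hphi z Hzd).
      assert (Hu2 : mob (- z1) z <> z2) by (apply Hphi2; [exact Hzd|lra]).
      unfold G. rewrite HQ by assumption.
      set (u := mob (- z1) z) in *.
      assert (D1 := mob_defect_le (- z1) z Hz1' (Rlt_le _ _ Hzd)).
      rewrite Cmod_opp, Hz in D1. fold u in D1.
      assert (D2 := mob_defect_le z2 u Hz2 (Rlt_le _ _ Hud)).
      assert (D3 : (1 - Cmod (mob z2 u) ^ 2 <= (1 - r ^ 2) / K)%R).
      { apply Rle_trans with (1 := D2).
        replace ((1 - r ^ 2) / K)%R
          with ((1 - r ^ 2) / (1 - Cmod z1) ^ 2 / (1 - Cmod z2) ^ 2)%R
          by (unfold K; field; lra).
        apply Rmult_le_compat_r; [|exact D1].
        left. apply Rinv_0_lt_compat, pow_lt. lra. }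
      assert (D4 : ((1 - r ^ 2) / K <= (1 - q) / 2)%R).
      { apply Rmult_le_reg_r with K; [exact HK|].
        unfold Rdiv at 1. rewrite Rmult_assoc, Rinv_l by lra.
        unfold r. nra. }
      assert (D5 : ((1 + q) / 2 <= Cmod (mob z2 u) ^ 2)%R) by lra.
      assert (Hb0 : mob z2 u <> 0).
      { intros E. rewrite E, Cmod_0 in D5. lra. }
      rewrite Cmod_div by exact Hb0.
      assert (Hbp : (0 < Cmod (mob z2 u))%R) by (apply Cmod_gt_0, Hb0).
      assert (Ha1 : (Cmod (mob (F z2) (F u)) < 1)%R).
      { apply mob_disc; apply HF; assumption. }
      apply pow2_le_inv; [apply sqrt_pos|].
      rewrite pow2_sqrt by exact Hm0.
      unfold Rdiv at 1. rewrite Rpow_mult_distr, pow_inv.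
      apply Rle_trans with (1 * / Cmod (mob z2 u) ^ 2)%R.
      - apply Rmult_le_compat_r.
        + left. apply Rinv_0_lt_compat, pow_lt, Hbp.
        + generalize (Cmod_ge_0 (mob (F z2) (F u))). nra.
      - rewrite Rmult_1_l.
        replace (2 / (1 + q))%R with (/ ((1 + q) / 2))%R by (field; lra).
        apply Rinv_le_contravar; lra. }
    assert (Hfin : (Cmod (G 0) ^ 2 <= 2 / (1 + q))%R).
    { rewrite <- (pow2_sqrt (2 / (1 + q))) by exact Hm0.
      apply pow_incr. split; [apply Cmod_ge_0|exact Hmax]. }
    assert (Eq : (Cmod (G 0) ^ 2 = / q)%R).
    { unfold q. rewrite Rinv_inv. reflexivity. }
    rewrite Eq in Hfin.
    apply Rmult_le_compat_r with (r := (q * (1 + q))%R) in Hfin; [|nra].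
    replace (/ q * (q * (1 + q)))%R with (1 + q)%R in Hfin by (field; lra).
    replace (2 / (1 + q) * (q * (1 + q)))%R with (2 * q)%R in Hfin
      by (field; lra).
    lra. }
  assert (Hb0 : mob z2 z1 <> 0).
  { unfold mob. intros E. apply (C_minus_neq_0 z1 z2 Hne).
    assert (Hd := mob_denom_neq_0 z2 z1 Hz2 (Rlt_le _ _ Hz1)).
    replace (z1 - z2) with ((z1 - z2) / (1 - z1 * Cconj z2)
      * (1 - z1 * Cconj z2)) by (field; exact Hd).
    rewrite E. ring. }
  rewrite HG0, Cmod_div in HG1 by exact Hb0.
  assert (Hbp : (0 < Cmod (mob z2 z1))%R) by (apply Cmod_gt_0, Hb0).
  apply Rmult_le_compat_r with (r := Cmod (mob z2 z1)) in HG1; [|lra].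
  unfold Rdiv in HG1. rewrite Rmult_assoc, Rinv_l in HG1 by lra. lra.
Qed.

(** Cleared of denominators, with both sides equal at [F = id]: the form that
    can be differentiated along a semigroup. *)
Lemma schwarz_pick_sqr (F : C -> C) (z1 z2 : C) :
  (forall z, unit_disc z -> unit_disc (F z)) -> holomorphic F ->
  unit_disc z1 -> unit_disc z2 ->
  (Cmod (F z1 - F z2) ^ 2 * ((1 - Cmod z1 ^ 2) * (1 - Cmod z2 ^ 2))
   <= Cmod (z1 - z2) ^ 2 * ((1 - Cmod (F z1) ^ 2) * (1 - Cmod (F z2) ^ 2)))%R.
Proof.
  intros HF Hhol Hz1 Hz2.
  assert (H := schwarz_pick F z1 z2 HF Hhol Hz1 Hz2).
  assert (HF1 := HF _ Hz1). assert (HF2 := HF _ Hz2).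
  unfold mob in H.
  assert (D1 := mob_denom_neq_0 _ _ HF2 (Rlt_le _ _ HF1)).
  assert (D2 := mob_denom_neq_0 _ _ Hz2 (Rlt_le _ _ Hz1)).
  rewrite !Cmod_div in H by assumption.
  apply Cmod_gt_0 in D1. apply Cmod_gt_0 in D2.
  assert (S1 := mob_sqr (F z2) (F z1)). assert (S2 := mob_sqr z2 z1).
  set (a := Cmod (F z1 - F z2)) in *. set (b := Cmod (z1 - z2)) in *.
  set (A := Cmod (1 - F z1 * Cconj (F z2))) in *.
  set (B := Cmod (1 - z1 * Cconj z2)) in *.
  assert (Ha : (0 <= a)%R) by apply Cmod_ge_0.
  assert (Hb : (0 <= b)%R) by apply Cmod_ge_0.
  assert (H' : (a * B <= b * A)%R).
  { apply Rmult_le_compat_r with (r := (A * B)%R) in H; [|nra].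
    replace (a / A * (A * B))%R with (a * B)%R in H by (field; lra).
    replace (b / B * (A * B))%R with (b * A)%R in H by (field; lra). exact H. }
  rewrite (Rmult_comm (1 - Cmod z1 ^ 2)), (Rmult_comm (1 - Cmod (F z1) ^ 2)).
  rewrite <- S1, <- S2.
  assert (H2 : ((a * B) ^ 2 <= (b * A) ^ 2)%R).
  { apply pow_incr. split; [nra|exact H']. }
  nra.
Qed.

(** * The sharp inequality satisfied by the generator *)

Lemma is_lim_seq_inv_S : is_lim_seq (fun n => (/ INR (S n))%R) 0%R.
Proof.
  apply (is_lim_seq_incr_1 (fun n => (/ INR n)%R)).
  replace (Finite 0) with (Rbar_inv p_infty) by reflexivity.
  apply is_lim_seq_inv; [apply is_lim_seq_INR|discriminate].
Qed.

Lemma is_lim_seq_Re (u : nat -> C) (l : C) :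
  filterlim u eventually (@locally C_UniformSpace l) ->
  is_lim_seq (fun n => Re (u n)) (Re l).
Proof.
  intros H. apply (filterlim_comp _ _ _ u Re _ _ _ H).
  destruct l as [x y]. exact (continuous_fst x y).
Qed.

Lemma is_lim_seq_Im (u : nat -> C) (l : C) :
  filterlim u eventually (@locally C_UniformSpace l) ->
  is_lim_seq (fun n => Im (u n)) (Im l).
Proof.
  intros H. apply (filterlim_comp _ _ _ u Im _ _ _ H).
  destruct l as [x y]. exact (continuous_snd x y).
Qed.

Ltac lim_seq :=
  repeat first [eassumption | apply is_lim_seq_const | apply is_lim_seq_minus'
               | apply is_lim_seq_plus' | apply is_lim_seq_mult'].

Lemma inv_S_at_right : filterlim (fun n => (/ INR (S n))%R) eventually (at_right 0).
Proof.
  intros P [d Hd].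
  destruct (is_lim_seq_inv_S (fun x => Rabs (x - 0) < d)%R) as [N HN].
  { exists d. intros y Hy. exact Hy. }
  exists N. intros n Hn. apply Hd; [exact (HN n Hn)|].
  apply Rinv_0_lt_compat, lt_0_INR. lia.
Qed.

(** Differentiating the Schwarz-Pick inequality for the semigroup at time 0. *)
Lemma generator_two_point (F : R -> C -> C) (f : C -> C) (z1 z2 : C) :
  semigroup F ->
  (forall z, unit_disc z ->
     filterlim (fun t : R => (z - F t z) / RtoC t) (at_right 0)
       (@locally C_UniformSpace (f z))) ->
  unit_disc z1 -> unit_disc z2 ->
  (- (Re ((f z1 - f z2) * Cconj (z1 - z2))
      * ((1 - Cmod z1 ^ 2) * (1 - Cmod z2 ^ 2)))
   <= Cmod (z1 - z2) ^ 2 * (Re (f z1 * Cconj z1) * (1 - Cmod z2 ^ 2)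
                            + Re (f z2 * Cconj z2) * (1 - Cmod z1 ^ 2)))%R.
Proof.
  intros HF Hf Hz1 Hz2.
  set (t := fun n => (/ INR (S n))%R).
  assert (Ht : forall n, (0 < t n)%R).
  { intros n. apply Rinv_0_lt_compat, lt_0_INR. lia. }
  set (d := fun z n => (z - F (t n) z) / RtoC (t n)).
  assert (Hd : forall z, unit_disc z ->
    filterlim (d z) eventually (@locally C_UniformSpace (f z))).
  { intros z Hz. apply (filterlim_comp _ _ _ t (fun t => (z - F t z) / RtoC t)
      _ _ _ inv_S_at_right (Hf z Hz)). }
  assert (HFd : forall z n, F (t n) z = z - RtoC (t n) * d z n).
  { intros z n. unfold d. field. intros E. apply RtoC_inj in E.
    specialize (Ht n). lra. }
  set (a1 := (1 - Cmod z1 ^ 2)%R). set (a2 := (1 - Cmod z2 ^ 2)%R).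
  set (A := fun z n => (2 * (Re (d z n) * Re z + Im (d z n) * Im z)
    - t n * (Re (d z n) * Re (d z n) + Im (d z n) * Im (d z n)))%R).
  set (lhs := fun n => (-2 * ((Re (d z1 n) - Re (d z2 n)) * (Re z1 - Re z2)
    + (Im (d z1 n) - Im (d z2 n)) * (Im z1 - Im z2)) * (a1 * a2))%R).
  set (rhs := fun n => (Cmod (z1 - z2) ^ 2
    * (a1 * A z2 n + a2 * A z1 n + t n * (A z1 n * A z2 n)))%R).
  assert (Hle : forall n, (lhs n <= rhs n)%R).
  { intros n. apply Rmult_le_reg_l with (t n); [apply Ht|].
    assert (SP := schwarz_pick_sqr (F (t n)) z1 z2).
    feed SP. { intros z Hz. apply (sg_disc F HF); [left; apply Ht|exact Hz]. }
    feed SP. { apply (sg_holo F HF). left. apply Ht. }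
    specialize (SP Hz1 Hz2). rewrite !HFd in SP. unfold lhs, rhs, A.
    assert (Hsub : forall z, (1 - Cmod (z - RtoC (t n) * d z n) ^ 2
      = (1 - Cmod z ^ 2) + t n * A z n)%R).
    { intros z. unfold A. rewrite !Cmod_sqr. unfold Re, Im. simpl. ring. }
    rewrite !Hsub in SP. fold a1 a2 in SP. fold (A z1 n) (A z2 n).
    assert (Hd2 : (Cmod (z1 - RtoC (t n) * d z1 n - (z2 - RtoC (t n) * d z2 n)) ^ 2
      = Cmod (z1 - z2) ^ 2
        - 2 * t n * ((Re (d z1 n) - Re (d z2 n)) * (Re z1 - Re z2)
                     + (Im (d z1 n) - Im (d z2 n)) * (Im z1 - Im z2))
        + t n ^ 2 * Cmod (d z1 n - d z2 n) ^ 2)%R).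
    { rewrite !Cmod_sqr. unfold Re, Im. simpl. ring. }
    rewrite Hd2 in SP.
    assert (Hpos : (0 <= t n ^ 2 * Cmod (d z1 n - d z2 n) ^ 2 * (a1 * a2))%R).
    { apply Rmult_le_pos; [apply Rmult_le_pos; apply pow2_ge_0|].
      apply Rmult_le_pos; left; apply Cmod_sqr_lt_1; assumption. }
    lra. }
  assert (Lt := is_lim_seq_inv_S). fold t in Lt.
  assert (R1 := is_lim_seq_Re _ _ (Hd z1 Hz1)).
  assert (I1 := is_lim_seq_Im _ _ (Hd z1 Hz1)).
  assert (R2 := is_lim_seq_Re _ _ (Hd z2 Hz2)).
  assert (I2 := is_lim_seq_Im _ _ (Hd z2 Hz2)).
  eassert (L1 : is_lim_seq lhs (Finite _)).
  { unfold lhs. lim_seq. }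
  eassert (L2 : is_lim_seq rhs (Finite _)).
  { unfold rhs, A. lim_seq. }
  assert (H := is_lim_seq_le _ _ _ _ Hle L1 L2). simpl in H.
  rewrite !re_mult, !re_conj, !im_conj, !re_minus, !im_minus.
  fold a1 a2. lra.
Qed.

(** Letting the second point tend to the boundary fixed point [1] along the
    radius turns the two-point inequality into this one-point inequality, in
    which the angular derivative [beta] appears. *)
Lemma generator_plus1_bound (f : C -> C) (beta : R) (z : C) :
  generator_plus1 f beta -> unit_disc z ->
  (beta * (1 - Cmod z ^ 2) * Cmod (1 - z) ^ 2
   <= - 2 * Re (f z * (Cconj (1 - z) * Cconj (1 - z))))%R.
Proof.
  intros [[F [HF Hf]] [_ [Hang _]]] Hz.
  set (r := fun n => (1 - / INR (S (S n)))%R).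
  assert (Hinv : forall n, (0 < / INR (S (S n)) < 1)%R).
  { intros n. split; [apply Rinv_0_lt_compat, lt_0_INR; lia|].
    rewrite <- Rinv_1. apply Rinv_lt_contravar.
    - rewrite Rmult_1_l. apply lt_0_INR. lia.
    - apply (lt_INR 1). lia. }
  assert (Hr : forall n, (0 < r n < 1)%R).
  { intros n. unfold r. generalize (Hinv n). lra. }
  assert (Lr : is_lim_seq r 1%R).
  { rewrite <- (Rminus_0_r 1).
    apply is_lim_seq_minus'; [apply is_lim_seq_const|].
    apply (is_lim_seq_incr_1 (fun n => (/ INR (S n))%R)), is_lim_seq_inv_S. }
  assert (Hrd : forall n, unit_disc (RtoC (r n))).
  { intros n. unfold unit_disc. rewrite Cmod_R, Rabs_right;
      generalize (Hr n); lra. }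
  set (b := fun n => f (RtoC (r n)) / (RtoC (r n) - 1)).
  assert (Lb : filterlim b eventually (@locally C_UniformSpace (RtoC beta))).
  { assert (Hrad : filterlim (fun n => RtoC (r n)) eventually
      (within (stolz 2) (@locally C_UniformSpace (RtoC 1)))).
    { intros P HP. apply locally_Cmod in HP. destruct HP as [e [He HP]].
      destruct (Lr (fun x => Rabs (x - 1) < e)%R) as [N HN].
      { exists (mkposreal e He). intros y Hy. exact Hy. }
      exists N. intros n Hn. apply HP.
      - rewrite <- RtoC_minus, Cmod_R. apply HN, Hn.
      - unfold stolz. rewrite <- RtoC_minus, !Cmod_R.
        generalize (Hr n). intros Hrn. rewrite !Rabs_right; lra. }
    exact (filterlim_comp _ _ _ _ (fun z => f z / (z - 1)) _ _ _ Hrad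
      (Hang 2%R ltac:(lra))). }
  assert (Rb := is_lim_seq_Re _ _ Lb). assert (Ib := is_lim_seq_Im _ _ Lb).
  simpl in Rb, Ib.
  assert (Hfb : forall n, f (RtoC (r n)) = (RtoC (r n) - 1) * b n).
  { intros n. unfold b. field. intros E.
    assert (E' : Re (RtoC (r n) - 1) = 0%R) by (rewrite E; reflexivity).
    simpl in E'. generalize (Hr n). lra. }
  set (a := (1 - Cmod z ^ 2)%R).
  set (x := Re z). set (y := Im z). set (fx := Re (f z)). set (fy := Im (f z)).
  set (D := fun n => ((x - r n) * (x - r n) + y * y)%R).
  set (lhs := fun n => (a * (r n * Re (b n)) * D n)%R).
  set (rhs := fun n => ((((fx - (r n - 1) * Re (b n)) * (x - r n)
      + (fy - (r n - 1) * Im (b n)) * y) * a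
     + D n * (fx * x + fy * y)) * (1 + r n))%R).
  assert (Hle : forall n, (lhs n <= rhs n)%R).
  { intros n.
    assert (H2 := generator_two_point F f z (RtoC (r n)) HF Hf Hz (Hrd n)).
    rewrite Hfb in H2.
    assert (Ea : (1 - Cmod (RtoC (r n)) ^ 2 = (1 - r n) * (1 + r n))%R).
    { rewrite Cmod_sqr. simpl. ring. }
    rewrite Ea in H2. fold a in H2.
    assert (E1 : (Re ((f z - (RtoC (r n) - 1) * b n) * Cconj (z - RtoC (r n)))
      = (fx - (r n - 1) * Re (b n)) * (x - r n)
        + (fy - (r n - 1) * Im (b n)) * y)%R).
    { unfold fx, fy, x, y, Re, Im. simpl. ring. }
    assert (E2 : (Cmod (z - RtoC (r n)) ^ 2 = D n)%R).
    { rewrite Cmod_sqr. unfold D, x, y, Re, Im. simpl. ring. }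
    assert (E3 : (Re (f z * Cconj z) = fx * x + fy * y)%R).
    { unfold fx, fy, x, y, Re, Im. simpl. ring. }
    assert (E4 : (Re ((RtoC (r n) - 1) * b n * Cconj (RtoC (r n)))
      = - ((1 - r n) * (r n * Re (b n))))%R).
    { unfold Re, Im. simpl. ring. }
    rewrite E1, E2, E3, E4 in H2.
    apply Rmult_le_reg_l with (1 - r n)%R; [generalize (Hr n); lra|].
    unfold lhs, rhs. lra. }
  eassert (L1 : is_lim_seq lhs (Finite _)).
  { unfold lhs, D. lim_seq. }
  eassert (L2 : is_lim_seq rhs (Finite _)).
  { unfold rhs, D. lim_seq. }
  assert (H := is_lim_seq_le _ _ _ _ Hle L1 L2). simpl in H.
  assert (E5 : (Cmod (1 - z) ^ 2 = (x - 1) * (x - 1) + y * y)%R).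
  { rewrite Cmod_sqr. unfold x, y, Re, Im. simpl. ring. }
  assert (E6 : (Re (f z * (Cconj (1 - z) * Cconj (1 - z)))
    = fx * ((1 - x) * (1 - x) - y * y) - fy * (2 * ((1 - x) * y)))%R).
  { unfold fx, fy, x, y, Re, Im. simpl. ring. }
  assert (E7 : (a = 1 - x * x - y * y)%R).
  { unfold a. rewrite Cmod_sqr. unfold x, y. ring. }
  rewrite E5, E6. fold a. rewrite E7 in *. lra.
Qed.

(** * A criterion for univalence and spirallikeness *)

Lemma telescope_lim (u : nat -> R) (q d : R) :
  (0 <= q < 1)%R -> (forall n, (Rabs (u (S n) - u n) <= d * q ^ n)%R) ->
  exists l : R, is_lim_seq u l.
Proof.
  intros Hq H.
  assert (Hs : ex_series (fun n => u (S n) - u n)%R).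
  { apply (ex_series_le (V := R_CompleteNormedModule) _ (fun n => d * q ^ n)%R).
    - exact H.
    - apply (ex_series_scal (V := R_NormedModule)). exists (/ (1 - q))%R.
      apply is_series_geom. rewrite Rabs_right; lra. }
  destruct Hs as [l Hl]. exists (l + u O)%R.
  apply is_lim_seq_incr_1.
  apply is_lim_seq_ext with
    (fun n => (sum_n (fun n => u (S n) - u n) n + u O)%R).
  - intros n. induction n as [|n IH].
    + rewrite sum_O. ring.
    + rewrite sum_Sn. unfold plus; simpl. unfold plus in IH; simpl in IH. lra.
  - apply is_lim_seq_plus'; [exact Hl|apply is_lim_seq_const].
Qed.

(** Banach's fixed point theorem on a closed half-plane. *)
Lemma half_plane_fixed_point (Phi : C -> C) (a q : R) :
  (0 <= q < 1)%R -> (forall z, (Re (Phi z) <= a)%R) ->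
  (forall z w, (Re z <= a)%R -> (Re w <= a)%R ->
     (Cmod (Phi z - Phi w) <= q * Cmod (z - w))%R) ->
  exists z, (Re z <= a)%R /\ Phi z = z.
Proof.
  intros Hq Ha HPhi.
  set (u := fun n => Nat.iter n Phi (Phi 0)).
  assert (Hu : forall n, (Re (u n) <= a)%R).
  { intros [|n]; apply Ha. }
  set (d := Cmod (u 1%nat - u O)).
  assert (Hd : forall n, (Cmod (u (S n) - u n) <= d * q ^ n)%R).
  { induction n as [|n IH].
    - simpl pow. rewrite Rmult_1_r. apply Rle_refl.
    - apply Rle_trans with (q * Cmod (u (S n) - u n))%R.
      + exact (HPhi _ _ (Hu (S n)) (Hu n)).
      + simpl pow. apply Rle_trans with (q * (d * q ^ n))%R; [|lra].
        apply Rmult_le_compat_l; [lra|exact IH]. }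
  destruct (telescope_lim (fun n => Re (u n)) q d Hq) as [x Hx].
  { intros n. rewrite <- re_minus. apply Rle_trans with (1 := re_le_Cmod _), Hd. }
  destruct (telescope_lim (fun n => Im (u n)) q d Hq) as [y Hy].
  { intros n. rewrite <- im_minus. apply Rle_trans with (1 := Im_le_Cmod _), Hd. }
  set (z := (x, y) : C).
  assert (Hz : (Re z <= a)%R).
  { apply (is_lim_seq_le (fun n => Re (u n)) (fun _ => a) x a Hu Hx),
      is_lim_seq_const. }
  exists z. split; [exact Hz|].
  set (e := fun n => (Rabs (Re (u n) - x) + Rabs (Im (u n) - y))%R).
  assert (He : forall n, (Cmod (u n - z) <= e n)%R).
  { intros n. exact (Cmod_le_abs (u n - z)). }
  assert (Le : is_lim_seq e 0%R).
  { replace 0%R with (Rabs (x - x) + Rabs (y - y))%R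
      by (rewrite !Rminus_diag, Rabs_R0; ring).
    apply is_lim_seq_plus'; apply (is_lim_seq_abs _ (Finite _));
      apply is_lim_seq_minus'; try assumption; apply is_lim_seq_const. }
  assert (H : forall n, (Cmod (Phi z - z) <= q * e n + e (S n))%R).
  { intros n.
    replace (Phi z - z) with ((Phi z - Phi (u n)) + (u (S n) - z))
      by (change (u (S n)) with (Phi (u n)); ring).
    apply Rle_trans with (1 := Cmod_triangle _ _).
    apply Rplus_le_compat; [|apply He].
    apply Rle_trans with (1 := HPhi _ _ Hz (Hu n)).
    rewrite Cmod_minus_sym. apply Rmult_le_compat_l; [lra|apply He]. }
  assert (H0 : (Cmod (Phi z - z) <= q * 0 + 0)%R).
  { apply (is_lim_seq_le (fun _ => Cmod (Phi z - z))
      (fun n => (q * e n + e (S n))%R) (Cmod (Phi z - z)) (q * 0 + 0)%R H).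
    - apply is_lim_seq_const.
    - apply is_lim_seq_plus'.
      + apply is_lim_seq_mult'; [apply is_lim_seq_const|exact Le].
      + apply (is_lim_seq_incr_1 e), Le. }
  assert (H1 : Cmod (Phi z - z) = 0%R).
  { generalize (Cmod_ge_0 (Phi z - z)). lra. }
  apply Cmod_eq_0 in H1.
  replace (Phi z) with (Phi z - z + z) by ring. rewrite H1. ring.
Qed.

Lemma segment_Re_le (a : R) (z w : C) (s : R) :
  (0 <= s <= 1)%R -> (Re z <= a)%R -> (Re w <= a)%R ->
  (Re (z + RtoC s * (w - z)) <= a)%R.
Proof.
  intros Hs Hz Hw. rewrite re_plus, re_scal_l, re_minus. nra.
Qed.

Lemma Re_conj_mult (v k : C) : Re (Cconj v * (k * v)) = (Cmod v ^ 2 * Re k)%R.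
Proof.
  rewrite Cmod_sqr. unfold Re, Im. simpl. ring.
Qed.

(** A function whose derivative has real part at least [delta > 0] on a convex
    set is a strongly monotone map of the plane. *)
Lemma half_plane_monotone (K K' : C -> C) (a delta : R) (z w : C) :
  (forall y, (Re y <= a)%R -> is_cderive K y (K' y) /\ (delta <= Re (K' y))%R) ->
  (Re z <= a)%R -> (Re w <= a)%R ->
  (delta * Cmod (w - z) ^ 2 <= Re (Cconj (w - z) * (K w - K z)))%R.
Proof.
  intros H Hz Hw.
  destruct (segment_mean_value K K' (Cconj (w - z)) z w) as [s [Hs E]].
  { intros s Hs. apply H, segment_Re_le; assumption. }
  rewrite E, Re_conj_mult, Rmult_comm.
  apply Rmult_le_compat_l; [apply pow2_ge_0|].
  apply H, segment_Re_le; assumption.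
Qed.

Lemma zero_of_scaled_sqr (d x : R) : (0 < d)%R -> (d * x ^ 2 <= 0)%R -> x = 0%R.
Proof.
  intros Hd H. destruct (Req_dec x 0) as [E|E]; [exact E|].
  assert (Hx : (0 < x ^ 2)%R) by (rewrite <- Rsqr_pow2; apply Rlt_0_sqr, E).
  assert (Hp := Rmult_lt_0_compat _ _ Hd Hx). lra.
Qed.

Lemma Rmin_contract (x y a : R) : ((Rmin x a - Rmin y a) ^ 2 <= (x - y) ^ 2)%R.
Proof.
  destruct (Rle_lt_dec x a) as [Hx|Hx], (Rle_lt_dec y a) as [Hy|Hy].
  - rewrite !Rmin_left by assumption. apply Rle_refl.
  - rewrite Rmin_left, Rmin_right by lra.
    assert (0 <= (a - x) * (y - a))%R by (apply Rmult_le_pos; lra).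
    generalize (pow2_ge_0 (y - a)). lra.
  - rewrite Rmin_right, Rmin_left by lra.
    assert (0 <= (x - a) * (a - y))%R by (apply Rmult_le_pos; lra).
    generalize (pow2_ge_0 (x - a)). lra.
  - rewrite !Rmin_right by lra. generalize (pow2_ge_0 (x - y)). lra.
Qed.

(** The image of the half-plane contains the horizontal ray running to the left
    from the image of a boundary point [z0].  A fixed point [z] of the projected
    step [z - e (K z - k)], with [k = K z0 - t], either solves [K z = k] or lies
    on the boundary line with [K z - k < 0]; monotonicity excludes the latter. *)
Lemma half_plane_ray (K K' : C -> C) (a delta M : R) (z0 : C) (t : R) :
  (0 < delta)%R ->
  (forall y, (Re y <= a)%R ->
     is_cderive K y (K' y) /\ (delta <= Re (K' y))%R /\ (Cmod (K' y) <= M)%R) ->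
  Re z0 = a -> (0 <= t)%R ->
  exists z, (Re z <= a)%R /\ K z = K z0 - RtoC t.
Proof.
  intros Hdel H Hz0 Ht.
  assert (HdM : (delta <= M)%R).
  { destruct (H z0) as [_ [H1 H2]]; [lra|]. generalize (Re_le_Cmod (K' z0)). lra. }
  set (k := K z0 - RtoC t).
  (* this step length minimises the bound 1 - 2 e delta + e^2 M^2 *)
  set (e := (delta / M ^ 2)%R).
  assert (HM2 : (0 < M ^ 2)%R) by (apply pow_lt; lra).
  assert (He : (0 < e)%R) by (apply Rdiv_lt_0_compat; assumption).
  set (q2 := (1 - delta ^ 2 / M ^ 2)%R).
  assert (Hq2 : (0 <= q2 < 1)%R).
  { unfold q2. split.
    - assert (delta ^ 2 / M ^ 2 <= 1)%R; [|lra].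
      apply Rmult_le_reg_r with (M ^ 2)%R; [exact HM2|].
      unfold Rdiv. rewrite Rmult_assoc, Rinv_l by lra. nra.
    - assert (0 < delta ^ 2 / M ^ 2)%R; [|lra].
      apply Rdiv_lt_0_compat; [apply pow_lt|]; assumption. }
  set (T := fun z => z - RtoC e * (K z - k)).
  assert (HT : forall z w, (Re z <= a)%R -> (Re w <= a)%R ->
    (Cmod (T w - T z) <= sqrt q2 * Cmod (w - z))%R).
  { intros z w Hz Hw.
    apply segment_mean_value_le with (g' := fun y => 1 - RtoC e * K' y).
    intros s Hs.
    destruct (H _ (segment_Re_le a z w s Hs Hz Hw)) as [D [D1 D2]].
    set (y := z + RtoC s * (w - z)) in *. split.
    - unfold T. eapply is_cderive_eq; [|cderive]. ring.
    - apply pow2_le_inv; [apply sqrt_pos|]. rewrite pow2_sqrt by lra.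
      rewrite Cmod_sqr, re_minus, im_minus, re_scal_l, im_scal_l.
      simpl (Re 1). simpl (Im 1).
      assert (Hb : (Re (K' y) ^ 2 + Im (K' y) ^ 2 <= M ^ 2)%R).
      { rewrite <- Cmod_sqr. apply pow_incr. split; [apply Cmod_ge_0|exact D2]. }
      replace ((1 - e * Re (K' y)) ^ 2 + (0 - e * Im (K' y)) ^ 2)%R
        with (1 - 2 * e * Re (K' y)
              + e ^ 2 * (Re (K' y) ^ 2 + Im (K' y) ^ 2))%R by ring.
      assert (X1 : (e * delta <= e * Re (K' y))%R)
        by (apply Rmult_le_compat_l; lra).
      assert (X2 : (e ^ 2 * (Re (K' y) ^ 2 + Im (K' y) ^ 2) <= e ^ 2 * M ^ 2)%R)
        by (apply Rmult_le_compat_l; [apply pow2_ge_0|exact Hb]).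
      assert (X3 : (e * delta = delta ^ 2 / M ^ 2)%R)
        by (unfold e; field; lra).
      assert (X4 : (e ^ 2 * M ^ 2 = delta ^ 2 / M ^ 2)%R)
        by (unfold e; field; lra).
      unfold q2. lra. }
  set (Phi := fun z => (Rmin (Re (T z)) a, Im (T z)) : C).
  destruct (half_plane_fixed_point Phi a (sqrt q2)) as [z [Hz E]].
  - split; [apply sqrt_pos|]. rewrite <- sqrt_1. apply sqrt_lt_1; lra.
  - intros z. apply Rmin_r.
  - intros z w Hz Hw. apply Rle_trans with (2 := HT w z Hw Hz).
    apply pow2_le_inv; [apply Cmod_ge_0|]. rewrite !Cmod_sqr.
    exact (Rplus_le_compat_r _ _ _ (Rmin_contract (Re (T z)) (Re (T w)) a)).
  - exists z. split; [exact Hz|].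
    assert (E1 : Re (Phi z) = Re z) by (rewrite E; reflexivity).
    assert (E2 : Im (Phi z) = Im z) by (rewrite E; reflexivity).
    set (v := K z - k).
    change (Rmin (Re (z - RtoC e * v)) a = Re z) in E1.
    change (Im (z - RtoC e * v) = Im z) in E2.
    rewrite re_minus, re_scal_l in E1. rewrite im_minus, im_scal_l in E2.
    assert (Iv : Im v = 0%R) by nra.
    assert (Rv : Re v = 0%R).
    { unfold Rmin in E1. destruct Rle_dec as [Hc|Hc]; [nra|].
      assert (Hneg : (Re v < 0)%R) by nra.
      assert (Hm := half_plane_monotone K K' a delta z0 z).
      feed Hm. { intros y Hy. split; apply H, Hy. }
      specialize (Hm ltac:(lra) Hz).
      replace (K z - K z0) with (v - RtoC t) in Hm by (unfold v, k; ring).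
      assert (HR : Re (Cconj (z - z0) * (v - RtoC t)) = 0%R).
      { rewrite re_mult, re_conj, im_conj, !re_minus, !im_minus, Iv.
        rewrite <- E1, Hz0. simpl. ring. }
      rewrite HR in Hm.
      assert (Hzz := zero_of_scaled_sqr _ _ Hdel Hm).
      apply Cmod_eq_0 in Hzz.
      assert (Ez : z = z0).
      { replace z with (z - z0 + z0) by ring. rewrite Hzz. ring. }
      revert Hneg. unfold v, k. rewrite Ez, !re_minus. simpl. lra. }
    fold k. replace (K z) with (v + k) by (unfold v; ring).
    replace v with (RtoC 0); [ring|]. symmetry.
    apply C_eq_Re_Im; simpl; assumption.
Qed.

(** The derivative of [log (mob tau z) + Psi z], divided by [mu], in the
    coordinate [log (mob tau z)]. *)
Definition spiral_quotient (tau mu : C) (Psi' : C -> C) (z : C) : C :=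
  (1 + Psi' z * ((z - tau) * (1 - z * Cconj tau) / (1 - tau * Cconj tau))) / mu.

(** Bounds on the hyperbolic discs around [tau]; punctured at [tau], they are the
    images of the half-planes to which [half_plane_ray] is applied. *)
Definition spiral_bounds (tau mu : C) (Psi' : C -> C) : Prop :=
  forall r : R, (r < 1)%R -> exists delta M : R, (0 < delta)%R /\
    forall z, unit_disc z -> (Cmod (mob tau z) <= r)%R ->
      (delta <= Re (spiral_quotient tau mu Psi' z))%R /\
      (Cmod (spiral_quotient tau mu Psi' z) <= M)%R.

Lemma mob_eq_0 (tau z : C) : unit_disc tau -> unit_disc z ->
  mob tau z = 0 -> z = tau.
Proof.
  intros Ht Hz E.
  rewrite <- (mob_opp_mob tau z Ht Hz), E. unfold mob. field.
Qed.

Lemma Cexp_disc (zeta : C) : (Re zeta < 0)%R -> unit_disc (Cexp zeta).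
Proof.
  intros H. unfold unit_disc. rewrite Cmod_Cexp, <- exp_0.
  apply exp_increasing, H.
Qed.

Lemma Re_neg_of_Cexp_disc (zeta : C) : unit_disc (Cexp zeta) -> (Re zeta < 0)%R.
Proof.
  unfold unit_disc. rewrite Cmod_Cexp, <- exp_0. apply exp_lt_inv.
Qed.

(** The covering of the disc punctured at [tau] by the left half-plane. *)
Definition disc_cover (tau zeta : C) : C := mob (- tau) (Cexp zeta).

Lemma disc_cover_disc (tau zeta : C) :
  unit_disc tau -> (Re zeta < 0)%R -> unit_disc (disc_cover tau zeta).
Proof.
  intros Ht Hz. apply mob_disc; [apply unit_disc_opp, Ht|apply Cexp_disc, Hz].
Qed.

Lemma mob_disc_cover (tau zeta : C) :
  unit_disc tau -> (Re zeta < 0)%R -> mob tau (disc_cover tau zeta) = Cexp zeta.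
Proof. intros Ht Hz. apply mob_mob_opp; [exact Ht|apply Cexp_disc, Hz]. Qed.

Lemma disc_cover_surj (tau z : C) :
  unit_disc tau -> unit_disc z -> z <> tau ->
  exists zeta, (Re zeta < 0)%R /\ disc_cover tau zeta = z.
Proof.
  intros Ht Hz Hne.
  destruct (Cexp_surj (mob tau z)) as [zeta E].
  { intros E. apply Hne, mob_eq_0; assumption. }
  exists zeta. split.
  - apply Re_neg_of_Cexp_disc. rewrite E. apply mob_disc; assumption.
  - unfold disc_cover. rewrite E. apply mob_opp_mob; assumption.
Qed.

Lemma disc_cover_derive (tau zeta : C) :
  unit_disc tau -> (Re zeta < 0)%R ->
  let z := disc_cover tau zeta in
  is_cderive (disc_cover tau) zeta
    ((z - tau) * (1 - z * Cconj tau) / (1 - tau * Cconj tau)).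
Proof.
  intros Ht Hz z.
  assert (Ht' := unit_disc_opp _ Ht).
  assert (He := Cexp_disc _ Hz).
  assert (H1 := mob_denom_neq_0 _ _ Ht' (Rlt_le _ _ He)).
  assert (H2 := mob_denom_neq_0 _ _ Ht (Rlt_le _ _ Ht)).
  rewrite Copp_conj in H1.
  eapply is_cderive_eq.
  2: { apply (is_cderive_comp (mob (- tau)) Cexp).
       - apply mob_derive; [exact Ht'|left; exact He].
       - apply is_cderive_Cexp. }
  unfold z, disc_cover, mob. rewrite Copp_conj. field.
  repeat split; try exact H2.
  replace (1 - Cexp zeta * - Cconj tau) with (1 - Cexp zeta * - Cconj tau)
    in H1 by ring.
  exact H1.
Qed.

Lemma log_coordinate_derive (tau mu zeta : C) (Psi Psi' : C -> C) :
  unit_disc tau -> mu <> 0 -> (Re zeta < 0)%R ->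
  (forall z, unit_disc z -> is_cderive Psi z (Psi' z)) ->
  is_cderive (fun x => (x + Psi (disc_cover tau x)) / mu) zeta
    (spiral_quotient tau mu Psi' (disc_cover tau zeta)).
Proof.
  intros Ht Hmu Hz HPsi.
  assert (H : 1 - tau * Cconj tau <> 0).
  { apply mob_denom_neq_0; [exact Ht|left; exact Ht]. }
  assert (D : is_cderive (fun x => Psi (disc_cover tau x)) zeta
    ((disc_cover tau zeta - tau) * (1 - disc_cover tau zeta * Cconj tau)
     / (1 - tau * Cconj tau) * Psi' (disc_cover tau zeta))).
  { apply (is_cderive_comp Psi); [apply HPsi, disc_cover_disc; assumption|].
    apply disc_cover_derive; assumption. }
  unfold spiral_quotient.
  eapply is_cderive_eq; [|cderive; exact Hmu].
  field. auto.
Qed.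

(** In the coordinate [zeta = log (mob tau z)], which ranges over a half-plane,
    [log g = zeta + Psi] has a derivative whose quotient by [mu] has positive
    real part, so it is injective; and it advances by [2 pi i] with [zeta], so
    equal values of [g] come from values of [zeta] over the same point. *)
Lemma spiral_univalent (tau mu kappa : C) (g Psi Psi' : C -> C) :
  unit_disc tau -> mu <> 0 -> kappa <> 0 ->
  (forall z, unit_disc z -> is_cderive Psi z (Psi' z)) ->
  (forall z, unit_disc z -> g z = kappa * mob tau z * Cexp (Psi z)) ->
  spiral_bounds tau mu Psi' ->
  forall z1 z2, unit_disc z1 -> unit_disc z2 -> g z1 = g z2 -> z1 = z2.
Proof.
  intros Ht Hmu Hk HPsi Hg HB z1 z2 Hz1 Hz2 E.
  assert (Hg0 : forall z, unit_disc z -> g z = 0 -> z = tau).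
  { intros z Hz E0. apply mob_eq_0; [exact Ht|exact Hz|].
    destruct (excluded_middle_informative (mob tau z = 0)) as [H|H]; [exact H|].
    exfalso. rewrite (Hg z Hz) in E0. revert E0.
    apply Cmult_neq_0; [|apply Cexp_neq_0].
    apply Cmult_neq_0; [exact Hk|exact H]. }
  assert (Hgt : g tau = 0).
  { rewrite (Hg tau Ht). unfold mob. replace (tau - tau) with (RtoC 0) by ring.
    unfold Cdiv. ring. }
  destruct (excluded_middle_informative (z1 = tau)) as [E1|N1].
  { subst z1. symmetry. apply Hg0; [exact Hz2|]. rewrite <- E. exact Hgt. }
  destruct (excluded_middle_informative (z2 = tau)) as [E2|N2].
  { subst z2. apply Hg0; [exact Hz1|]. rewrite E. exact Hgt. }
  destruct (disc_cover_surj tau z1 Ht Hz1 N1) as [x1 [Hx1 D1]].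
  destruct (disc_cover_surj tau z2 Ht Hz2 N2) as [x2 [Hx2 D2]].
  assert (M1 := mob_disc_cover tau x1 Ht Hx1). rewrite D1 in M1.
  assert (M2 := mob_disc_cover tau x2 Ht Hx2). rewrite D2 in M2.
  rewrite (Hg z1 Hz1), (Hg z2 Hz2), M1, M2 in E.
  assert (Hper : exists k : Z,
    x1 + Psi z1 - (x2 + Psi z2) = RtoC (2 * IZR k * PI) * Ci).
  { apply Cexp_eq_1. rewrite Cexp_minus, !Cexp_plus.
    assert (HE : Cexp x1 * Cexp (Psi z1) = Cexp x2 * Cexp (Psi z2)).
    { replace (Cexp x1 * Cexp (Psi z1))
        with (/ kappa * (kappa * Cexp x1 * Cexp (Psi z1)))
        by (field; exact Hk).
      rewrite E. field. exact Hk. }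
    rewrite HE. field. split; apply Cexp_neq_0. }
  destruct Hper as [k Hper].
  set (x3 := x2 + RtoC (2 * IZR k * PI) * Ci).
  assert (Hx3 : Re x3 = Re x2).
  { unfold x3. rewrite re_plus. simpl. ring. }
  assert (E3 : Cexp x3 = Cexp x2).
  { unfold x3. rewrite Cexp_plus, Cexp_period. ring. }
  assert (D3 : disc_cover tau x3 = z2).
  { unfold disc_cover. rewrite E3. exact D2. }
  set (K := fun x => (x + Psi (disc_cover tau x)) / mu).
  assert (EK : K x1 = K x3).
  { unfold K. rewrite D1, D3. f_equal. unfold x3.
    replace (RtoC (2 * IZR k * PI) * Ci)
      with (x1 + Psi z1 - (x2 + Psi z2)) by exact Hper. ring. }
  set (a := Rmax (Re x1) (Re x2)).
  assert (Ha : (a < 0)%R) by (apply Rmax_lub_lt; assumption).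
  destruct (HB (exp a)) as [delta [M [Hdel Hb]]].
  { rewrite <- exp_0. apply exp_increasing, Ha. }
  assert (Hm := half_plane_monotone K
    (fun x => spiral_quotient tau mu Psi' (disc_cover tau x)) a delta x1 x3).
  feed Hm.
  { intros y Hy. assert (Hy0 : (Re y < 0)%R) by lra.
    assert (Dy := disc_cover_disc tau y Ht Hy0). split.
    - apply log_coordinate_derive; auto.
    - apply Hb; [exact Dy|].
      rewrite mob_disc_cover, Cmod_Cexp by assumption. apply exp_le, Hy. }
  specialize (Hm (Rmax_l _ _)). rewrite Hx3 in Hm. specialize (Hm (Rmax_r _ _)).
  rewrite EK in Hm. replace (K x3 - K x3) with (RtoC 0) in Hm by ring.
  rewrite Cmult_0_r in Hm. simpl (Re 0) in Hm.
  assert (Hz := zero_of_scaled_sqr _ _ Hdel Hm).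
  apply Cmod_eq_0 in Hz.
  rewrite <- D1, <- D3. f_equal.
  replace x3 with (x3 - x1 + x1) by ring. rewrite Hz. ring.
Qed.

(** A shift by [- t] in the coordinate [log g / mu] multiplies [g] by
    [exp (- t mu)], and [half_plane_ray] provides the point so reached. *)
Lemma spiral_invariant (tau mu kappa : C) (g Psi Psi' : C -> C) :
  unit_disc tau -> mu <> 0 ->
  (forall z, unit_disc z -> is_cderive Psi z (Psi' z)) ->
  (forall z, unit_disc z -> g z = kappa * mob tau z * Cexp (Psi z)) ->
  spiral_bounds tau mu Psi' ->
  forall z t, unit_disc z -> (0 <= t)%R ->
    image_disc g (Cexp (- (RtoC t * mu)) * g z).
Proof.
  intros Ht Hmu HPsi Hg HB z t Hz Htp.
  destruct (excluded_middle_informative (z = tau)) as [->|N].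
  { exists tau. split; [exact Ht|]. rewrite (Hg tau Ht). unfold mob.
    replace (tau - tau) with (RtoC 0) by ring. unfold Cdiv. ring. }
  destruct (disc_cover_surj tau z Ht Hz N) as [x0 [Hx0 D0]].
  destruct (HB (exp (Re x0))) as [delta [M [Hdel Hb]]].
  { rewrite <- exp_0. apply exp_increasing, Hx0. }
  set (K := fun x => (x + Psi (disc_cover tau x)) / mu).
  destruct (half_plane_ray K
    (fun x => spiral_quotient tau mu Psi' (disc_cover tau x))
    (Re x0) delta M x0 t Hdel) as [x [Hx E]]; [|reflexivity|exact Htp|].
  { intros y Hy. assert (Hy0 : (Re y < 0)%R) by lra.
    assert (Dy := disc_cover_disc tau y Ht Hy0). split.
    - apply log_coordinate_derive; auto.
    - apply Hb; [exact Dy|].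
      rewrite mob_disc_cover, Cmod_Cexp by assumption. apply exp_le, Hy. }
  assert (Hx1 : (Re x < 0)%R) by lra.
  assert (Dx := disc_cover_disc tau x Ht Hx1).
  exists (disc_cover tau x). split; [exact Dx|].
  assert (HG : forall y, (Re y < 0)%R ->
    g (disc_cover tau y) = kappa * Cexp (mu * K y)).
  { intros y Hy. rewrite Hg by (apply disc_cover_disc; assumption).
    rewrite mob_disc_cover by assumption. unfold K.
    replace (mu * ((y + Psi (disc_cover tau y)) / mu))
      with (y + Psi (disc_cover tau y)) by (field; exact Hmu).
    rewrite Cexp_plus. ring. }
  rewrite <- D0, (HG x Hx1), (HG x0 Hx0), E.
  replace (mu * (K x0 - RtoC t)) with (- (RtoC t * mu) + mu * K x0) by ring.
  rewrite Cexp_plus. ring.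
Qed.

(** * Harnack-type bounds in the half-plane *)

(** The inequality satisfied by generators of [G^+[1]]; with
    [w = (1 + z) / (1 - z)] and [P = - 2 f / (1 - z)^2] it reads
    [beta Re w <= Re P]. *)
Definition generator_bound (f : C -> C) (beta : R) : Prop :=
  forall z, unit_disc z ->
    (beta * (1 - Cmod z ^ 2) * Cmod (1 - z) ^ 2
     <= - 2 * Re (f z * (Cconj (1 - z) * Cconj (1 - z))))%R.

Lemma one_minus_neq_0 (z : C) : unit_disc z -> 1 - z <> 0.
Proof.
  intros Hz. apply Cmod_pos_neq_0. unfold unit_disc in Hz.
  generalize (Cmod_triangle_rev 1 z). rewrite Cmod_1. lra.
Qed.

Lemma generator_bound_Cmod (f : C -> C) (beta : R) (z : C) :
  generator_bound f beta -> unit_disc z ->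
  (beta * (1 - Cmod z ^ 2) / 2 <= Cmod (f z))%R.
Proof.
  intros H Hz. specialize (H z Hz).
  assert (H1 : (0 < Cmod (1 - z))%R) by (apply Cmod_gt_0, one_minus_neq_0, Hz).
  assert (H2 := re_le_Cmod (f z * (Cconj (1 - z) * Cconj (1 - z)))).
  rewrite !Cmod_mult, !Cmod_conj in H2.
  apply Rabs_le_between in H2.
  assert (H3 : (0 < Cmod (1 - z) ^ 2)%R) by (apply pow_lt, H1).
  apply Rmult_le_reg_r with (Cmod (1 - z) ^ 2)%R; [exact H3|]. lra.
Qed.

Lemma generator_bound_neq_0 (f : C -> C) (beta : R) (z : C) :
  (0 < beta)%R -> generator_bound f beta -> unit_disc z -> f z <> 0.
Proof.
  intros Hb H Hz. apply Cmod_pos_neq_0.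
  assert (H1 := generator_bound_Cmod f beta z H Hz).
  assert (H2 := Rmult_lt_0_compat _ _ Hb (Cmod_sqr_lt_1 z Hz)). lra.
Qed.

Lemma Omega_plus_sqr (beta : R) (w : C) :
  Omega_plus beta w -> (Cmod w ^ 2 <= 2 * beta * Re w)%R.
Proof.
  intros [H _].
  assert (H2 : (Cmod (w - RtoC beta) ^ 2 <= beta ^ 2)%R).
  { apply pow_incr. split; [apply Cmod_ge_0|exact H]. }
  rewrite Cmod_sqr, re_minus, im_minus in H2. rewrite Cmod_sqr.
  simpl (Re (RtoC beta)) in H2. simpl (Im (RtoC beta)) in H2. lra.
Qed.

Lemma Omega_plus_Re_pos (beta : R) (w : C) :
  (0 < beta)%R -> Omega_plus beta w -> (0 < Re w)%R.
Proof.
  intros Hb H. assert (H1 := Omega_plus_sqr beta w H). destruct H as [_ H0].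
  apply Cmod_gt_0 in H0.
  assert (H2 : (0 < Cmod w ^ 2)%R) by (apply pow_lt, H0). nra.
Qed.

Lemma Re_inv (w : C) : w <> 0 -> Re (/ w) = (Re w / Cmod w ^ 2)%R.
Proof. intros H. rewrite Cmod_sqr. reflexivity. Qed.

Lemma Omega_plus_inv (beta : R) (w : C) :
  (0 < beta)%R -> Omega_plus beta w -> (/ beta <= 2 * Re (/ w))%R.
Proof.
  intros Hb H. assert (H1 := Omega_plus_sqr beta w H). destruct H as [_ H0].
  rewrite Re_inv by exact H0. apply Cmod_gt_0 in H0.
  assert (H2 : (0 < Cmod w ^ 2)%R) by (apply pow_lt, H0).
  apply Rmult_le_reg_r with (beta * Cmod w ^ 2)%R; [nra|].
  replace (/ beta * (beta * Cmod w ^ 2))%R with (Cmod w ^ 2)%R by (field; lra).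
  replace (2 * (Re w / Cmod w ^ 2) * (beta * Cmod w ^ 2))%R
    with (2 * beta * Re w)%R by (field; lra).
  exact H1.
Qed.

(** The hypothesis says that [2 beta (Re w) X] lies in the disc of centre and
    radius [1], so the real part of its product with
    [A = (w - sigma) (w + conj sigma)] is at most [Re A + |A|]. *)
Lemma half_plane_harnack (w sigma X : C) (beta rho : R) :
  (0 < beta)%R -> (0 < Re w)%R -> (0 <= rho)%R ->
  (beta * Re w * Cmod X ^ 2 <= Re X)%R ->
  Cmod (w - sigma) = (rho * Cmod (w + Cconj sigma))%R ->
  (Re sigma * (1 - rho)
   <= (1 + rho) * (Re w - beta * Re ((w - sigma) * (w + Cconj sigma) * X)))%R.
Proof.
  intros Hb Hw Hrho HX Hrat.
  set (u := Re w) in *. set (s := Re sigma).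
  set (N := (Cmod (w + Cconj sigma) ^ 2)%R).
  set (A := (w - sigma) * (w + Cconj sigma)).
  assert (HN : (rho ^ 2 * N = N - 4 * u * s)%R).
  { replace (rho ^ 2 * N)%R with (Cmod (w - sigma) ^ 2)%R
      by (rewrite Hrat; unfold N; ring).
    unfold N. rewrite !Cmod_sqr. unfold u, s, Re, Im. simpl. ring. }
  assert (HA : Re A = (2 * u ^ 2 + 2 * u * s - N)%R).
  { unfold A, N. rewrite Cmod_sqr. unfold u, s, Re, Im. simpl. ring. }
  assert (HmA : Cmod A = (rho * N)%R).
  { unfold A. rewrite Cmod_mult, Hrat. unfold N. ring. }
  set (Y := RtoC (2 * beta * u) * X).
  assert (HY : (Cmod (Y - 1) <= 1)%R).
  { apply pow2_le_inv; [lra|]. rewrite Cmod_sqr in HX |- *.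
    unfold Y. rewrite re_minus, im_minus, re_scal_l, im_scal_l.
    simpl (Re 1). simpl (Im 1).
    assert (HX' : (4 * beta * u * (beta * u * (Re X ^ 2 + Im X ^ 2))
      <= 4 * beta * u * Re X)%R).
    { apply Rmult_le_compat_l; [|exact HX].
      assert (H := Rmult_lt_0_compat _ _ Hb Hw). lra. }
    lra. }
  assert (HR : (2 * beta * u * Re (A * X) <= Re A + rho * N)%R).
  { rewrite <- re_scal_l.
    replace (RtoC (2 * beta * u) * (A * X)) with (A + A * (Y - 1))
      by (unfold Y; ring).
    rewrite re_plus. apply Rplus_le_compat_l.
    apply Rle_trans with (1 := Re_le_Cmod _).
    rewrite Cmod_mult, HmA. rewrite <- (Rmult_1_r (rho * N)) at 2.
    apply Rmult_le_compat_l; [|exact HY].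
    apply Rmult_le_pos; [exact Hrho|]. unfold N. apply pow2_ge_0. }
  rewrite HA in HR.
  assert (H1 : (N * (1 - rho) - 2 * u * s
    <= 2 * u * (u - beta * Re (A * X)))%R) by lra.
  apply Rmult_le_reg_l with (2 * u)%R; [lra|].
  apply Rmult_le_compat_l with (r := (1 + rho)%R) in H1; [|lra].
  lra.
Qed.

Lemma half_plane_coordinate_Re (z : C) :
  unit_disc z ->
  Re ((1 + z) / (1 - z)) = ((1 - Cmod z ^ 2) / Cmod (1 - z) ^ 2)%R.
Proof.
  intros Hz. assert (H := one_minus_neq_0 z Hz).
  assert (Hm := proj1 (Cmod_gt_0 _) H).
  replace ((1 + z) / (1 - z))
    with (RtoC (/ Cmod (1 - z) ^ 2) * ((1 + z) * Cconj (1 - z))).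
  - rewrite re_scal_l.
    replace (Re ((1 + z) * Cconj (1 - z))) with (1 - Cmod z ^ 2)%R.
    + field. lra.
    + rewrite Cmod_sqr. unfold Re, Im. simpl. ring.
  - rewrite RtoC_inv, Cmod2_conj by (apply pow_nonzero; lra). field. split; [|exact (Cconj_neq_0 _ H)].
    exact H.
Qed.

Lemma RtoC_2_neq_0 : RtoC 2 <> 0.
Proof. intros F. apply RtoC_inj in F. lra. Qed.

(** The half-plane coordinates [w], [sigma] of [z], [tau] and [X = 1 / P] turn
    the quotient into
    [1 / mu + (2 Re (1 / mu) (w - sigma) - A X) / (2 Re sigma)]. *)
Lemma spiral_quotient_half_plane (f : C -> C) (mu tau z : C) (Psi' : C -> C) :
  mu <> 0 -> unit_disc tau -> unit_disc z -> f z <> 0 ->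
  Psi' z = mu / f z + (1 + mu / Cconj mu)
             * ((1 - Cconj tau) / ((1 - z * Cconj tau) * (1 - z))) ->
  let w := (1 + z) / (1 - z) in
  let sigma := (1 + tau) / (1 - tau) in
  let X := - ((1 - z) * (1 - z)) / (2 * f z) in
  spiral_quotient tau mu Psi' z
  = / mu + ((/ mu + / Cconj mu) * (w - sigma)
            - (w - sigma) * (w + Cconj sigma) * X) / (sigma + Cconj sigma).
Proof.
  intros Hmu Ht Hz Hf E w sigma X.
  assert (H1 := one_minus_neq_0 z Hz). assert (H2 := one_minus_neq_0 tau Ht).
  assert (H3 := mob_denom_neq_0 tau z Ht (Rlt_le _ _ Hz)).
  assert (H4 := mob_denom_neq_0 tau tau Ht (Rlt_le _ _ Ht)).
  assert (H5 : 1 - Cconj tau <> 0).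
  { generalize (Cconj_neq_0 _ H2). rewrite Cminus_conj, Cconj_1. auto. }
  assert (H6 := Cconj_neq_0 _ Hmu).
  assert (Hsc : Cconj sigma = (1 + Cconj tau) / (1 - Cconj tau)).
  { unfold sigma. rewrite Cdiv_conj by exact H2.
    rewrite Cplus_conj, Cminus_conj, Cconj_1. reflexivity. }
  rewrite Hsc. unfold spiral_quotient. rewrite E.
  assert (Hss : sigma + (1 + Cconj tau) / (1 - Cconj tau)
    = 2 * (1 - tau * Cconj tau) / ((1 - tau) * (1 - Cconj tau))).
  { unfold sigma. field. auto. }
  rewrite Hss. unfold w, sigma, X.
  assert (H7 := RtoC_2_neq_0).
  field. repeat split; auto.
Qed.

Lemma inv_P_Re (f z : C) (beta : R) :
  unit_disc z -> f <> 0 ->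
  (beta * (1 - Cmod z ^ 2) * Cmod (1 - z) ^ 2
     <= - 2 * Re (f * (Cconj (1 - z) * Cconj (1 - z))))%R ->
  let X := - ((1 - z) * (1 - z)) / (2 * f) in
  (beta * Re ((1 + z) / (1 - z)) * Cmod X ^ 2 <= Re X)%R.
Proof.
  intros Hz Hf H X.
  assert (H1 := one_minus_neq_0 z Hz).
  assert (Hm := proj1 (Cmod_gt_0 _) H1). assert (Hmf := proj1 (Cmod_gt_0 _) Hf).
  rewrite half_plane_coordinate_Re by exact Hz.
  assert (EX : X = RtoC (/ (2 * Cmod f ^ 2))
    * - Cconj (f * (Cconj (1 - z) * Cconj (1 - z)))).
  { unfold X. rewrite RtoC_inv, RtoC_mult, Cmod2_conj
      by (apply Rmult_integral_contrapositive_currified; [lra|];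
          apply pow_nonzero; lra).
    rewrite !Cmult_conj, !Cconj_conj. field. split; [exact (Cconj_neq_0 _ Hf)|exact Hf]. }
  assert (ER : Re X = (/ (2 * Cmod f ^ 2)
    * - Re (f * (Cconj (1 - z) * Cconj (1 - z))))%R).
  { rewrite EX, re_scal_l, re_opp, re_conj. reflexivity. }
  assert (EM : (Cmod X = Cmod (1 - z) ^ 2 / (2 * Cmod f))%R).
  { unfold X. rewrite Cmod_div.
    - rewrite Cmod_opp, !Cmod_mult, Cmod_R, Rabs_right by lra. field. lra.
    - apply Cmult_neq_0; [exact RtoC_2_neq_0|exact Hf]. }
  rewrite ER, EM.
  apply Rmult_le_reg_r with (4 * Cmod f ^ 2)%R.
  { assert (H3 : (0 < Cmod f ^ 2)%R) by (apply pow_lt, Hmf). lra. }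
  replace (beta * ((1 - Cmod z ^ 2) / Cmod (1 - z) ^ 2)
    * (Cmod (1 - z) ^ 2 / (2 * Cmod f)) ^ 2 * (4 * Cmod f ^ 2))%R
    with (beta * (1 - Cmod z ^ 2) * Cmod (1 - z) ^ 2)%R by (field; lra).
  match goal with |- (_ <= / _ * - ?Y * _)%R =>
    replace (/ (2 * Cmod f ^ 2) * - Y * (4 * Cmod f ^ 2))%R with (- 2 * Y)%R
      by (field; lra) end.
  exact H.
Qed.

Lemma Cmod_half_plane_mob (tau z : C) :
  unit_disc tau -> unit_disc z ->
  let w := (1 + z) / (1 - z) in
  let sigma := (1 + tau) / (1 - tau) in
  Cmod (w - sigma) = (Cmod (mob tau z) * Cmod (w + Cconj sigma))%R.
Proof.
  intros Ht Hz w sigma.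
  assert (H1 := one_minus_neq_0 z Hz). assert (H2 := one_minus_neq_0 tau Ht).
  assert (H3 := mob_denom_neq_0 tau z Ht (Rlt_le _ _ Hz)).
  assert (H5 : Cconj (1 - tau) <> 0) by (apply Cconj_neq_0, H2).
  assert (H6 : 1 - Cconj tau <> 0).
  { rewrite Cminus_conj, Cconj_1 in H5. exact H5. }
  assert (E : w - sigma
    = mob tau z * (w + Cconj sigma) * (Cconj (1 - tau) / (1 - tau))).
  { unfold w, sigma, mob. rewrite Cdiv_conj by exact H2.
    rewrite Cplus_conj, Cminus_conj, Cconj_1. field. auto. }
  rewrite E, !Cmod_mult, Cmod_div, Cmod_conj by exact H2.
  unfold Rdiv. rewrite Rinv_r by (apply Rgt_not_eq, Cmod_gt_0, H2). ring.
Qed.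

Lemma spiral_quotient_Re_ge (f : C -> C) (beta : R) (mu tau z : C)
    (Psi' : C -> C) :
  (0 < beta)%R -> generator_bound f beta -> Omega_plus beta mu ->
  unit_disc tau -> unit_disc z ->
  Psi' z = mu / f z + (1 + mu / Cconj mu)
             * ((1 - Cconj tau) / ((1 - z * Cconj tau) * (1 - z))) ->
  ((1 - Cmod (mob tau z)) / (4 * beta)
   <= Re (spiral_quotient tau mu Psi' z))%R.
Proof.
  intros Hb Hf Hmu Ht Hz E.
  assert (Hf0 := generator_bound_neq_0 f beta z Hb Hf Hz).
  assert (Hmu0 := proj2 Hmu).
  rewrite (spiral_quotient_half_plane f) by assumption.
  assert (HX := inv_P_Re (f z) z beta Hz Hf0 (Hf z Hz)).
  assert (Hrat := Cmod_half_plane_mob tau z Ht Hz).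
  assert (Hu := half_plane_coordinate_Re z Hz).
  assert (Hs := half_plane_coordinate_Re tau Ht).
  cbv zeta in HX, Hrat.
  set (w := (1 + z) / (1 - z)) in *.
  set (sigma := (1 + tau) / (1 - tau)) in *.
  set (X := - ((1 - z) * (1 - z)) / (2 * f z)) in *.
  set (rho := Cmod (mob tau z)) in *.
  assert (Hrho : (0 <= rho < 1)%R).
  { split; [apply Cmod_ge_0|]. apply (mob_disc tau z Ht Hz). }
  assert (Hpos : forall y, unit_disc y ->
    (0 < (1 - Cmod y ^ 2) / Cmod (1 - y) ^ 2)%R).
  { intros y Hy. apply Rdiv_lt_0_compat; [apply Cmod_sqr_lt_1, Hy|].
    apply pow_lt, Cmod_gt_0, one_minus_neq_0, Hy. }
  assert (Hu0 : (0 < Re w)%R) by (rewrite Hu; apply Hpos, Hz).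
  assert (Hs0 : (0 < Re sigma)%R) by (rewrite Hs; apply Hpos, Ht).
  assert (Hh := half_plane_harnack w sigma X beta rho Hb Hu0 (proj1 Hrho) HX Hrat).
  assert (Ha := Omega_plus_inv beta mu Hb Hmu).
  set (a := Re (/ mu)) in *.
  assert (Es : sigma + Cconj sigma = RtoC (2 * Re sigma)).
  { apply C_eq_Re_Im; simpl; ring. }
  assert (Em : / mu + / Cconj mu = RtoC (2 * a)).
  { rewrite <- Cinv_conj by exact Hmu0. unfold a. apply C_eq_Re_Im; simpl; ring. }
  rewrite Es, Em.
  set (A := (w - sigma) * (w + Cconj sigma)) in *.
  assert (EQ : Re (/ mu + (RtoC (2 * a) * (w - sigma) - A * X)
      / RtoC (2 * Re sigma))
    = ((2 * a * Re w - Re (A * X)) / (2 * Re sigma))%R).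
  { unfold Cdiv. rewrite <- RtoC_inv, re_plus, re_scal_r, re_minus, re_scal_l,
      re_minus by lra.
    fold a. field. lra. }
  rewrite EQ.
  set (B := Re (A * X)) in *.
  apply Rmult_le_reg_r with (4 * beta * (2 * Re sigma))%R.
  { apply Rmult_lt_0_compat; lra. }
  replace ((1 - rho) / (4 * beta) * (4 * beta * (2 * Re sigma)))%R
    with (2 * (Re sigma * (1 - rho)))%R by (field; lra).
  replace ((2 * a * Re w - B) / (2 * Re sigma) * (4 * beta * (2 * Re sigma)))%R
    with (4 * (beta * (2 * a) * Re w - beta * B))%R by (field; lra).
  assert (Hba : (1 <= beta * (2 * a))%R).
  { apply Rmult_le_compat_l with (r := beta) in Ha; [|lra].
    rewrite Rinv_r in Ha by lra. exact Ha. }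
  assert (H1 : (Re w <= beta * (2 * a) * Re w)%R) by nra.
  (* the factor 1 + rho of the Harnack bound lies between 1 and 2 *)
  set (V := (Re w - beta * B)%R) in *.
  assert (HV : (0 <= V)%R).
  { assert (0 <= Re sigma * (1 - rho))%R by (apply Rmult_le_pos; lra).
    nra. }
  assert (H2 : ((1 + rho) * V <= 2 * V)%R) by nra.
  unfold V in *. lra.
Qed.

Lemma Cmod_le_2 (z w : C) : unit_disc z -> unit_disc w -> (Cmod (z - w) <= 2)%R.
Proof.
  unfold unit_disc. intros Hz Hw. generalize (Cmod_triangle_minus z w). lra.
Qed.

Lemma one_minus_sqr_ge (tau z : C) (r : R) :
  unit_disc tau -> unit_disc z -> (Cmod (mob tau z) <= r)%R -> (r < 1)%R ->
  ((1 - r) * (1 - Cmod tau) ^ 2 <= 1 - Cmod z ^ 2)%R.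
Proof.
  intros Ht Hz Hm Hr.
  assert (D := mob_defect tau z Ht (Rlt_le _ _ Hz)).
  assert (Hd := Cmod_mob_denom_ge tau z (Rlt_le _ _ Hz)).
  assert (Hz1 := Cmod_sqr_lt_1 z Hz).
  unfold unit_disc in Ht.
  set (q := Cmod (1 - z * Cconj tau)) in *.
  assert (Hq : (0 < q)%R) by lra.
  set (rho := Cmod (mob tau z)) in *.
  assert (Hrho : (0 <= rho)%R) by apply Cmod_ge_0.
  assert (H1 : (1 - r <= 1 - rho ^ 2)%R) by nra.
  assert (H2 : ((1 - rho ^ 2) * q ^ 2 <= 1 - Cmod z ^ 2)%R).
  { rewrite D. unfold Rdiv. rewrite Rmult_assoc, Rinv_l
      by (apply pow_nonzero; lra).
    rewrite Rmult_1_r. generalize (pow2_ge_0 (Cmod tau)). nra. }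
  apply Rle_trans with (2 := H2).
  apply Rmult_le_compat; [lra|apply pow2_ge_0|exact H1|].
  apply pow_incr. lra.
Qed.

Lemma spiral_bounds_of_generator (f : C -> C) (beta : R) (mu tau : C)
    (Psi' : C -> C) :
  (0 < beta)%R -> generator_bound f beta -> Omega_plus beta mu ->
  unit_disc tau ->
  (forall z, unit_disc z ->
     Psi' z = mu / f z + (1 + mu / Cconj mu)
               * ((1 - Cconj tau) / ((1 - z * Cconj tau) * (1 - z)))) ->
  spiral_bounds tau mu Psi'.
Proof.
  intros Hb Hf Hmu Ht E r Hr.
  assert (Hmu0 := proj2 Hmu).
  assert (Hmm := proj1 (Cmod_gt_0 _) Hmu0).
  set (m := ((1 - r) * (1 - Cmod tau) ^ 2)%R).
  assert (Hm : (0 < m)%R).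
  { apply Rmult_lt_0_compat; [lra|]. apply pow_lt. unfold unit_disc in Ht. lra. }
  assert (Htt : 1 - tau * Cconj tau = RtoC (1 - Cmod tau ^ 2)).
  { rewrite RtoC_minus, Cmod2_conj. reflexivity. }
  assert (Ht1 := Cmod_sqr_lt_1 tau Ht).
  set (d := (1 - Cmod tau ^ 2)%R) in *.
  exists ((1 - r) / (4 * beta))%R.
  exists (/ Cmod mu + 8 / (beta * m * d) + 16 / (Cmod mu * m * d))%R.
  split; [apply Rdiv_lt_0_compat; lra|].
  intros z Hz Hrz. split.
  { apply Rle_trans with ((1 - Cmod (mob tau z)) / (4 * beta))%R.
    - apply Rmult_le_compat_r; [|lra]. left. apply Rinv_0_lt_compat. lra.
    - apply spiral_quotient_Re_ge with f; auto. }
  assert (Hf0 := generator_bound_neq_0 f beta z Hb Hf Hz).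
  assert (Hfm := generator_bound_Cmod f beta z Hf Hz).
  assert (Hzm := one_minus_sqr_ge tau z r Ht Hz Hrz Hr). fold m in Hzm.
  assert (H1 := one_minus_neq_0 z Hz).
  assert (H3 := mob_denom_neq_0 tau z Ht (Rlt_le _ _ Hz)).
  assert (Hd0 : RtoC d <> 0) by (intros F; apply RtoC_inj in F; lra).
  assert (EQ : spiral_quotient tau mu Psi' z
    = / mu + (z - tau) * (1 - z * Cconj tau) / (RtoC d * f z)
      + (/ mu + / Cconj mu) * ((1 - Cconj tau) * (z - tau))
        / (RtoC d * (1 - z))).
  { unfold spiral_quotient. rewrite E, Htt by exact Hz. field.
    repeat split; auto. apply Cconj_neq_0, Hmu0. }
  rewrite EQ.
  assert (L1 : (beta * m / 2 <= Cmod (f z))%R).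
  { apply Rle_trans with (2 := Hfm).
    assert (H := Rmult_le_compat_l beta _ _ (Rlt_le _ _ Hb) Hzm). lra. }
  assert (L2 : (m / 2 <= Cmod (1 - z))%R).
  { generalize (Cmod_triangle_rev 1 z). rewrite Cmod_1.
    unfold unit_disc in Hz. generalize (Cmod_ge_0 z). nra. }
  assert (B1 : (Cmod (z - tau) <= 2)%R) by (apply Cmod_le_2; assumption).
  assert (B2 : (Cmod (1 - z * Cconj tau) <= 2)%R).
  { apply Rle_trans with (1 := Cmod_triangle_minus _ _).
    rewrite Cmod_1, Cmod_mult, Cmod_conj. unfold unit_disc in *.
    generalize (Cmod_ge_0 z) (Cmod_ge_0 tau). nra. }
  assert (B3 : (Cmod (1 - Cconj tau) <= 2)%R).
  { apply Rle_trans with (1 := Cmod_triangle_minus _ _).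
    rewrite Cmod_1, Cmod_conj. unfold unit_disc in Ht. lra. }
  assert (B4 : (Cmod (/ mu + / Cconj mu) <= 2 * / Cmod mu)%R).
  { apply Rle_trans with (1 := Cmod_triangle _ _).
    rewrite !Cmod_inv, Cmod_conj by (try apply Cconj_neq_0; exact Hmu0). lra. }
  assert (Hi : (0 < / Cmod mu)%R) by (apply Rinv_0_lt_compat, Hmm).
  assert (Hbm : (0 < beta * m)%R) by (apply Rmult_lt_0_compat; assumption).
  apply Rle_trans with (1 := Cmod_triangle _ _).
  apply Rplus_le_compat; [apply Rle_trans with (1 := Cmod_triangle _ _);
    apply Rplus_le_compat|].
  - rewrite Cmod_inv by exact Hmu0. apply Rle_refl.
  - rewrite Cmod_div, !Cmod_mult, Cmod_R, Rabs_right
      by (try lra; apply Cmult_neq_0; assumption).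
    replace (8 / (beta * m * d))%R with (2 * 2 * / (d * (beta * m / 2)))%R
      by (field; lra).
    apply Rmult_le_compat.
    + apply Rmult_le_pos; apply Cmod_ge_0.
    + left. apply Rinv_0_lt_compat, Rmult_lt_0_compat; lra.
    + apply Rmult_le_compat; try apply Cmod_ge_0; assumption.
    + apply Rinv_le_contravar; [apply Rmult_lt_0_compat; lra|].
      apply Rmult_le_compat_l; lra.
  - rewrite Cmod_div, !Cmod_mult, Cmod_R, Rabs_right
      by (try lra; apply Cmult_neq_0; assumption).
    replace (16 / (Cmod mu * m * d))%R
      with (2 * / Cmod mu * (2 * 2) * / (d * (m / 2)))%R by (field; lra).
    apply Rmult_le_compat.
    + apply Rmult_le_pos; [|apply Rmult_le_pos]; apply Cmod_ge_0.
    + left. apply Rinv_0_lt_compat, Rmult_lt_0_compat; lra.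
    + apply Rmult_le_compat; try apply Cmod_ge_0; try assumption.
      * apply Rmult_le_pos; apply Cmod_ge_0.
      * apply Rmult_le_compat; try apply Cmod_ge_0; assumption.
    + apply Rinv_le_contravar; [apply Rmult_lt_0_compat; lra|].
      apply Rmult_le_compat_l; lra.
Qed.

(** * The functions [h_tau] *)

Lemma log_admissible_linear (tau : C) :
  (Cmod tau <= 1)%R ->
  log_admissible (fun w => 1 - w * Cconj tau) (fun _ => - Cconj tau).
Proof.
  intros Ht. split; [|split].
  - intros z _. eapply is_cderive_eq; [|cderive]. ring.
  - intros r Hr. exists (/ (1 - r))%R. intros z Hz.
    rewrite Cmod_opp, Cmod_conj.
    assert (H : (1 - r <= Cmod (1 - z * Cconj tau))%R).
    { generalize (Cmod_triangle_rev 1 (z * Cconj tau)).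
      rewrite Cmod_1, Cmod_mult, Cmod_conj.
      generalize (Cmod_ge_0 tau) (Cmod_ge_0 z). nra. }
    apply Rle_trans with (/ (1 - r) * (1 - r))%R.
    + rewrite Rinv_l by lra. exact Ht.
    + apply Rmult_le_compat_l; [left; apply Rinv_0_lt_compat; lra|exact H].
  - ring.
Qed.

Lemma log_admissible_one_minus : log_admissible (fun w => 1 - w) (fun _ => - (1)).
Proof.
  split; [|split].
  - intros z _. eapply is_cderive_eq; [|cderive]. ring.
  - intros r Hr. exists (/ (1 - r))%R. intros z Hz.
    rewrite Cmod_opp, Cmod_1.
    assert (H : (1 - r <= Cmod (1 - z))%R).
    { generalize (Cmod_triangle_rev 1 z). rewrite Cmod_1. lra. }
    apply Rle_trans with (/ (1 - r) * (1 - r))%R.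
    + rewrite Rinv_l by lra. apply Rle_refl.
    + apply Rmult_le_compat_l; [left; apply Rinv_0_lt_compat; lra|exact H].
  - ring.
Qed.

(** All that the study of [h_tau] takes from the semigroup is the bound on [f]. *)
Definition starting_function (f h : C -> C) (beta : R) (lambda : C) : Prop :=
  (0 < beta)%R /\ generator_bound f beta /\ Omega_plus beta lambda /\
  holomorphic h /\
  (forall z, unit_disc z -> lambda * h z = C_derive h z * f z) /\
  h 0 = 1.

Lemma starting_function_admissible (f h : C -> C) (beta : R) (lambda : C) :
  starting_function f h beta lambda ->
  log_admissible h (fun z => lambda * h z / f z).
Proof.
  intros (Hb & Hf & Hl & Hh & Heq & H0). split; [|split; [|exact H0]].
  - intros z Hz.
    apply (is_cderive_eq _ _ (C_derive h z)).
    + rewrite (Heq z Hz). field. exact (generator_bound_neq_0 f beta z Hb Hf Hz).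
    + apply C_derive_is, Hh, Hz.
  - intros r Hr. exists (Cmod lambda * (2 / (beta * (1 - r))))%R. intros z Hz.
    assert (Hzd : unit_disc z) by (unfold unit_disc; lra).
    assert (Hf0 := generator_bound_neq_0 f beta z Hb Hf Hzd).
    assert (Hfm := generator_bound_Cmod f beta z Hf Hzd).
    rewrite Cmod_div, Cmod_mult by exact Hf0.
    unfold Rdiv at 1. rewrite !Rmult_assoc.
    apply Rmult_le_compat_l; [apply Cmod_ge_0|].
    rewrite (Rmult_comm (Cmod (h z))).
    apply Rmult_le_compat_r; [apply Cmod_ge_0|].
    replace (2 / (beta * (1 - r)))%R with (/ (beta * (1 - r) / 2))%R
      by (field; lra).
    assert (Hbr : (0 < beta * (1 - r))%R) by (apply Rmult_lt_0_compat; lra).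
    apply Rinv_le_contravar; [lra|].
    apply Rle_trans with (2 := Hfm).
    apply Rmult_le_compat_r; [lra|]. apply Rmult_le_compat_l; [lra|].
    generalize (Cmod_ge_0 z). nra.
Qed.

Lemma starting_function_neq_0 (f h : C -> C) (beta : R) (lambda z : C) :
  starting_function f h beta lambda -> unit_disc z -> h z <> 0.
Proof.
  intros H Hz. rewrite <- (Cexp_log_branch h _ z
    (starting_function_admissible f h beta lambda H) Hz).
  apply Cexp_neq_0.
Qed.

Lemma starting_function_log_derive (f h : C -> C) (beta : R) (lambda z : C) :
  starting_function f h beta lambda -> unit_disc z ->
  is_cderive (log_branch h) z (lambda / f z).
Proof.
  intros H Hz. eapply is_cderive_eq.
  2: exact (log_branch_derive h _ z
       (starting_function_admissible f h beta lambda H) Hz).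
  assert (H0 := starting_function_neq_0 f h beta lambda z H Hz).
  destruct H as (Hb & Hf & _).
  assert (Hf0 := generator_bound_neq_0 f beta z Hb Hf Hz).
  field. auto.
Qed.

Definition log_ratio (tau z : C) : C :=
  log_branch (fun w => 1 - w * Cconj tau) z - log_branch (fun w => 1 - w) z.

Lemma log_ratio_0 (tau : C) : unit_disc tau -> log_ratio tau 0 = 0.
Proof.
  intros Ht. unfold log_ratio.
  rewrite (log_branch_0 _ _ (log_admissible_linear tau (Rlt_le _ _ Ht))).
  rewrite (log_branch_0 _ _ log_admissible_one_minus). ring.
Qed.

Lemma log_ratio_derive (tau z : C) : unit_disc tau -> unit_disc z ->
  is_cderive (log_ratio tau) z
    ((1 - Cconj tau) / ((1 - z * Cconj tau) * (1 - z))).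
Proof.
  intros Ht Hz.
  assert (D1 := log_branch_derive _ _ z
    (log_admissible_linear tau (Rlt_le _ _ Ht)) Hz).
  assert (D2 := log_branch_derive _ _ z log_admissible_one_minus Hz).
  eapply is_cderive_eq; [|exact (is_cderive_minus _ _ _ _ _ D1 D2)].
  cbv beta. field. split; [apply one_minus_neq_0, Hz|].
  apply mob_denom_neq_0; [exact Ht|left; exact Hz].
Qed.

Lemma Cexp_log_ratio (tau z : C) : unit_disc tau -> unit_disc z ->
  Cexp (log_ratio tau z) = (1 - z * Cconj tau) / (1 - z).
Proof.
  intros Ht Hz. unfold log_ratio. rewrite Cexp_minus.
  rewrite (Cexp_log_branch _ _ z (log_admissible_linear tau (Rlt_le _ _ Ht)) Hz).
  rewrite (Cexp_log_branch _ _ z log_admissible_one_minus Hz). reflexivity.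
Qed.

Definition h_tau_exponent (h : C -> C) (lambda mu tau z : C) : C :=
  mu / lambda * log_branch h z + (1 + mu / Cconj mu) * log_ratio tau z.

(** [1 - z conj tau] is both the denominator of [mob tau] and the base of the
    power with exponent [mu / conj mu]. *)
Lemma h_tau_eq (h : C -> C) (lambda mu tau z : C) :
  unit_disc tau -> unit_disc z ->
  h_tau h lambda mu tau z
  = - (1) * mob tau z * Cexp (h_tau_exponent h lambda mu tau z).
Proof.
  intros Ht Hz. unfold h_tau, branch_pow, h_tau_exponent, log_ratio, mob.
  set (Lt := log_branch (fun w => 1 - w * Cconj tau) z).
  set (L1 := log_branch (fun w => 1 - w) z).
  assert (E := Cexp_log_branch _ _ z
    (log_admissible_linear tau (Rlt_le _ _ Ht)) Hz).
  fold Lt in E. cbv beta in E. rewrite <- E.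
  set (c := mu / Cconj mu). set (b := mu / lambda * log_branch h z).
  replace (b + (1 + c) * (Lt - L1)) with (b + (Lt + c * Lt) - (1 + c) * L1)
    by ring.
  rewrite Cexp_minus, !Cexp_plus. field. split; apply Cexp_neq_0.
Qed.

Lemma h_tau_exponent_derive (f h : C -> C) (beta : R) (lambda mu tau z : C) :
  starting_function f h beta lambda -> unit_disc tau -> unit_disc z ->
  is_cderive (h_tau_exponent h lambda mu tau) z
    (mu / f z + (1 + mu / Cconj mu)
       * ((1 - Cconj tau) / ((1 - z * Cconj tau) * (1 - z)))).
Proof.
  intros H Ht Hz.
  assert (D1 := starting_function_log_derive f h beta lambda z H Hz).
  assert (D2 := log_ratio_derive tau z Ht Hz).
  destruct H as (Hb & Hf & Hl & _).
  assert (Hf0 := generator_bound_neq_0 f beta z Hb Hf Hz).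
  apply (is_cderive_eq _ _ (mu / lambda * (lambda / f z) + (1 + mu / Cconj mu)
    * ((1 - Cconj tau) / ((1 - z * Cconj tau) * (1 - z))))).
  { f_equal. field. split; [exact Hf0|apply Hl]. }
  apply (is_cderive_plus (fun z => mu / lambda * log_branch h z)
    (fun z => (1 + mu / Cconj mu) * log_ratio tau z)).
  - apply is_cderive_scal, D1.
  - apply is_cderive_scal, D2.
Qed.

Lemma holomorphic_ext (g k : C -> C) :
  (forall z, unit_disc z -> g z = k z) -> holomorphic g -> holomorphic k.
Proof.
  intros E H z Hz. destruct (ball_open 1 z Hz) as [d [Hd Hb]].
  eapply is_cderive_ex, is_cderive_ext_near; [exact Hd| |].
  - intros y Hy. apply E, Hb, Hy.
  - apply C_derive_is, H, Hz.
Qed.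

Lemma h_tau_holomorphic (f h : C -> C) (beta : R) (lambda mu tau : C) :
  starting_function f h beta lambda -> unit_disc tau ->
  holomorphic (h_tau h lambda mu tau).
Proof.
  intros H Ht.
  apply holomorphic_ext with (g := fun z =>
    - (1) * mob tau z * Cexp (h_tau_exponent h lambda mu tau z)).
  { intros z Hz. symmetry. apply h_tau_eq; assumption. }
  intros z Hz.
  assert (D1 := mob_derive tau z Ht (Rlt_le _ _ Hz)).
  assert (D2 := is_cderive_Cexp_comp _ _ _
    (h_tau_exponent_derive f h beta lambda mu tau z H Ht Hz)).
  eapply is_cderive_ex. cderive.
Qed.

Lemma h_tau_Sp (f h : C -> C) (beta : R) (lambda mu tau : C) :
  starting_function f h beta lambda -> Omega_plus beta mu -> unit_disc tau ->
  univalent (h_tau h lambda mu tau) /\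
  Sp tau (h_tau h lambda mu tau) /\
  h_tau h lambda mu tau tau = 0 /\
  h_tau h lambda mu tau 0 = tau.
Proof.
  intros H Hmu Ht.
  set (Psi' := fun z => mu / f z + (1 + mu / Cconj mu)
    * ((1 - Cconj tau) / ((1 - z * Cconj tau) * (1 - z)))).
  assert (HD : forall z, unit_disc z ->
    is_cderive (h_tau_exponent h lambda mu tau) z (Psi' z)).
  { intros z Hz. eapply h_tau_exponent_derive; eassumption. }
  assert (HE : forall z, unit_disc z -> h_tau h lambda mu tau z
    = - (1) * mob tau z * Cexp (h_tau_exponent h lambda mu tau z)).
  { intros z Hz. apply h_tau_eq; assumption. }
  assert (HB : spiral_bounds tau mu Psi').
  { destruct H as (Hb & Hf & _).
    apply spiral_bounds_of_generator with f beta; auto. }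
  assert (Hn1 : - (1) <> 0).
  { apply Cmod_pos_neq_0. rewrite Cmod_opp, Cmod_1. lra. }
  assert (HU : univalent (h_tau h lambda mu tau)).
  { split; [apply h_tau_holomorphic with f beta; assumption|].
    exact (spiral_univalent tau mu (- (1)) _ _ Psi' Ht (proj2 Hmu) Hn1 HD HE HB). }
  assert (H1 : h_tau h lambda mu tau tau = 0).
  { rewrite HE by exact Ht. unfold mob. replace (tau - tau) with (RtoC 0) by ring.
    unfold Cdiv. ring. }
  split; [exact HU|]. split; [|split; [exact H1|]].
  - split; [|exact H1]. split; [exact HU|]. exists mu. split.
    + apply Omega_plus_Re_pos with beta; [apply H|exact Hmu].
    + exact (spiral_invariant tau mu (- (1)) _ _ Psi' Ht (proj2 Hmu) HD HE HB).
  - assert (Hd0 : unit_disc 0) by (unfold unit_disc; rewrite Cmod_0; lra).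
    rewrite HE by exact Hd0.
    unfold h_tau_exponent. rewrite (log_ratio_0 tau Ht).
    rewrite (log_branch_0 h _ (starting_function_admissible f h beta lambda H)).
    replace (mu / lambda * 0 + (1 + mu / Cconj mu) * 0) with (RtoC 0) by ring.
    rewrite Cexp_0. unfold mob. field.
Qed.

(** * Convergence of [h_tau] to [h] *)

Lemma starting_function_bounded (f h : C -> C) (beta : R) (lambda : C) (r : R) :
  starting_function f h beta lambda -> (0 < r < 1)%R ->
  exists B : R, (0 < B)%R /\ forall z, (Cmod z <= r)%R -> (Cmod (h z) <= B)%R.
Proof.
  intros H Hr.
  destruct (starting_function_admissible f h beta lambda H) as [Hd [HB H0]].
  destruct (HB r (proj2 Hr)) as [M HM].
  exists (exp (Rabs M)). split; [apply exp_pos|]. intros z Hz.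
  destruct (segment_gronwall h (fun z => lambda * h z / f z) M 0 z) as [_ G].
  { intros s Hs.
    assert (Hp : (Cmod (0 + RtoC s * (z - 0)) <= r)%R).
    { apply segment_in_ball; [exact Hs|rewrite Cmod_0; lra|exact Hz]. }
    split; [apply Hd; unfold unit_disc; lra|apply HM, Hp]. }
  rewrite H0, Cmod_1 in G. replace (z - 0) with z in G by ring.
  apply pow2_le_inv; [left; apply exp_pos|].
  apply Rle_trans with (1 := G).
  replace (exp (Rabs M) ^ 2)%R with (exp (2 * Rabs M)).
  2: { replace (2 * Rabs M)%R with (Rabs M + Rabs M)%R by ring.
       rewrite exp_plus. ring. }
  rewrite pow1, Rmult_1_r. apply exp_le.
  assert (Hz0 := Cmod_ge_0 z).
  assert (H1 : (M * Cmod z <= Rabs M * Cmod z)%R)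
    by (apply Rmult_le_compat_r; [exact Hz0|apply Rle_abs]).
  assert (H2 : (Rabs M * Cmod z <= Rabs M * 1)%R)
    by (apply Rmult_le_compat_l; [apply Rabs_pos|lra]).
  lra.
Qed.

Lemma log_ratio_small (tau z : C) (r : R) :
  unit_disc tau -> (Cmod z <= r)%R -> (r < 1)%R ->
  (Cmod (log_ratio tau z) <= Cmod (tau - 1) / (1 - r) ^ 2)%R.
Proof.
  intros Ht Hz Hr.
  assert (Hr0 := Rle_trans _ _ _ (Cmod_ge_0 z) Hz).
  assert (Hp2 : (0 < (1 - r) ^ 2)%R) by (apply pow_lt; lra).
  set (M := (Cmod (tau - 1) / (1 - r) ^ 2)%R).
  assert (HM : (0 <= M)%R).
  { apply Rmult_le_pos; [apply Cmod_ge_0|]. left. apply Rinv_0_lt_compat, Hp2. }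
  assert (H : (Cmod (log_ratio tau z - log_ratio tau 0) <= M * Cmod (z - 0))%R).
  { apply segment_mean_value_le with (g' := fun y =>
      (1 - Cconj tau) / ((1 - y * Cconj tau) * (1 - y))).
    intros s Hs. set (y := 0 + RtoC s * (z - 0)).
    assert (Hy : (Cmod y <= r)%R).
    { apply segment_in_ball; [exact Hs|rewrite Cmod_0; exact Hr0|exact Hz]. }
    assert (Hyd : unit_disc y) by (unfold unit_disc; lra).
    split; [apply log_ratio_derive; assumption|].
    assert (N1 := one_minus_neq_0 y Hyd).
    assert (N2 := mob_denom_neq_0 tau y Ht (Rlt_le _ _ Hyd)).
    rewrite Cmod_div, Cmod_mult by (apply Cmult_neq_0; assumption).
    replace (Cmod (1 - Cconj tau)) with (Cmod (tau - 1)).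
    2: { rewrite Cmod_minus_sym, <- Cmod_conj, Cminus_conj, Cconj_1.
         reflexivity. }
    apply Rmult_le_compat_l; [apply Cmod_ge_0|].
    apply Rinv_le_contravar; [exact Hp2|].
    replace ((1 - r) ^ 2)%R with ((1 - r) * (1 - r))%R by ring.
    apply Rmult_le_compat; try lra.
    - generalize (Cmod_triangle_rev 1 (y * Cconj tau)).
      rewrite Cmod_1, Cmod_mult, Cmod_conj. unfold unit_disc in Ht.
      generalize (Cmod_ge_0 tau) (Cmod_ge_0 y). nra.
    - generalize (Cmod_triangle_rev 1 y). rewrite Cmod_1. lra. }
  rewrite (log_ratio_0 tau Ht) in H.
  replace (log_ratio tau z - 0) with (log_ratio tau z) in H by ring.
  replace (z - 0) with z in H by ring.
  apply Rle_trans with (1 := H).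
  rewrite <- (Rmult_1_r M) at 2. apply Rmult_le_compat_l; [exact HM|lra].
Qed.

(** [h_tau / h = (1 - (1 - tau) / (1 - z)) exp (c log_ratio)], [|c| = 1]. *)
Lemma h_tau_over_h (f h : C -> C) (beta : R) (lambda tau z : C) :
  starting_function f h beta lambda -> unit_disc tau -> unit_disc z ->
  h_tau h lambda lambda tau z - h z
  = h z * ((Cexp (lambda / Cconj lambda * log_ratio tau z) - 1)
           + (tau - 1) / (1 - z)
             * Cexp (lambda / Cconj lambda * log_ratio tau z)).
Proof.
  intros H Ht Hz. rewrite h_tau_eq by assumption.
  unfold h_tau_exponent. set (c := lambda / Cconj lambda).
  assert (Hl : lambda <> 0) by apply H.
  replace (lambda / lambda * log_branch h z + (1 + c) * log_ratio tau z)
    with (log_branch h z + log_ratio tau z + c * log_ratio tau z)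
    by (field; exact Hl).
  rewrite !Cexp_plus, (Cexp_log_branch h _ z
    (starting_function_admissible f h beta lambda H) Hz).
  rewrite Cexp_log_ratio by assumption. unfold mob.
  field. split; [apply one_minus_neq_0, Hz|].
  apply mob_denom_neq_0; [exact Ht|left; exact Hz].
Qed.

Lemma h_tau_cvg_ball (f h : C -> C) (beta : R) (lambda : C) (r eps : R) :
  starting_function f h beta lambda -> (0 < r < 1)%R -> (0 < eps)%R ->
  exists d, (0 < d)%R /\ forall tau, unit_disc tau -> (Cmod (tau - 1) < d)%R ->
    forall z, (Cmod z <= r)%R ->
      (Cmod (h_tau h lambda lambda tau z - h z) < eps)%R.
Proof.
  intros H Hr Heps.
  destruct (starting_function_bounded f h beta lambda r H Hr) as [B [HB Hh]].
  set (e := Rmin 1 (eps / (4 * B))).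
  assert (He : (0 < e)%R).
  { apply Rmin_pos; [lra|]. apply Rdiv_lt_0_compat; lra. }
  assert (He1 : (e <= 1)%R) by apply Rmin_l.
  assert (He2 : (e * (4 * B) <= eps)%R).
  { apply Rle_trans with (eps / (4 * B) * (4 * B))%R.
    - apply Rmult_le_compat_r; [lra|apply Rmin_r].
    - right. field. lra. }
  destruct (is_cderive_cont_at _ _ _ (is_cderive_Cexp 0) e He) as [d0 [Hd0 HE]].
  assert (Hr2 : (0 < (1 - r) ^ 2)%R) by (apply pow_lt; lra).
  exists (Rmin (d0 * (1 - r) ^ 2) (e * (1 - r))). split.
  { apply Rmin_pos; apply Rmult_lt_0_compat; lra. }
  intros tau Ht Htd z Hz.
  destruct (Rmin_Rgt_l _ _ _ Htd) as [Ht1 Ht2].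
  assert (Hzd : unit_disc z) by (unfold unit_disc; lra).
  assert (Hl : lambda <> 0) by apply H.
  rewrite (h_tau_over_h f h beta) by assumption.
  set (x := lambda / Cconj lambda * log_ratio tau z).
  assert (Hx : (Cmod x < d0)%R).
  { unfold x. rewrite Cmod_mult, Cmod_div by (apply Cconj_neq_0, Hl).
    rewrite Cmod_conj. unfold Rdiv at 1.
    rewrite Rinv_r, Rmult_1_l by (apply Rgt_not_eq, Cmod_gt_0, Hl).
    apply Rle_lt_trans with (1 := log_ratio_small tau z r Ht Hz (proj2 Hr)).
    apply Rmult_lt_reg_r with ((1 - r) ^ 2)%R; [exact Hr2|].
    unfold Rdiv. rewrite Rmult_assoc, Rinv_l, Rmult_1_r by lra. exact Ht1. }
  assert (HX : (Cmod (Cexp x - 1) < e)%R).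
  { rewrite <- Cexp_0. apply HE. replace (x - 0) with x by ring. exact Hx. }
  assert (HX2 : (Cmod (Cexp x) <= 2)%R).
  { generalize (Cmod_triangle_rev (Cexp x) 1). rewrite Cmod_1. lra. }
  assert (HQ : (Cmod ((tau - 1) / (1 - z)) <= e)%R).
  { assert (N1 := one_minus_neq_0 z Hzd).
    assert (Hm := proj1 (Cmod_gt_0 _) N1).
    rewrite Cmod_div by exact N1.
    apply Rmult_le_reg_r with (Cmod (1 - z)); [exact Hm|].
    unfold Rdiv. rewrite Rmult_assoc, Rinv_l, Rmult_1_r by lra.
    apply Rle_trans with (e * (1 - r))%R; [lra|].
    apply Rmult_le_compat_l; [lra|].
    generalize (Cmod_triangle_rev 1 z). rewrite Cmod_1. lra. }
  rewrite Cmod_mult.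
  apply Rle_lt_trans with (B * Cmod (Cexp x - 1 + (tau - 1) / (1 - z) * Cexp x))%R.
  { apply Rmult_le_compat_r; [apply Cmod_ge_0|apply Hh, Hz]. }
  apply Rlt_le_trans with (B * (e + e * 2))%R.
  - apply Rmult_lt_compat_l; [exact HB|].
    apply Rle_lt_trans with (1 := Cmod_triangle _ _).
    rewrite Cmod_mult.
    apply Rplus_lt_le_compat; [exact HX|].
    apply Rmult_le_compat; try apply Cmod_ge_0; assumption.
  - assert (0 < B * e)%R by (apply Rmult_lt_0_compat; assumption). lra.
Qed.

(** The discs [|z| < r] with [r < 1] cover a compact subset of the unit disc. *)
Lemma compact_in_ball (K : C -> Prop) :
  compact_set K -> (forall z, K z -> unit_disc z) ->
  exists r, (0 < r < 1)%R /\ forall z, K z -> (Cmod z <= r)%R.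
Proof.
  intros HK Hd.
  set (cover := fun U : C -> Prop => exists r, (r < 1)%R /\
    forall z, U z <-> (Cmod z < r)%R).
  destruct (HK cover) as [l [Hl Hcov]].
  - intros U [r [_ HU]] z Hz. apply locally_Cmod.
    apply HU in Hz. destruct (ball_open r z Hz) as [d [Hd0 Hb]].
    exists d. split; [exact Hd0|]. intros y Hy. apply HU, Hb, Hy.
  - intros z Hz. specialize (Hd z Hz). unfold unit_disc in Hd.
    exists (fun y => (Cmod y < (1 + Cmod z) / 2)%R). split; [|lra].
    exists ((1 + Cmod z) / 2)%R. split; [lra|]. intros y. tauto.
  - assert (Hr : exists r, (0 < r < 1)%R /\
      forall U, In U l -> forall z, U z -> (Cmod z <= r)%R).
    { clear Hcov. induction Hl as [|U l HU Hl IH].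
      - exists (/ 2)%R. split; [lra|]. intros U [].
      - destruct IH as [r [Hr IH]]. destruct HU as [s [Hs HU]].
        exists (Rmax r s). split.
        + split; [generalize (Rmax_l r s); lra|apply Rmax_lub_lt; lra].
        + intros V [<-|HV] z Hz.
          * apply HU in Hz. generalize (Rmax_r r s). lra.
          * generalize (IH V HV z Hz) (Rmax_l r s). lra. }
    destruct Hr as [r [Hr Hall]]. exists r. split; [exact Hr|].
    intros z Hz. destruct (Hcov z Hz) as [U [HU HUz]]. exact (Hall U HU z HUz).
Qed.

Lemma h_tau_cvg (f h : C -> C) (beta : R) (lambda : C) :
  starting_function f h beta lambda ->
  cvg_on_compacts (fun tau => h_tau h lambda lambda tau)
    (within unit_disc (locally (RtoC 1))) h.
Proof.
  intros H K HK Hd eps.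
  destruct (compact_in_ball K HK Hd) as [r [Hr HKr]].
  destruct (h_tau_cvg_ball f h beta lambda r eps H Hr (cond_pos eps))
    as [d [Hd0 Hcv]].
  apply locally_Cmod. exists d. split; [exact Hd0|].
  intros tau Htd Ht z Hz. apply Hcv; auto.
Qed.

(** * Univalence of the limit *)

(** Hurwitz: near a point [z1] where [g' <> 0], every holomorphic function
    uniformly close to [g] takes the value [g z1]; otherwise the reciprocal of
    its difference with [g z1] violates the maximum principle on a small disc
    around [z1]. *)
Lemma hurwitz (g : C -> C) (z1 l : C) (rho : R) :
  unit_disc z1 -> is_cderive g z1 l -> l <> 0 -> (0 < rho)%R ->
  exists eta r, (0 < eta)%R /\ (0 < r < 1)%R /\
    forall G, holomorphic G ->
      (forall z, (Cmod z <= r)%R -> (Cmod (G z - g z) < eta)%R) ->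
      exists z, unit_disc z /\ (Cmod (z - z1) < rho)%R /\ G z = g z1.
Proof.
  intros Hz1 Hg Hl Hrho. unfold unit_disc in Hz1.
  assert (Hlm := proj1 (Cmod_gt_0 _) Hl).
  destruct (proj1 (is_cderive_eps _ _ _) Hg (Cmod l / 2)%R) as [d [Hd Hb]]; [lra|].
  set (r := Rmin (d / 2) (Rmin (rho / 2) ((1 - Cmod z1) / 2))).
  assert (Hr : (0 < r)%R) by (repeat apply Rmin_pos; lra).
  assert (Hr1 : (r <= d / 2)%R) by apply Rmin_l.
  assert (Hr2 : (r <= rho / 2)%R)
    by (eapply Rle_trans; [apply Rmin_r|apply Rmin_l]).
  assert (Hr3 : (r <= (1 - Cmod z1) / 2)%R)
    by (eapply Rle_trans; [apply Rmin_r|apply Rmin_r]).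
  clearbody r.
  set (m := (Cmod l / 2 * r)%R).
  assert (Hm : (0 < m)%R) by (apply Rmult_lt_0_compat; lra).
  exists (m / 4)%R, ((1 + Cmod z1) / 2)%R.
  assert (Hz0 := Cmod_ge_0 z1).
  split; [lra|]. split; [lra|]. intros G HG Hclose.
  destruct (excluded_middle_informative
    (exists z, (Cmod (z - z1) <= r)%R /\ G z = g z1)) as [[z [Hz E]]|Hno].
  { exists z. split; [|split; [lra|exact E]]. unfold unit_disc.
    generalize (Cmod_triangle_rev z z1). lra. }
  exfalso.
  assert (Hin : forall w, (Cmod w <= r)%R ->
    (Cmod (z1 + w) <= (1 + Cmod z1) / 2)%R).
  { intros w Hw. generalize (Cmod_triangle z1 w). lra. }
  assert (Hne : forall w, (Cmod w <= r)%R -> G (z1 + w) - g z1 <> 0).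
  { intros w Hw. apply C_minus_neq_0. intros E. apply Hno.
    exists (z1 + w). split; [|exact E].
    replace (z1 + w - z1) with w by ring. exact Hw. }
  set (k := fun w => / (G (z1 + w) - g z1)).
  assert (Hk : forall w, (Cmod w <= r)%R -> exists q, is_cderive k w q).
  { intros w Hw. eexists. apply is_cderive_inv; [|apply Hne, Hw].
    apply (is_cderive_minus (fun w => G (z1 + w)));
      [|apply is_cderive_const].
    apply (is_cderive_comp G (fun w => z1 + w)).
    - apply C_derive_is, HG. generalize (Hin w Hw). unfold unit_disc. lra.
    - cderive. }
  assert (Hmax := max_modulus_centre k r 1 (4 / (3 * m)) Hr Rlt_0_1).
  feed Hmax.
  { intros w Hw. destruct (Hk w Hw) as [q Hq]. eapply is_cderive_cont_at, Hq. }
  feed Hmax. { intros w [_ Hw] _. apply Hk, Hw. }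
  feed Hmax.
  { intros w Hw. unfold k.
    assert (Hwr : (Cmod w <= r)%R) by lra.
    rewrite Cmod_inv by (apply Hne, Hwr).
    replace (4 / (3 * m))%R with (/ (m - m / 4))%R by (field; lra).
    apply Rinv_le_contravar; [lra|].
    assert (H1 := Hclose (z1 + w) (Hin w Hwr)).
    assert (H2 := Hb (z1 + w)). replace (z1 + w - z1) with w in H2 by ring.
    specialize (H2 ltac:(lra)). rewrite Hw in H2.
    assert (H3 : (m <= Cmod (g (z1 + w)%C - g z1))%R).
    { generalize (Cmod_triangle_rev (l * w)
        (l * w - (g (z1 + w) - g z1))).
      replace (l * w - (l * w - (g (z1 + w) - g z1)))
        with (g (z1 + w) - g z1) by ring.
      rewrite (Cmod_minus_sym (l * w)), Cmod_mult, Hw. unfold m. lra. }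
    generalize (Cmod_triangle_rev (g (z1 + w) - g z1) (g (z1 + w) - G (z1 + w))).
    replace (g (z1 + w) - g z1 - (g (z1 + w) - G (z1 + w)))
      with (G (z1 + w) - g z1) by ring.
    rewrite (Cmod_minus_sym (g (z1 + w)) (G (z1 + w))). lra. }
  assert (Hw0 : (Cmod 0 <= r)%R) by (rewrite Cmod_0; lra).
  unfold k in Hmax. rewrite Cmod_inv in Hmax by (apply Hne, Hw0).
  assert (H1 := Hclose (z1 + 0) (Hin 0 Hw0)).
  assert (Hp := proj1 (Cmod_gt_0 _) (Hne 0 Hw0)).
  rewrite Cplus_0_r in *.
  assert (H2 : (/ (m / 4) < / Cmod (G z1 - g z1))%R).
  { apply Rinv_lt_contravar; [apply Rmult_lt_0_compat; lra|exact H1]. }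
  assert (H3 : (4 / (3 * m) < / (m / 4))%R).
  { replace (/ (m / 4))%R with (4 / m)%R by (field; lra).
    apply Rmult_lt_compat_l; [lra|].
    apply Rinv_lt_contravar; [nra|lra]. }
  lra.
Qed.

(** The derivative [lambda h / f] does not vanish, so a value taken by [h] at two
    points would be taken near both, by [hurwitz], by the injective [h_tau] with
    [tau] close to [1]. *)
Lemma starting_function_univalent (f h : C -> C) (beta : R) (lambda : C) :
  starting_function f h beta lambda -> univalent h.
Proof.
  intros H. assert (Hs := H). destruct Hs as (Hb & Hf & Hl & Hh & Heq & H0).
  split; [exact Hh|]. intros z1 z2 Hz1 Hz2 E.
  destruct (excluded_middle_informative (z1 = z2)) as [E0|Hne]; [exact E0|].
  exfalso.
  set (rho := (Cmod (z1 - z2) / 2)%R).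
  assert (Hrho : (0 < rho)%R).
  { unfold rho. assert (Hp := proj1 (Cmod_gt_0 _) (C_minus_neq_0 _ _ Hne)). lra. }
  destruct (starting_function_admissible f h beta lambda H) as [Hd _].
  assert (Hd0 : forall z, unit_disc z -> lambda * h z / f z <> 0).
  { intros z Hz. unfold Cdiv.
    assert (Hf0 := generator_bound_neq_0 f beta z Hb Hf Hz).
    apply Cmult_neq_0; [apply Cmult_neq_0|].
    - apply Hl.
    - apply starting_function_neq_0 with f beta lambda; assumption.
    - apply Cmod_pos_neq_0. rewrite Cmod_inv by exact Hf0.
      apply Rinv_0_lt_compat, Cmod_gt_0, Hf0. }
  destruct (hurwitz h z1 _ rho Hz1 (Hd z1 Hz1) (Hd0 z1 Hz1) Hrho)
    as (e1 & r1 & He1 & Hr1 & A1).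
  destruct (hurwitz h z2 _ rho Hz2 (Hd z2 Hz2) (Hd0 z2 Hz2) Hrho)
    as (e2 & r2 & He2 & Hr2 & A2).
  destruct (h_tau_cvg_ball f h beta lambda (Rmax r1 r2) (Rmin e1 e2) H)
    as [d [Hd1 Hcv]].
  { split; [generalize (Rmax_l r1 r2); lra|apply Rmax_lub_lt; lra]. }
  { apply Rmin_pos; assumption. }
  set (t := (Rmin d 1 / 2)%R).
  assert (Ht : (0 < t /\ t < d /\ t < 1)%R).
  { unfold t. generalize (Rmin_pos d 1 Hd1 Rlt_0_1) (Rmin_l d 1) (Rmin_r d 1).
    lra. }
  set (tau := RtoC (1 - t)).
  assert (Htau : unit_disc tau).
  { unfold unit_disc, tau. rewrite Cmod_R, Rabs_right; lra. }
  assert (Htd : (Cmod (tau - 1) < d)%R).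
  { unfold tau. rewrite <- RtoC_minus, Cmod_R, Rabs_left; lra. }
  specialize (Hcv tau Htau Htd).
  destruct (h_tau_Sp f h beta lambda lambda tau H Hl Htau) as [[HG Hinj] _].
  destruct (A1 _ HG) as (y1 & Hy1 & Hc1 & E1).
  { intros z Hz. generalize (Rmin_l e1 e2) (Hcv z (Rle_trans _ _ _ Hz (Rmax_l _ _))).
    lra. }
  destruct (A2 _ HG) as (y2 & Hy2 & Hc2 & E2).
  { intros z Hz. generalize (Rmin_r e1 e2) (Hcv z (Rle_trans _ _ _ Hz (Rmax_r _ _))).
    lra. }
  assert (Ey : y1 = y2).
  { apply Hinj; [exact Hy1|exact Hy2|]. rewrite E1, E2. exact E. }
  subst y2.
  generalize (Cmod_triangle_minus (y1 - z2) (y1 - z1)).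
  replace (y1 - z2 - (y1 - z1)) with (z1 - z2) by ring.
  unfold rho in *. lra.
Qed.

(** * The semigroup acts on [h] by the spiral *)

(** The derivative of a semigroup in time is one-sided, so the mean value
    theorem is replaced by an argument on the supremum of the times up to which
    [Y] has moved by at most [eps s]. *)
Lemma right_derivative_0_const (Y : R -> C) :
  (forall c eps, (0 < c)%R -> (0 < eps)%R -> exists d, (0 < d)%R /\
     forall s, (0 <= s)%R -> (c - d < s <= c)%R -> (Cmod (Y s - Y c) < eps)%R) ->
  (forall t eps, (0 <= t)%R -> (0 < eps)%R -> exists d, (0 < d)%R /\
     forall u, (0 < u < d)%R -> (Cmod (Y (t + u)%R - Y t) <= eps * u)%R) ->
  forall t, (0 <= t)%R -> Y t = Y 0%R.
Proof.
  intros Hc Hd T HT.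
  assert (Hbound : forall eps, (0 < eps)%R -> (Cmod (Y T - Y 0%R) <= eps * T)%R).
  { intros eps Heps.
    set (S := fun t => (0 <= t <= T)%R /\
      forall s, (0 <= s <= t)%R -> (Cmod (Y s - Y 0%R) <= eps * s)%R).
    assert (HS0 : S 0%R).
    { split; [lra|]. intros s Hs. replace s with 0%R by lra.
      replace (Y 0%R - Y 0%R) with (RtoC 0) by ring. rewrite Cmod_0. lra. }
    destruct (completeness S) as [c [Hub Hlub]].
    { exists T. intros t [Ht _]. lra. }
    { exists 0%R. exact HS0. }
    assert (Hc0 : (0 <= c)%R) by (apply Hub, HS0).
    assert (HcT : (c <= T)%R) by (apply Hlub; intros t [Ht _]; lra).
    assert (Hbelow : forall s, (0 <= s < c)%R -> (Cmod (Y s - Y 0%R) <= eps * s)%R).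
    { intros s Hs.
      destruct (Rle_lt_dec (Cmod (Y s - Y 0%R)) (eps * s)) as [H|H]; [exact H|].
      exfalso. assert (c <= s)%R; [|lra].
      apply Hlub. intros t [Ht HSt].
      destruct (Rle_lt_dec t s) as [Hts|Hts]; [exact Hts|].
      specialize (HSt s ltac:(lra)). lra. }
    assert (Hat : (Cmod (Y c - Y 0%R) <= eps * c)%R).
    { destruct (Req_dec c 0) as [->|Hcn].
      { apply HS0. lra. }
      apply le_epsilon. intros e He.
      destruct (Hc c e) as [d [Hd0 H]]; [lra|exact He|].
      set (s := Rmax 0 (c - d / 2)).
      assert (Hs : (0 <= s < c /\ c - d < s)%R).
      { unfold s. split; [split; [apply Rmax_l|apply Rmax_lub_lt; lra]|].
        generalize (Rmax_r 0 (c - d / 2)). lra. }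
      assert (H1 := H s ltac:(lra) ltac:(lra)).
      assert (H2 := Hbelow s ltac:(lra)).
      replace (Y c - Y 0%R) with ((Y s - Y 0%R) - (Y s - Y c)) by ring.
      apply Rle_trans with (1 := Cmod_triangle_minus _ _).
      assert (eps * s <= eps * c)%R by (apply Rmult_le_compat_l; lra).
      lra. }
    destruct (Req_dec c T) as [E|E]; [rewrite <- E; exact Hat|].
    exfalso.
    destruct (Hd c eps Hc0 Heps) as [d [Hd0 H]].
    set (t := Rmin T (c + d / 2)).
    assert (Ht : (c < t <= T /\ t < c + d)%R).
    { unfold t. split; [split; [apply Rmin_glb_lt; lra|apply Rmin_l]|].
      generalize (Rmin_r T (c + d / 2)). lra. }
    assert (HSt : S t).
    { split; [lra|]. intros s Hs.
      destruct (Rlt_le_dec s c) as [H1|H1]; [apply Hbelow; lra|].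
      destruct (Req_dec s c) as [->|H2]; [exact Hat|].
      specialize (H (s - c)%R ltac:(lra)).
      replace (c + (s - c))%R with s in H by ring.
      replace (Y s - Y 0%R) with ((Y s - Y c) + (Y c - Y 0%R)) by ring.
      apply Rle_trans with (1 := Cmod_triangle _ _). lra. }
    apply Hub in HSt. lra. }
  assert (H0 : Cmod (Y T - Y 0%R) = 0%R).
  { apply Rle_antisym; [|apply Cmod_ge_0]. apply le_epsilon. intros e He.
    apply Rle_trans with (e / (T + 1) * T)%R.
    - apply Hbound, Rdiv_lt_0_compat; lra.
    - rewrite Rplus_0_l. replace e with (e / (T + 1) * (T + 1))%R at 2
        by (field; lra).
      apply Rmult_le_compat_l; [left; apply Rdiv_lt_0_compat|]; lra. }
  apply Cmod_eq_0 in H0.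
  replace (Y T) with (Y T - Y 0%R + Y 0%R) by ring. rewrite H0. ring.
Qed.

(** Along a trajectory [dz/dt = - f z], so [log h], whose derivative is
    [lambda / f], decreases at the constant rate [lambda]. *)
Lemma log_branch_flow (F : R -> C -> C) (f h : C -> C) (beta : R) (lambda z : C)
    (t : R) :
  starting_function f h beta lambda -> semigroup F ->
  (forall z, unit_disc z ->
     filterlim (fun t : R => (z - F t z) / RtoC t) (at_right 0)
       (@locally C_UniformSpace (f z))) ->
  unit_disc z -> (0 <= t)%R ->
  log_branch h (F t z) = log_branch h z - RtoC t * lambda.
Proof.
  intros H HF Hf Hz Ht.
  set (Y := fun t : R => log_branch h (F t z) + RtoC t * lambda).
  assert (HFz : forall t, (0 <= t)%R -> unit_disc (F t z)).
  { intros s Hs. apply (sg_disc F HF); assumption. }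
  assert (HY : Y t = Y 0%R).
  { apply right_derivative_0_const; [| |exact Ht].
    - intros c eps Hc Heps.
      assert (HL := is_cderive_cont_at _ _ _
        (starting_function_log_derive f h beta lambda (F c z) H
          (HFz c (Rlt_le _ _ Hc)))).
      destruct (HL (eps / 2)%R ltac:(lra)) as [d1 [Hd1 H1]].
      assert (HFc := sg_cont F HF c z (Rlt_le _ _ Hc) Hz).
      assert (HP : @locally C_UniformSpace (F c z)
        (fun y => (Cmod (y - F c z) < d1)%R)).
      { apply locally_Cmod. exists d1. auto. }
      destruct (HFc _ HP) as [d2 Hd2].
      assert (Hl1 : (0 < 1 + Cmod lambda)%R)
        by (generalize (Cmod_ge_0 lambda); lra).
      exists (Rmin d2 (eps / 2 / (1 + Cmod lambda))). split.
      { apply Rmin_pos; [apply cond_pos|]. apply Rdiv_lt_0_compat; lra. }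
      intros s Hs0 Hs.
      assert (Hsa : (c - s < d2)%R).
      { generalize (Rmin_l d2 (eps / 2 / (1 + Cmod lambda))). lra. }
      assert (Hsb : (c - s < eps / 2 / (1 + Cmod lambda))%R).
      { generalize (Rmin_r d2 (eps / 2 / (1 + Cmod lambda))). lra. }
      assert (HFs : (Cmod (F s z - F c z) < d1)%R).
      { apply Hd2; [|exact Hs0]. change (Rabs (s - c) < d2)%R.
        rewrite Rabs_left1; lra. }
      unfold Y.
      replace (log_branch h (F s z) + RtoC s * lambda
        - (log_branch h (F c z) + RtoC c * lambda))
        with ((log_branch h (F s z) - log_branch h (F c z))
              + RtoC (s - c) * lambda) by (rewrite RtoC_minus; ring).
      apply Rle_lt_trans with (1 := Cmod_triangle _ _).
      rewrite Cmod_mult, Cmod_R, Rabs_left1 by lra.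
      assert (H2 := H1 _ HFs).
      assert (H3 : (- (s - c) * Cmod lambda <= eps / 2)%R).
      { apply Rle_trans with (eps / 2 / (1 + Cmod lambda) * (1 + Cmod lambda))%R.
        - apply Rmult_le_compat; [lra|apply Cmod_ge_0|lra|lra].
        - right. field. lra. }
      lra.
    - intros s eps Hs Heps.
      set (p := F s z). assert (Hp : unit_disc p) by (apply HFz, Hs).
      assert (Hf0 : f p <> 0).
      { destruct H as (Hb & Hg & _). exact (generator_bound_neq_0 f beta p Hb Hg Hp). }
      assert (HD := starting_function_log_derive f h beta lambda p H Hp).
      set (l := lambda / f p) in *.
      set (m := (Cmod (f p) + 1)%R).
      assert (Hm : (0 < m)%R) by (unfold m; generalize (Cmod_ge_0 (f p)); lra).
      assert (Hl1 : (0 < 1 + Cmod l)%R) by (generalize (Cmod_ge_0 l); lra).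
      destruct (proj1 (is_cderive_eps _ _ _) HD (eps / 2 / m)%R)
        as [d1 [Hd1 H1]]; [apply Rdiv_lt_0_compat; lra|].
      set (e := Rmin 1 (eps / 2 / (1 + Cmod l))).
      assert (He : (0 < e)%R).
      { apply Rmin_pos; [lra|]. apply Rdiv_lt_0_compat; lra. }
      assert (HP : @locally C_UniformSpace (f p)
        (fun y => (Cmod (y - f p) < e)%R)).
      { apply locally_Cmod. exists e. auto. }
      destruct (Hf p Hp _ HP) as [d2 Hd2].
      exists (Rmin d2 (d1 / m)). split.
      { apply Rmin_pos; [apply cond_pos|]. apply Rdiv_lt_0_compat; lra. }
      intros u [Hu0 Hu].
      destruct (Rmin_Rgt_l _ _ _ Hu) as [Hu2 Hu1].
      assert (Hq : (Cmod ((p - F u p) / RtoC u - f p) < e)%R).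
      { apply Hd2; [|exact Hu0]. change (Rabs (u - 0) < d2)%R.
        rewrite Rminus_0_r, Rabs_right; lra. }
      set (q := (p - F u p) / RtoC u) in *.
      assert (Hu' : RtoC u <> 0) by (intros E; apply RtoC_inj in E; lra).
      assert (EF : F u p - p = - (RtoC u * q)) by (unfold q; field; exact Hu').
      assert (Hqm : (Cmod q <= m)%R).
      { generalize (Cmod_triangle_rev q (f p)) (Rmin_l 1 (eps / 2 / (1 + Cmod l))).
        fold e. unfold m. lra. }
      assert (HFm : (Cmod (F u p - p) <= u * m)%R).
      { rewrite EF, Cmod_opp, Cmod_mult, Cmod_R, Rabs_right by lra.
        apply Rmult_le_compat_l; lra. }
      assert (H2 := H1 (F u p)). feed H2.
      { apply Rle_lt_trans with (1 := HFm).
        apply Rlt_le_trans with (d1 / m * m)%R.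
        - apply Rmult_lt_compat_r; assumption.
        - right. field. lra. }
      unfold Y.
      replace (F (s + u)%R z) with (F u p)
        by (unfold p; rewrite (Rplus_comm s); symmetry;
            apply (sg_add F HF); [lra|exact Hs|exact Hz]).
      fold p.
      replace (log_branch h (F u p) + RtoC (s + u) * lambda
        - (log_branch h p + RtoC s * lambda))
        with ((log_branch h (F u p) - log_branch h p - l * (F u p - p))
              - RtoC u * (l * (q - f p))).
      2: { rewrite EF, RtoC_plus. unfold l. field. exact Hf0. }
      apply Rle_trans with (1 := Cmod_triangle_minus _ _).
      rewrite !Cmod_mult, Cmod_R, Rabs_right by lra.
      assert (H3 : (eps / 2 / m * Cmod (F u p - p) <= eps / 2 * u)%R).
      { apply Rle_trans with (eps / 2 / m * (u * m))%R.
        - apply Rmult_le_compat_l; [|exact HFm].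
          left. apply Rdiv_lt_0_compat; lra.
        - right. field. lra. }
      assert (H4 : (Cmod l * Cmod (q - f p) <= eps / 2)%R).
      { apply Rle_trans with ((1 + Cmod l) * (eps / 2 / (1 + Cmod l)))%R.
        - apply Rmult_le_compat; try apply Cmod_ge_0; [lra|].
          left. apply Rlt_le_trans with (1 := Hq), Rmin_r.
        - right. field. lra. }
      assert (H5 : (u * (Cmod l * Cmod (q - f p)) <= u * (eps / 2))%R)
        by (apply Rmult_le_compat_l; lra).
      lra. }
  unfold Y in HY. rewrite (sg_id F HF z Hz) in HY.
  replace (log_branch h (F t z))
    with (log_branch h (F t z) + RtoC t * lambda - RtoC t * lambda) by ring.
  rewrite HY. ring.
Qed.

Lemma starting_function_spiral (f h : C -> C) (beta : R) (lambda : C) :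
  generator f -> starting_function f h beta lambda ->
  forall z t, unit_disc z -> (0 <= t)%R ->
    image_disc h (Cexp (- (RtoC t * lambda)) * h z).
Proof.
  intros [F [HF Hf]] H z t Hz Ht.
  assert (Hd : unit_disc (F t z)) by (apply (sg_disc F HF); assumption).
  exists (F t z). split; [exact Hd|].
  assert (Ha := starting_function_admissible f h beta lambda H).
  rewrite <- (Cexp_log_branch h _ (F t z) Ha Hd).
  rewrite <- (Cexp_log_branch h _ z Ha Hz).
  rewrite (log_branch_flow F f h beta lambda z t H HF Hf Hz Ht).
  rewrite <- Cexp_plus. f_equal. ring.
Qed.

(** The spiral through [h 0 = 1] runs into [0], which [h] does not take. *)
Lemma starting_function_boundary (f h : C -> C) (beta : R) (lambda : C) :
  generator f -> starting_function f h beta lambda ->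
  boundary (image_disc h) 0.
Proof.
  intros Hgen H P HP. split.
  - apply locally_Cmod in HP. destruct HP as [d [Hd HP]].
    assert (Hl : (0 < Re lambda)%R).
    { apply Omega_plus_Re_pos with beta; apply H. }
    assert (Hd0 : unit_disc 0) by (unfold unit_disc; rewrite Cmod_0; lra).
    set (t := Rmax 0 ((1 - ln d) / Re lambda)).
    assert (Ht : (0 <= t)%R) by apply Rmax_l.
    exists (Cexp (- (RtoC t * lambda)) * h 0). split.
    + apply HP.
      replace (h 0) with (RtoC 1) by (symmetry; apply H).
      replace (Cexp (- (RtoC t * lambda)) * 1 - 0)
        with (Cexp (- (RtoC t * lambda))) by ring.
      rewrite Cmod_Cexp, re_opp, re_scal_l.
      rewrite <- (exp_ln d Hd). apply exp_increasing.
      assert (H1 : ((1 - ln d) / Re lambda <= t)%R) by apply Rmax_r.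
      apply Rmult_le_compat_r with (r := Re lambda) in H1; [|lra].
      unfold Rdiv in H1. rewrite Rmult_assoc, Rinv_l in H1 by lra. lra.
    + apply starting_function_spiral with f beta; assumption.
  - exists (RtoC 0). split; [apply locally_singleton, HP|].
    intros [z [Hz E]].
    exact (starting_function_neq_0 f h beta lambda z H Hz E).
Qed.

Lemma starting_function_starlike (f h : C -> C) (beta : R) (lambda : C) :
  generator f -> starting_function f h beta lambda -> Im lambda = 0%R ->
  starlike h.
Proof.
  intros Hgen H Him. split; [exact (starting_function_univalent f h beta lambda H)|].
  intros z t Hz Ht.
  assert (Hl : (0 < Re lambda)%R).
  { apply Omega_plus_Re_pos with beta; apply H. }
  set (s := (- ln t / Re lambda)%R).
  assert (Hs : (0 <= s)%R).
  { apply Rmult_le_pos; [|left; apply Rinv_0_lt_compat, Hl].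
    assert (ln t <= ln 1)%R by (apply ln_le; lra). rewrite ln_1 in *. lra. }
  replace (RtoC t) with (Cexp (- (RtoC s * lambda))).
  - apply starting_function_spiral with f beta; assumption.
  - assert (Hre : Re (- (RtoC s * lambda)) = ln t).
    { rewrite re_opp, re_scal_l. unfold s. field. lra. }
    assert (Hi : Im (- (RtoC s * lambda)) = 0%R).
    { rewrite im_opp, im_scal_l, Him. ring. }
    apply C_eq_Re_Im; rewrite ?Re_Cexp, ?Im_Cexp, Hre, Hi, exp_ln by lra.
    + rewrite cos_0. simpl. ring.
    + rewrite sin_0. simpl. ring.
Qed.

Theorem theorem3p5 (f h : C -> C) (beta : R) (lambda : C)
  (hf : generator_plus1 f beta)
  (hlambda : Omega_plus beta lambda)
  (h_holo : holomorphic h)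
  (h_eq : forall z, unit_disc z -> lambda * h z = C_derive h z * f z)
  (h_at0 : h 0 = 1)
  (h_at1 : angular_lim h 0) :
  (forall z, unit_disc z -> h z <> 0) /\
  (forall mu tau : C, Omega_plus beta mu -> unit_disc tau ->
     univalent (h_tau h lambda mu tau) /\
     Sp tau (h_tau h lambda mu tau) /\
     h_tau h lambda mu tau tau = 0 /\
     h_tau h lambda mu tau 0 = tau) /\
  cvg_on_compacts (fun tau => h_tau h lambda lambda tau)
    (within unit_disc (locally (RtoC 1))) h /\
  univalent h /\
  spirallike_boundary h /\
  (Im lambda = 0%R -> starlike_boundary h) /\
  angular_lim h 0.
Proof.
  assert (Hgen : generator f) by apply hf.
  assert (H : starting_function f h beta lambda).
  { split; [apply hf|]. split; [|auto].
    intros z Hz. apply generator_plus1_bound; assumption. }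
  assert (Hb := starting_function_boundary f h beta lambda Hgen H).
  assert (Hu := starting_function_univalent f h beta lambda H).
  split; [|split; [|split; [|split; [exact Hu|split; [|split]]]]].
  - intros z. exact (starting_function_neq_0 f h beta lambda z H).
  - intros mu tau. exact (h_tau_Sp f h beta lambda mu tau H).
  - exact (h_tau_cvg f h beta lambda H).
  - split; [|exact Hb]. split; [exact Hu|]. exists lambda. split.
    + apply Omega_plus_Re_pos with beta; apply H.
    + exact (starting_function_spiral f h beta lambda Hgen H).
  - intros Him. split; [|exact Hb].
    exact (starting_function_starlike f h beta lambda Hgen H Him).
  - exact h_at1.
Qed.
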